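(* There is a universal constant $C>0$ such that for every $n\ge1$ and every square-integrable martingale difference sequence $Y=\{Y_m\}_{m=1}^n$ with $s_n>0$, $$\mathcal W_3(X_n,\mathcal N)\le C\Big(L_3+\|V_n^2-1\|_{3/2}^{1/2}\Big).$$
   Context: Martingale setting: $Y=\{Y_m\}_{m=1}^n$ is a square-integrable martingale difference sequence with respect to $\sigma$-fields $\{\mathcal F_m\}_{m=0}^n$, where $\mathcal F_0$ is trivial. Put $s_n^2=\sum_{i=1}^nE[Y_i^2]$, $\sigma_i^2(Y)=E[Y_i^2\mid\mathcal F_{i-1}]$, $V_n^2=\frac1{s_n^2}\sum_{i=1}^n\sigma_i^2(Y)$, $X_n=\frac1{s_n}\sum_{i=1}^nY_i$. $\mathcal N$ denotes a standard normal $N(0,1)$ random variable. For a random variable $U$ and $r>0$, $\|U\|_r=E[|U|^r]^{1/r}$. The Wasserstein distance of order $r\ge1$ is $\mathcal W_r(\mu,\nu)=\inf\{\|U-V\|_r:U\sim\mu,V\sim\nu\}$; random variables are used as synonyms of their distributions. The Lyapunov coefficient is $L_3=\frac1{s_n}\big(\sum_{i=1}^nE|Y_i|^3\big)^{1/3}$ (possibly $+\infty$, in which case the bound is trivial). *)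

(* Defs.v *)
(* MathComp-Analysis, over an arbitrary R : realType. *)
From HB Require Import structures.
From mathcomp Require Export all_boot all_order all_algebra.
From mathcomp Require Export all_classical all_reals all_analysis.
From mathcomp Require Export measurable_realfun.

Set Implicit Arguments.
Unset Strict Implicit.
Unset Printing Implicit Defensive.

Import Order.TTheory GRing.Theory Num.Theory.
Import numFieldNormedType.Exports.

Local Open Scope classical_set_scope.
Local Open Scope ring_scope.

Section Wasserstein.
Context {R : realType}.
Local Open Scope ereal_scope.

(* Laws are compared on Borel sets only: the values that a measure takes on
   non-measurable sets are meaningless. *)
Definition has_law d (T : measurableType d) (P : probability T R)
    (U : {RV P >-> R}) (mu : probability R R) : Prop :=
  forall A : set R, measurable A -> distribution P U A = mu A.

(* The infimum ranges over all pairs (U, V) defined on a common, arbitrary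
   probability space; it takes its values in the extended reals. *)
Definition wasserstein (r : R) (mu nu : probability R R) : \bar R :=
  ereal_inf [set x | exists d, exists T : measurableType d,
    exists P : probability T R, exists U : {RV P >-> R},
    exists V : {RV P >-> R},
      [/\ has_law U mu, has_law V nu &
          x = 'N[P]_(r%:E)[(fun w => (U w - V w)%:E)]]].

End Wasserstein.

Section StandardNormal.
Context {R : realType}.

(* [normal_prob] lives on [measurableTypeR R], whose measurable sets are those
   of [R] but whose display differs; the identity transports it to [R]. *)
Let idTR : measurableTypeR R -> R := idfun.

#[local] HB.instance Definition _ :=
  @isMeasurableFun.Build _ _ _ _ idTR (@measurable_id _ _ setT).

Definition standard_normal : probability R R :=
  distribution (normal_prob 0 1 : probability (measurableTypeR R) R) idTR.

End StandardNormal.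

Section Martingale.
Context {R : realType} d (T : measurableType d) (P : probability T R).
Implicit Types (G : set (set T)) (X Z : T -> R) (n : nat).

Definition sub_sigma_field G : Prop :=
  sigma_algebra [set: T] G /\ G `<=` @measurable d T.

(* [Z] is a version of E[X | G], for X integrable; versions of a conditional
   expectation agree only almost surely. *)
Definition is_cond_exp G X Z : Prop :=
  [/\ g_sigma_algebra_preimage Z `<=` G,
      Z \in Lfun P 1%E &
      forall A, G A ->
        (\int[P]_(w in A) (Z w)%:E = \int[P]_(w in A) (X w)%:E)%E].

(* Sequences are indexed by nat; only F_0, ..., F_n and Y_1, ..., Y_n matter. *)
Definition filtration n (F : nat -> set (set T)) : Prop :=
  (forall m, (m <= n)%N -> sub_sigma_field (F m)) /\
  (forall m, (m < n)%N -> F m `<=` F m.+1).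

Definition trivial_sigma_field G : Prop := G = [set set0; [set: T]].

Definition martingale_difference n (F : nat -> set (set T))
    (Y : nat -> {RV P >-> R}) : Prop :=
  forall m, (0 < m <= n)%N ->
    [/\ g_sigma_algebra_preimage (Y m) `<=` F m,
        (Y m : T -> R) \in Lfun P 1%E &
        is_cond_exp (F m.-1) (Y m) (cst 0)].

Definition square_integrable n (Y : nat -> {RV P >-> R}) : Prop :=
  forall m, (0 < m <= n)%N -> (Y m : T -> R) \in Lfun P 2%:E.

Definition sn2 n (Y : nat -> {RV P >-> R}) : R :=
  \sum_(1 <= i < n.+1) fine 'E_P[(fun w => Y i w ^+ 2)].

Definition sn n (Y : nat -> {RV P >-> R}) : R := Num.sqrt (sn2 n Y).

Definition Xn n (Y : nat -> {RV P >-> R}) : {RV P >-> R} :=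
  (sn n Y)^-1 *: \sum_(1 <= i < n.+1) (Y i : {mfun T >-> R}).

(* [sigma2 i] is a version of E[Y_i^2 | F_(i-1)]. *)
Definition conditional_variances n (F : nat -> set (set T))
    (Y : nat -> {RV P >-> R}) (sigma2 : nat -> T -> R) : Prop :=
  forall i, (0 < i <= n)%N ->
    is_cond_exp (F i.-1) (fun w => Y i w ^+ 2) (sigma2 i).

Definition Vn2 n (Y : nat -> {RV P >-> R}) (sigma2 : nat -> T -> R)
    (w : T) : R :=
  (sn2 n Y)^-1 * \sum_(1 <= i < n.+1) sigma2 i w.

Definition L3 n (Y : nat -> {RV P >-> R}) : \bar R :=
  ((sn n Y)^-1%:E *
   (\sum_(1 <= i < n.+1) 'E_P[(fun w => `|Y i w| ^+ 3)%R]) `^ 3^-1%R)%E.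

End Martingale.

(* Main.v *)
(* Couple X_n and N by their quantile functions, as U and V on [0, 1]. Since U and V
   are both nondecreasing, the difference U - V is a 2-Lipschitz function D of the
   midpoint (U + V) / 2, whence D has the sign of U - V on the whole interval between
   U and V, and is of order U - V near its midpoint. A function g with g' comparable
   to D |D| therefore satisfies g(U) - g(V) >= c |U - V|^3, and E|U - V|^3 is bounded
   by a multiple of E g(X_n) - E g(N). Adding dyadic bumps, g can be taken with a
   universally Lipschitz second derivative and |g'| <= C D^2, |g''| <= C |D|.

   Lindeberg's method bounds the last difference. With normalized steps y_i and
   conditional variances q_i, the steps are kept only while the accumulated q_i
   stays below 1 and the missing variance is filled by an independent normal
   variable: this costs C (E|y_i|^3 + E q_i^{3/2}) per step. The discarded steps and
   the missing variance are controlled in L^3, by a Rosenthal inequality, through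
   E|V_n^2 - 1|^{3/2} and sum E|y_i|^3. Comparing g at X_n and at the stopped sum by
   Taylor and Young costs in addition eps E|D(X_n)|^3 <= 8 eps E|U - V|^3, which is
   absorbed on the left. *)
From HB Require Import structures.
Require Import Defs.
From mathcomp Require Import ring lra.

Set Implicit Arguments.
Unset Strict Implicit.
Unset Printing Implicit Defensive.

Import Order.TTheory GRing.Theory Num.Theory.
Import numFieldNormedType.Exports.

Local Open Scope classical_set_scope.
Local Open Scope ring_scope.

(** For a Lipschitz [D] the product [D * |D|] need not be differentiable, while Lindeberg's method
    wants [g''] Lipschitz with a constant independent of the coupling. Where [|D|] is of order [r],
    however, averaging [D] over a length proportional to [r] moves it only by a fraction of [r], and
    the roughness left is what a bump of height [r ^ 2] tolerates; hence one bump per dyadic [r].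
    Finitely many scales keep [g'] and [g''] bounded, so that all integrals exist, but the gain then
    holds on a bounded range of [|U - V|] only. As no other bound depends on the number of scales, a
    limit removes the restriction.

    The growth bounds in [D] serve the stopping: the discarded sum depends on the kept one, so its
    first-order effect on [g] is not centred, and a merely bounded [g'] would leave a term linear in
    it. With [g'] of order [D ^ 2] every term becomes a cube.

    Absorption needs [E|U - V|^3] finite; this holds once all steps have third moments, and
    otherwise the right-hand side is infinite. Conditional expectations enter only through integrals
    against adapted multipliers, and the normal variable is integrated out, so that no product space
    is formed. *)

Section RealIntegrable.
Context d (T : measurableType d) (R : realType).
Variable m : {measure set T -> \bar R}.
Implicit Types (f g : T -> R) (c : R).

Lemma integrable_realZ c f : m.-integrable setT (EFin \o f) ->
  m.-integrable setT (EFin \o (fun x => c * f x)).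
Proof. by move=> mf; have := integrableZl measurableT c mf. Qed.

Lemma integrable_realD f g : m.-integrable setT (EFin \o f) ->
  m.-integrable setT (EFin \o g) ->
  m.-integrable setT (EFin \o (fun x => f x + g x)).
Proof. by move=> mf mg; have := integrableD measurableT mf mg. Qed.

Lemma integrable_realB f g : m.-integrable setT (EFin \o f) ->
  m.-integrable setT (EFin \o g) ->
  m.-integrable setT (EFin \o (fun x => f x - g x)).
Proof. by move=> mf mg; have := integrableB measurableT mf mg. Qed.

Lemma integrable_real_sum (I : Type) (s : seq I) (h : I -> T -> R) :
  (forall i, m.-integrable setT (EFin \o h i)) ->
  m.-integrable setT (EFin \o (fun x => \sum_(i <- s) h i x)).
Proof.
move=> mh; elim: s => [|i s IH].
  rewrite (_ : EFin \o _ = cst 0%E); first exact: integrable0.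
  by apply/funext => x /=; rewrite big_nil.
rewrite (_ : (fun _ => _) = (fun x => h i x + \sum_(i <- s) h i x)).
  exact: integrable_realD.
by apply/funext => x; rewrite big_cons.
Qed.

Lemma integrable_real_le f g : measurable_fun setT f ->
  m.-integrable setT (EFin \o g) -> (forall x, `|f x| <= g x) ->
  m.-integrable setT (EFin \o f).
Proof.
move=> mf ig fg; apply: (le_integrable measurableT _ _ ig).
  exact/measurable_EFinP.
by move=> x _ /=; rewrite lee_fin (le_trans (fg x)) ?ler_norm.
Qed.

Lemma integrable_real_measurable f :
  m.-integrable setT (EFin \o f) -> measurable_fun setT f.
Proof. by move=> /(measurable_int m)/measurable_EFinP. Qed.

Lemma le_RintegralT f g :
  m.-integrable setT (EFin \o f) -> m.-integrable setT (EFin \o g) ->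
  (forall x, f x <= g x) -> \int[m]_x f x <= \int[m]_x g x.
Proof. by move=> mf mg fg; apply: le_Rintegral. Qed.

Lemma EFin_Rintegral f : m.-integrable setT (EFin \o f) ->
  (\int[m]_x f x)%:E = (\int[m]_x (f x)%:E)%E.
Proof. by move=> mf; rewrite /Rintegral fineK//; exact: integrable_fin_num. Qed.

Lemma ge0_integrable_real f : measurable_fun setT f -> (forall x, 0 <= f x) ->
  (\int[m]_x (f x)%:E < +oo)%E -> m.-integrable setT (EFin \o f).
Proof.
move=> mf f0 fy; apply/integrableP; split; first exact/measurable_EFinP.
by under eq_integral do rewrite /= ger0_norm//.
Qed.

End RealIntegrable.

(** * One-variable calculus *)

Section Calculus.
Context {R : realType}.
Implicit Types (f g F G : R -> R) (x y z l K M B : R).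

(** Meant for [Num.max 0 r ^+ 2], defined by cases: a quadratic remainder is checked by comparing
    signs, with no limit to take at the kink. *)
Lemma is_derive_quadratic f x l K :
  (forall h, `|f (x + h) - f x - l * h| <= K * h ^+ 2) -> is_derive x 1 f l.
Proof.
move=> fK.
have cvgf : h^-1 *: (f (h + x) - f x) @[h --> 0^'] --> l.
  apply/cvgrPdist_le => e e0; near=> h.
  have h0 : h != 0 by near: h; exact: nbhs_dnbhs_neq.
  have hn0 : 0 < `|h| by rewrite normr_gt0.
  have := fK h; rewrite (addrC x) => fKh.
  rewrite distrC.
  have -> : h^-1 *: (f (h + x) - f x) - l = h^-1 * (f (h + x) - f x - l * h).
    by rewrite mulrBr mulrCA mulVf// mulr1.
  rewrite normrM normfV ler_pdivrMl//; apply: (le_trans fKh).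
  rewrite -(real_normK (num_real h)) expr2 mulrA [leRHS]mulrC ler_wpM2r//.
  apply: (@le_trans _ _ ((`|K| + 1) * `|h|)).
    by rewrite ler_wpM2r// (le_trans (ler_norm _))// lerDl.
  have K1 : 0 < `|K| + 1 by rewrite ltr_wpDl.
  rewrite -ler_pdivlMl// mulrC.
  by near: h; apply: dnbhs0_le; rewrite divr_gt0.
apply: DeriveDef; last first.
  apply/cvg_lim => //; apply: cvg_trans cvgf; apply: near_eq_cvg; near=> h.
  by rewrite /= [h *: 1]mulr1.
apply/cvg_ex; exists l; apply: cvg_trans cvgf; apply: near_eq_cvg; near=> h.
by rewrite /= [h *: 1]mulr1.
Unshelve. all: by end_near. Qed.

Lemma is_derive_continuous F G : (forall x, is_derive x 1 F (G x)) ->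
  continuous F.
Proof.
move=> FG x; apply: differentiable_continuous; apply/derivable1_diffP.
by have [] := FG x.
Qed.

Lemma mean_value F G x y : (forall x, is_derive x 1 F (G x)) ->
  exists z, [/\ Num.min x y <= z, z <= Num.max x y & F y - F x = G z * (y - x)].
Proof.
move=> FG; have cF := is_derive_continuous FG.
wlog xy : x y / x <= y => [H|].
  have /orP[/H//|/H[z [z1 z2 z3]]] := le_total x y.
  exists z; split; [by rewrite minC|by rewrite maxC|].
  by rewrite -opprB z3 -mulrN opprB.
have [z zxy Ez] : exists2 z, z \in `[x, y]%R & F y - F x = G z * (y - x).
  by apply: MVT_segment => //; exact: continuous_subspaceT.
rewrite {}Ez.
exists z; split => //; last first.
  by rewrite max_r//; move: zxy; rewrite in_itv /= => /andP[].
rewrite min_l//; by move: zxy; rewrite in_itv /= => /andP[].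
Qed.

(** The derivative is bounded only on the ball around [x] through [y]. In [taylor2] this bound
    shrinks with the radius, and each use raises the power of the remainder by one. *)
Lemma derive_bounded_near F G M x y : (forall x, is_derive x 1 F (G x)) ->
  (forall z, `|z - x| <= `|y - x| -> `|G z| <= M) ->
  `|F y - F x| <= M * `|y - x|.
Proof.
move=> FG GM; have [z [z1 z2 ->]] := mean_value x y FG.
rewrite normrM ler_wpM2r//; apply: GM.
move: z1 z2; rewrite /Num.min /Num.max; case: ltP => xy z1 z2.
  by rewrite !ger0_norm; lra.
by rewrite ler0_norm 1?ler0_norm; lra.
Qed.

Lemma derive_bounded_lipschitz F G M : (forall x, is_derive x 1 F (G x)) ->
  (forall z, `|G z| <= M) -> forall x y, `|F y - F x| <= M * `|y - x|.
Proof. by move=> FG GM x y; apply: (derive_bounded_near FG) => z _. Qed.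

Lemma lipschitz_continuous f K : (forall x y, `|f y - f x| <= K * `|y - x|) ->
  continuous f.
Proof.
move=> fK x; apply/cvgrPdist_le => e e0; near=> y.
rewrite distrC; apply: (le_trans (fK _ _)).
have K1 : 0 < `|K| + 1 by rewrite ltr_wpDl.
apply: (@le_trans _ _ ((`|K| + 1) * `|y - x|)).
  by rewrite ler_wpM2r// (le_trans (ler_norm _))// lerDl.
rewrite -ler_pdivlMl// mulrC distrC; near: y.
by apply: cvgr_dist_le => //; rewrite divr_gt0.
Unshelve. all: by end_near. Qed.

(** The mean value inequality is applied to [h], then to [k]; this gives [K] where integration would
    give [K / 6]. *)
Lemma taylor2 f F G K x z : 0 <= K ->
  (forall x, is_derive x 1 f (F x)) -> (forall x, is_derive x 1 F (G x)) ->
  (forall x y, `|G y - G x| <= K * `|y - x|) ->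
  `|f (x + z) - f x - F x * z - 2^-1 * G x * z ^+ 2| <= K * `|z| ^+ 3.
Proof.
move=> K0 fF FG GK.
pose h (t : R) := F t - F x - G x * (t - x).
have dh (t : R) : is_derive t 1 h (G t - G x).
  rewrite /h; have := FG t => FGt.
  by apply: is_derive_eq; rewrite /GRing.scale /=; ring.
have hK (t : R) : `|h t| <= K * `|t - x| ^+ 2.
  have -> : h t = h t - h x by rewrite /h; ring.
  rewrite expr2 mulrA; apply: (derive_bounded_near dh) => s sx.
  by apply: (le_trans (GK _ _)); rewrite ler_wpM2l.
pose k (t : R) := f t - f x - F x * (t - x) - 2^-1 * G x * (t - x) ^+ 2.
have dk (t : R) : is_derive t 1 k (h t).
  rewrite /k /h; have := fF t => fFt.
  by apply: is_derive_eq; rewrite /GRing.scale /=; field.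
have -> : f (x + z) - f x - F x * z - 2^-1 * G x * z ^+ 2 = k (x + z) - k x.
  by rewrite /k; field.
have -> : `|z| = `|x + z - x| by congr `|_|; ring.
rewrite exprSr mulrA; apply: (derive_bounded_near dk) => s sx.
apply: (le_trans (hK _)); rewrite ler_wpM2l// lerXn2r ?nnegrE//.
Qed.

(** Primitives on [[- n, x]], normalized to vanish at 0, agree for all large [n]; [F] glues them
    together. *)
Lemma continuous_antiderivative f : continuous f ->
  exists F, forall x, is_derive x 1 F (f x).
Proof.
move=> cf.
have intf a b : lebesgue_measure.-integrable `[a, b] (EFin \o f).
  apply: continuous_compact_integrable; first exact: segment_compact.
  exact: continuous_subspaceT.
pose I n x : R := \int[lebesgue_measure]_(t in `[- n%:R, x]) f t.
pose J n x := I n x - I n 0.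
have JE n m x : `|x| <= n%:R -> (n <= m)%N -> J n x = J m x.
  move=> xn nm.
  have IE y : `|y| <= n%:R ->
      I m y = I m (- n%:R) + I n y.
    move=> yn; rewrite /I.
    have ny : - n%:R <= y by rewrite lerNl (le_trans _ yn)// -normrN ler_norm.
    have mn : - m%:R <= - n%:R :> R by rewrite lerN2 ler_nat.
    have := @Rintegral_itvB _ f (BLeft (- m%:R)) (BRight y) (- n%:R) (intf _ _).
    rewrite !bnd_simp => /(_ mn ny); rewrite Rintegral_itv_obnd_cbnd => [<-|].
      by rewrite addrCA subrr addr0.
    by apply: integrableS (intf (- n%:R) y) => //; by move=> u /=;
      rewrite !in_itv /= => /andP[/ltW -> ->].
  rewrite /J (IE x)// (IE 0)//; first by ring.
  by rewrite normr0.
pose F x := J (Num.truncn `|x|).+1 x.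
exists F => x.
(* The extra unit makes this [n] large enough for every [y] within distance 1 of [x], so that [F]
   coincides near [x] with the single primitive [J n]. *)
pose n := (Num.truncn (`|x| + 1)).+1.
have xn1 : `|x| + 1 < n%:R by exact: truncnS_gt.
have xn : - n%:R < x < n%:R.
  by rewrite -ltr_norml; apply: lt_trans xn1; rewrite ltrDl.
have [Jd JE'] : derivable (I n) x 1 /\ derive1 (I n) x = f x.
  apply: (@continuous_FTC1_closed _ f (- n%:R) x n%:R) => //.
  - by case/andP: xn.
  - by case/andP: xn.
  - exact: cf.
have dJ : is_derive x 1 (J n) (f x).
  have dI : is_derive x 1 (I n) (f x) by apply: DeriveDef => //; rewrite -derive1E.
  by rewrite /J; apply: is_derive_eq; rewrite subr0.
apply: near_eq_is_derive dJ.
near=> y; rewrite /F.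
have yn : `|y| <= (Num.truncn `|y|).+1%:R by rewrite ltW// truncnS_gt.
apply/esym; rewrite /= (JE _ n)//.
rewrite ltnS; apply: le_truncn.
have yx : `|y - x| <= 1 by rewrite distrC; near: y; exact: cvgr_dist_le.
by rewrite -lerBlDl (le_trans _ yx)// lerB_dist.
Unshelve. all: by end_near. Qed.

End Calculus.

(** * Test functions adapted to a coupling *)

Section Bump.
Context {R : realType}.
Implicit Types (s t x y r : R).

Definition clip t : R := Num.max (-1) (Num.min 1 t).

Lemma clip_cases t : [\/ t <= -1 /\ clip t = -1, -1 <= t <= 1 /\ clip t = t |
  1 <= t /\ clip t = 1].
Proof.
rewrite /clip; have [t1|t1] := lerP 1 t.
  by apply: Or33; split => //; rewrite max_r//; lra.
have [t2|t2] := lerP (-1) t; first by apply: Or32; split => //; lra.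
by apply: Or31; split => //; lra.
Qed.

Lemma clip_lipschitz s t : `|clip t - clip s| <= `|t - s|.
Proof.
have h1 := ler_norm (t - s); have := ler_norm (s - t).
rewrite (distrC s) => h2; rewrite ler_norml.
by case: (clip_cases t) => -[ht ->]; case: (clip_cases s) => -[hs ->]; lra.
Qed.

Lemma clip_bounded t : -1 <= clip t <= 1.
Proof. by case: (clip_cases t) => -[ht ->]; lra. Qed.

(** Squaring makes the positive part differentiable with a Lipschitz derivative, which is all the
    smoothness asked of a summand of [g']. *)
Definition chi t : R := Num.max 0 (1 - t ^+ 2) ^+ 2.
Definition dchi t : R := - 4 * t * Num.max 0 (1 - t ^+ 2).

Lemma max_clip t : Num.max 0 (1 - t ^+ 2) = 1 - clip t ^+ 2.
Proof.
case: (clip_cases t) => -[ht ->]; last 1 first.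
- by rewrite max_l; nra.
- by rewrite max_l; nra.
- by rewrite max_r//; nra.
Qed.

(** As a cubic in [clip t], which is 1-Lipschitz with values in [[-1, 1]], [dchi] gets its bound and
    its Lipschitz constant from polynomial inequalities on that interval. *)
Lemma dchiE t : dchi t = - 4 * (clip t - clip t ^+ 3).
Proof. by rewrite /dchi max_clip; case: (clip_cases t) => -[ht ->]; ring. Qed.

Lemma is_derive_max_sq r : is_derive r 1 (fun r => Num.max 0 r ^+ 2) (2 * Num.max 0 r).
Proof.
apply: (@is_derive_quadratic _ _ _ _ 1) => h; rewrite ler_norml.
by have [a|a] := lerP 0 r; have [b|b] := lerP 0 (r + h); nra.
Qed.

Lemma is_derive_chi t : is_derive t 1 chi (dchi t).
Proof.
have := is_derive_max_sq (1 - t ^+ 2) => H.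
have dq : is_derive t 1 (fun t : R => 1 - t ^+ 2) (- 2 * t).
  by apply: is_derive_eq; rewrite /GRing.scale /=; ring.
have := @is_derive1_comp _ (fun r => Num.max 0 r ^+ 2)
  (fun t => 1 - t ^+ 2) _ _ _ H dq.
by rewrite (_ : _ * _ * _ = dchi t)// /dchi; ring.
Qed.

Lemma chi_ge0 t : 0 <= chi t.
Proof. exact: sqr_ge0. Qed.

Lemma chi_le1 t : chi t <= 1.
Proof.
rewrite /chi max_clip; have := clip_bounded t; set c := clip t => c1.
have : 0 <= c ^+ 2 <= 1 by nra.
by set e := c ^+ 2 => e1; nra.
Qed.

Lemma dchi_bounded t : `|dchi t| <= 4.
Proof.
rewrite dchiE ler_norml; have := clip_bounded t; set c := clip t => c1.
have : 0 <= c ^+ 2 <= 1 by nra.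
rewrite (_ : c - c ^+ 3 = c * (1 - c ^+ 2)); last by ring.
by set e := c ^+ 2 => e1; nra.
Qed.

Lemma dchi_lipschitz s t : `|dchi t - dchi s| <= 16 * `|t - s|.
Proof.
rewrite !dchiE -mulrBr normrM normrN [`|4|]ger0_norm//.
have := clip_lipschitz s t; have := clip_bounded t; have := clip_bounded s.
set c := clip t; set d := clip s => d1 c1 cd.
have -> : c - c ^+ 3 - (d - d ^+ 3) = (c - d) * (1 - (c ^+ 2 + c * d + d ^+ 2)).
  by ring.
rewrite normrM.
have : `|1 - (c ^+ 2 + c * d + d ^+ 2)| <= 4 by rewrite ler_norml; nra.
by have := normr_ge0 (c - d); nra.
Qed.

Lemma chi_out t : 1 <= `|t| -> chi t = 0 /\ dchi t = 0.
Proof.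
move=> t1; have : 1 <= t ^+ 2 by rewrite -real_normK ?num_real// exprn_ege1.
by move=> t2; rewrite /chi /dchi max_l ?subr_le0// expr0n mulr0.
Qed.

(** [6 / 7] is [(9 - 2 * s) / 7] at [s = 3 / 2], the edge of the plateau of [theta]; [1 / 16] is a
    round value below [(13 / 49) ^ 2]. *)
Lemma chi_in t : `|t| <= 6 / 7 -> 1 / 16 <= chi t.
Proof.
rewrite ler_norml => /andP[t1 t2]; rewrite /chi max_r; last by nra.
have : 13 / 49 <= 1 - t ^+ 2 by nra.
by nra.
Qed.

(* An odd bump: nonnegative on [s >= 0], supported on [1 <= |s| <= 8], and at least
   1/16 on [3 / 2 <= s <= 9 / 2]. *)
Definition theta s : R := chi ((2 * s - 9) / 7) - chi ((2 * s + 9) / 7).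
Definition dtheta s : R :=
  2 / 7 * (dchi ((2 * s - 9) / 7) - dchi ((2 * s + 9) / 7)).

Lemma is_derive_theta s : is_derive s 1 theta (dtheta s).
Proof.
have H1 := is_derive_chi ((2 * s - 9) / 7).
have H2 := is_derive_chi ((2 * s + 9) / 7).
have d1 : is_derive s 1 (fun s : R => (2 * s - 9) / 7) (2 / 7).
  by apply: is_derive_eq; rewrite /GRing.scale /=; ring.
have d2 : is_derive s 1 (fun s : R => (2 * s + 9) / 7) (2 / 7).
  by apply: is_derive_eq; rewrite /GRing.scale /=; ring.
have K1 := @is_derive1_comp _ chi (fun s => (2 * s - 9) / 7) _ _ _ H1 d1.
have K2 := @is_derive1_comp _ chi (fun s => (2 * s + 9) / 7) _ _ _ H2 d2.
rewrite (_ : theta = (chi \o (fun s : R => (2 * s - 9) / 7)) -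
  (chi \o (fun s : R => (2 * s + 9) / 7)))//.
by apply: is_derive_eq; rewrite /dtheta; ring.
Qed.

Lemma theta_bounded s : `|theta s| <= 4.
Proof.
rewrite /theta ler_norml.
have := chi_ge0 ((2 * s - 9) / 7); have := chi_ge0 ((2 * s + 9) / 7).
have := chi_le1 ((2 * s - 9) / 7); have := chi_le1 ((2 * s + 9) / 7).
by lra.
Qed.

Lemma dtheta_bounded s : `|dtheta s| <= 4.
Proof.
rewrite /dtheta.
have := dchi_bounded ((2 * s - 9) / 7); have := dchi_bounded ((2 * s + 9) / 7).
by rewrite !ler_norml; lra.
Qed.

Lemma dtheta_lipschitz s t : `|dtheta t - dtheta s| <= 4 * `|t - s|.
Proof.
rewrite /dtheta.
have := dchi_lipschitz ((2 * s - 9) / 7) ((2 * t - 9) / 7).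
have := dchi_lipschitz ((2 * s + 9) / 7) ((2 * t + 9) / 7).
rewrite (_ : (2 * t + 9) / 7 - (2 * s + 9) / 7 = 2 / 7 * (t - s)); last by field.
rewrite (_ : (2 * t - 9) / 7 - (2 * s - 9) / 7 = 2 / 7 * (t - s)); last by field.
rewrite normrM (ger0_norm (_ : 0 <= 2 / 7)) ; last by lra.
have := normr_ge0 (t - s).
by rewrite !ler_norml; lra.
Qed.

Lemma theta_out s : `|s| <= 1 \/ 8 <= `|s| -> theta s = 0 /\ dtheta s = 0.
Proof.
move=> s18; rewrite /theta /dtheta.
have [|-> ->] := @chi_out ((2 * s - 9) / 7).
  by rewrite ler_normr; case: s18; rewrite ?ler_norml ?ler_normr; [|move=> /orP[]]; lra.
have [|-> ->] := @chi_out ((2 * s + 9) / 7).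
  by rewrite ler_normr; case: s18; rewrite ?ler_norml ?ler_normr; [|move=> /orP[]]; lra.
by rewrite subrr mulr0.
Qed.

Lemma theta_ge0 s : 0 <= s -> 0 <= theta s.
Proof.
move=> s0; rewrite /theta.
have [|-> _] := @chi_out ((2 * s + 9) / 7); first by rewrite ler_normr; lra.
by rewrite subr0 chi_ge0.
Qed.

Lemma theta_gt s : 3 / 2 <= s <= 9 / 2 -> 1 / 16 <= theta s.
Proof.
move=> s0; rewrite /theta.
have [|-> _] := @chi_out ((2 * s + 9) / 7); first by rewrite ler_normr; lra.
by rewrite subr0 chi_in// ler_norml; lra.
Qed.

Lemma thetaN s : theta (- s) = - theta s.
Proof.
rewrite /theta opprB.
have chiN t : chi (- t) = chi t by rewrite /chi sqrrN.
by congr (_ - _); rewrite -chiN; congr chi; field.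
Qed.

(* [S] is the average of [D] over [[x, x + r / 4]]. *)
Lemma smoothing (D : R -> R) r : 0 < r ->
  (forall x y, `|D y - D x| <= 2 * `|y - x|) ->
  exists S dS : R -> R, [/\ (forall x, is_derive x 1 S (dS x)),
    (forall x, `|S x - D x| <= r / 2), (forall x, `|dS x| <= 2) &
    (forall x y, `|dS y - dS x| <= 16 / r * `|y - x|)].
Proof.
move=> r0 DL.
have [P DP] := continuous_antiderivative (lipschitz_continuous DL).
have h0 : 0 < r / 4 by rewrite divr_gt0.
have r1 : r != 0 by rewrite gt_eqF.
pose S x := (P (x + r / 4) - P x) / (r / 4).
pose dS x := (D (x + r / 4) - D x) / (r / 4).
exists S, dS; split => [x|x|x|x y].
- have dx : is_derive x 1 (fun x : R => x + r / 4) 1.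
    by apply: is_derive_eq; rewrite addr0.
  have := @is_derive1_comp _ P (fun x => x + r / 4) _ _ _ (DP (x + r / 4)) dx => H.
  have := DP x => Hx.
  rewrite (_ : S = (r / 4)^-1 *: ((P \o (fun x : R => x + r / 4)) - P)).
    by apply: is_derive_eq; rewrite /dS /GRing.scale /=; field.
  by apply/funext => z; rewrite /S [RHS]mulrC.
- have [z [z1 z2 e]] := mean_value x (x + r / 4) DP.
  rewrite /S e (_ : x + r / 4 - x = r / 4); last by ring.
  rewrite mulfK ?gt_eqF//; apply: (le_trans (DL _ _)).
  move: z1 z2; rewrite min_l ?max_r; try lra.
  by move=> z1 z2; rewrite ger0_norm; lra.
- rewrite /dS normrM normfV (ger0_norm (ltW h0)) ler_pdivrMr//.
  apply: (le_trans (DL _ _)); rewrite (_ : x + r / 4 - x = r / 4); last by ring.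
  by rewrite (ger0_norm (ltW h0)).
- rewrite /dS -mulrBl normrM normfV (ger0_norm (ltW h0)) ler_pdivrMr//.
  have -> : 16 / r * `|y - x| * (r / 4) = 4 * `|y - x| by field.
  have := DL x y; have := DL (x + r / 4) (y + r / 4).
  rewrite (_ : y + r / 4 - (x + r / 4) = y - x); last by ring.
  by rewrite !ler_norml; lra.
Qed.

(* [H = r^2 theta (S / r)], with [S] the smoothing of [D] at scale [r]: at this scale
   the second derivative of [S] is O(1 / r), so [H'] is Lipschitz uniformly in [r]. *)
Lemma scale_bump (D : R -> R) r : 0 < r ->
  (forall x y, `|D y - D x| <= 2 * `|y - x|) ->
  exists H dH : R -> R,
    [/\ (forall x, is_derive x 1 H (dH x)),
       (forall x, `|H x| <= 4 * r ^+ 2 /\ `|dH x| <= 8 * r),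
       (forall x y, `|dH y - dH x| <= 80 * `|y - x|),
       (forall x, `|D x| <= r / 2 \/ 17 / 2 * r <= `|D x| -> H x = 0 /\ dH x = 0) &
       (forall x, (0 <= D x -> 0 <= H x) /\ (D x <= 0 -> H x <= 0)) /\
       (forall x, (2 * r <= D x <= 4 * r -> r ^+ 2 / 16 <= H x) /\
         (2 * r <= - D x <= 4 * r -> r ^+ 2 / 16 <= - H x))].
Proof.
move=> r0 DL; have [S [dS [S1 S2 S3 S4]]] := smoothing r0 DL.
have r1 : r != 0 by rewrite gt_eqF.
pose H x := r ^+ 2 * theta (S x / r).
pose dH x := r * dtheta (S x / r) * dS x.
(* [S] is within [r / 2] of [D]: the window [[r, 8 * r]] for [|S|] widens to [r / 2] and
   [17 / 2 * r] for [|D|]. *)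
have out x : `|D x| <= r / 2 \/ 17 / 2 * r <= `|D x| -> H x = 0 /\ dH x = 0.
  move=> Dx; rewrite /H /dH; have [|-> ->] := @theta_out (S x / r).
    rewrite normrM normfV (ger0_norm (ltW r0)) ler_pdivrMr// ler_pdivlMr//.
    have Sx := S2 x.
    case: Dx => Dx; [left|right].
      by move: Dx Sx; rewrite !ler_norml; lra.
    have := ler_normB (S x) (S x - D x).
    by rewrite opprB addrCA subrr addr0; lra.
  by rewrite !mulr0 mul0r.
(* Where [|D x| > r / 2] the smoothing cannot change the sign; elsewhere [H] vanishes. *)
have sgn x : (D x < - (r / 2) \/ r / 2 < D x) ->
  (0 <= D x -> 0 <= S x / r) /\ (D x <= 0 -> 0 <= - (S x / r)).
  have := S2 x; rewrite ler_norml -[- (S x / r)]mulNr => Sx Dx.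
  by split => D0; rewrite divr_ge0 ?(ltW r0)//; case: Dx => Dx; lra.
exists H, dH; split => //.
- move=> x; have dx : is_derive x 1 (fun x => S x / r) (dS x / r).
    have := S1 x => S1x; rewrite (_ : (fun _ => _) = r^-1 *: S).
      by apply: is_derive_eq; rewrite /GRing.scale /= mulrC.
    by apply/funext => z; rewrite [RHS]mulrC.
  have := @is_derive1_comp _ theta (fun x => S x / r) _ _ _
    (is_derive_theta (S x / r)) dx => K.
  rewrite (_ : H = r ^+ 2 *: (theta \o (fun x => S x / r)))//.
  by apply: is_derive_eq; rewrite /dH /GRing.scale /=; field.
- move=> x; split.
    by rewrite /H normrM ger0_norm ?sqr_ge0// mulrC ler_wpM2r ?sqr_ge0 ?theta_bounded.
  rewrite /dH; move: (dtheta_bounded (S x / r)) (S3 x).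
  move: (dtheta _) (dS x) => a b a4 b2.
  rewrite !normrM (ger0_norm (ltW r0)) -mulrA [leRHS]mulrC ler_wpM2l ?(ltW r0)//.
  by rewrite (le_trans (ler_pM _ _ a4 b2))//; lra.
(* Product rule: varying [dtheta] costs [8 * 2] and varying [dS] costs [4 * 16], in total 80; the
   powers of [r] cancel in both terms. *)
- move=> x y; rewrite /dH.
  have -> : r * dtheta (S y / r) * dS y - r * dtheta (S x / r) * dS x =
    r * (dtheta (S y / r) - dtheta (S x / r)) * dS y +
    r * (dtheta (S x / r) * (dS y - dS x)) by ring.
  have l1 : `|r * (dtheta (S y / r) - dtheta (S x / r))| <= 8 * `|y - x|.
    move: (dtheta_lipschitz (S x / r) (S y / r)).
    have l2 := derive_bounded_lipschitz S1 S3 x y.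
    move: (dtheta (S y / r)) (dtheta (S x / r)) => a b l1.
    rewrite normrM (ger0_norm (ltW r0)) -ler_pdivlMl//; apply: (le_trans l1).
    rewrite -mulrBl normrM normfV (ger0_norm (ltW r0)).
    by rewrite [leLHS]mulrA [leLHS]mulrC ler_pM2l ?invr_gt0//; lra.
  have l3 : `|r * (dtheta (S x / r) * (dS y - dS x))| <= 64 * `|y - x|.
    move: (dtheta_bounded (S x / r)); move: (dtheta _) => a a4.
    rewrite !normrM (ger0_norm (ltW r0)) mulrCA.
    have l3 : r * `|dS y - dS x| <= 16 * `|y - x|.
      by rewrite -ler_pdivlMl// mulrA (mulrC r^-1); exact: S4.
    have : 0 <= r * `|dS y - dS x| by rewrite mulr_ge0// ltW.
    have := normr_ge0 a; have := normr_ge0 (y - x).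
    move: (r * _) l3 => e l3 z0 a0 e0.
    by apply: (le_trans (ler_pM a0 e0 a4 l3)); lra.
  move: l1 l3; move: (r * _) (r * _) => b a l1 l3.
  apply: (le_trans (ler_normD _ _)).
  rewrite [X in X + _]normrM.
  have l5 := ler_pM (normr_ge0 a) (normr_ge0 (dS y)) l1 (S3 y).
  by apply: (le_trans (lerD l5 l3)); lra.
- split => x; split => Dx.
  + have [Dr|Dr] := lerP `|D x| (r / 2).
      by have [-> _] := out x (or_introl Dr).
    have [] := sgn x; first by move: Dr; rewrite ltr_normr; case/orP; lra.
    by move=> /(_ Dx) Sx _; rewrite /H mulr_ge0 ?sqr_ge0// theta_ge0.
  + have [Dr|Dr] := lerP `|D x| (r / 2).
      by have [-> _] := out x (or_introl Dr).
    have [] := sgn x; first by move: Dr; rewrite ltr_normr; case/orP; lra.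
    move=> _ /(_ Dx) Sx; rewrite /H -oppr_ge0 -mulrN -thetaN.
    by rewrite mulr_ge0 ?sqr_ge0// theta_ge0.
  (* Here [S x / r] lies in [[3 / 2, 9 / 2]], the interval of [theta_gt]. *)
  + rewrite /H ler_wpM2l ?sqr_ge0// -[leLHS]mul1r theta_gt//.
    rewrite ler_pdivlMr// ler_pdivrMr//; have := S2 x; rewrite ler_norml; lra.
  + rewrite /H -mulrN -thetaN ler_wpM2l ?sqr_ge0// -[leLHS]mul1r theta_gt//.
    rewrite -mulNr ler_pdivlMr// ler_pdivrMr//; have := S2 x; rewrite ler_norml; lra.
Qed.

End Bump.

Section TestFunction.
Context {R : realType}.
Implicit Types (D G g H : R -> R) (x y a b delta : R).

Lemma sum_dyadic_le delta b M : 0 < delta -> 0 <= b ->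
  \sum_(k < M | delta * 2 ^+ k <= b) delta * 2 ^+ k <= 2 * b.
Proof.
move=> d0 b0.
have S N : \sum_(k < N) delta * 2 ^+ k <= delta * 2 ^+ N.
  elim: N => [|N IH]; first by rewrite big_ord0 expr0 mulr1 ltW.
  by rewrite big_ord_recr /= exprS; lra.
elim: M => [|M IH]; first by rewrite big_ord0 mulr_ge0.
rewrite big_mkcond big_ord_recr -big_mkcond /=; case: ifPn => Mb; last by lra.
have : \sum_(k < M | delta * 2 ^+ k <= b) delta * 2 ^+ k <= delta * 2 ^+ M.
  apply: le_trans (S M); rewrite big_mkcond ler_sum// => k _; case: ifP => // _.
  by rewrite mulr_ge0 ?exprn_ge0// ltW.
by lra.
Qed.

Lemma sum_dyadic_inv_le delta a M : 0 < delta -> 0 < a ->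
  \sum_(k < M | a <= delta * 2 ^+ k) a / (delta * 2 ^+ k) <= 2.
Proof.
move=> d0 a0.
(* For the induction, the tail of the geometric series from [M] on is subtracted from the bound; the
   maximum with 0 covers the scales below [a], where the sum is still empty. *)
suff : \sum_(k < M | a <= delta * 2 ^+ k) a / (delta * 2 ^+ k) <=
    Num.max 0 (2 - 2 * (a / (delta * 2 ^+ M))).
  move=> H; apply: (le_trans H); rewrite ge_max ler0n /= lerBlDr lerDl.
  by rewrite mulr_ge0// divr_ge0 ?(ltW a0)// mulr_ge0 ?exprn_ge0// ltW.
elim: M => [|M IH]; first by rewrite big_ord0 le_max lexx.
rewrite big_mkcond big_ord_recr -big_mkcond /=.
have r0 : 0 < delta * 2 ^+ M by rewrite mulr_gt0// exprn_gt0.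
have -> : a / (delta * 2 ^+ M.+1) = a / (delta * 2 ^+ M) / 2.
  by rewrite exprS; field; rewrite expf_neq0 gt_eqF.
set e := a / (delta * 2 ^+ M) in IH *.
have e0 : 0 < e by rewrite divr_gt0.
case: ifPn => Ma; last first.
  rewrite addr0; apply: (le_trans IH); rewrite ge_max le_max lexx /=.
  by rewrite le_max; apply/orP; right; lra.
have e1 : e <= 1 by rewrite ler_pdivrMr// mul1r.
rewrite le_max; apply/orP; right.
move: IH; rewrite le_max => /orP[IH|IH]; lra.
Qed.

Lemma dyadic_between delta a M : 0 < delta ->
  2 * delta <= a <= delta * 2 ^+ M.+2 ->
  exists2 k, (k < M.+1)%N & 2 * (delta * 2 ^+ k) <= a <= 4 * (delta * 2 ^+ k).
Proof.
move=> d0; elim: M => [|M IH] /andP[h1 h2].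
  by exists 0%N => //; move: h2; rewrite expr0 expr2; lra.
have [h3|h3] := lerP a (delta * 2 ^+ M.+2).
  by have [|k kM ka] := IH; [rewrite h1|exists k => //; rewrite ltnW].
by exists M.+1 => //; move: h2 h3; rewrite !exprS; lra.
Qed.

Lemma is_derive_bigsum M (H dH : nat -> R -> R) :
  (forall k x, is_derive x 1 (H k) (dH k x)) -> forall x,
  is_derive x 1 (fun x => \sum_(k < M) H k x) (\sum_(k < M) dH k x).
Proof.
move=> HdH x; elim: M => [|M IH].
  rewrite big_ord0 (_ : (fun _ => _) = cst 0); first exact: is_derive_cst.
  by apply/funext => y; rewrite big_ord0.
rewrite big_ord_recr /=.
rewrite (_ : (fun _ => _) = (fun x => \sum_(k < M) H k x) + H M).
  exact: is_deriveD.
by apply/funext => y; rewrite big_ord_recr.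
Qed.

(* [G] adds up the bumps at the dyadic scales [delta * 2 ^ k], a C^{1,1} substitute for
   [D * |D|]: at a given point only boundedly many summands do not vanish. *)
Lemma multiscale_bump D delta M : 0 < delta ->
  (forall x y, `|D y - D x| <= 2 * `|y - x|) ->
  exists G G1 : R -> R,
    [/\ (forall x, is_derive x 1 G (G1 x)),
        (forall x, `|G x| <= 32 * `|D x| ^+ 2 /\ `|G1 x| <= 32 * `|D x|),
        (forall x y, `|G1 y - G1 x| <= 5440 * `|y - x|),
        (exists B, forall x, `|G x| <= B /\ `|G1 x| <= B) &
        (forall x, (0 <= D x -> 0 <= G x) /\ (D x <= 0 -> G x <= 0)) /\
        (forall x, (2 * delta <= D x <= delta * 2 ^+ M.+2 -> D x ^+ 2 / 256 <= G x) /\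
          (2 * delta <= - D x <= delta * 2 ^+ M.+2 -> D x ^+ 2 / 256 <= - G x))].
Proof.
move=> d0 DL.
have r0 k : 0 < delta * 2 ^+ k by rewrite mulr_gt0// exprn_gt0.
have /choice[HH HP] : forall k, exists HH : (R -> R) * (R -> R),
  [/\ (forall x, is_derive x 1 HH.1 (HH.2 x)),
       (forall x, `|HH.1 x| <= 4 * (delta * 2 ^+ k) ^+ 2 /\
          `|HH.2 x| <= 8 * (delta * 2 ^+ k)),
       (forall x y, `|HH.2 y - HH.2 x| <= 80 * `|y - x|),
       (forall x, `|D x| <= (delta * 2 ^+ k) / 2 \/
          17 / 2 * (delta * 2 ^+ k) <= `|D x| -> HH.1 x = 0 /\ HH.2 x = 0) &
       (forall x, (0 <= D x -> 0 <= HH.1 x) /\ (D x <= 0 -> HH.1 x <= 0)) /\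
       (forall x, (2 * (delta * 2 ^+ k) <= D x <= 4 * (delta * 2 ^+ k) ->
             (delta * 2 ^+ k) ^+ 2 / 16 <= HH.1 x) /\
         (2 * (delta * 2 ^+ k) <= - D x <= 4 * (delta * 2 ^+ k) ->
            (delta * 2 ^+ k) ^+ 2 / 16 <= - HH.1 x))].
  by move=> k; have [H [dH HP]] := scale_bump (r0 k) DL; exists (H, dH).
pose H k := (HH k).1; pose dH k := (HH k).2.
have HdH k x : is_derive x 1 (H k) (dH k x) by case: (HP k).
have H1 k x : `|H k x| <= 4 * (delta * 2 ^+ k) ^+ 2.
  by case: (HP k) => _ + _ _ _ => /(_ x)[].
have H2 k x : `|dH k x| <= 8 * (delta * 2 ^+ k).
  by case: (HP k) => _ + _ _ _ => /(_ x)[].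
have H3 k x y : `|dH k y - dH k x| <= 80 * `|y - x|.
  by case: (HP k) => _ _ + _ _; apply.
have H4 k x : `|D x| <= (delta * 2 ^+ k) / 2 \/
    17 / 2 * (delta * 2 ^+ k) <= `|D x| -> H k x = 0 /\ dH k x = 0.
  by case: (HP k) => _ _ _ + _; apply.
have H5 k x : 0 <= D x -> 0 <= H k x.
  by case: (HP k) => _ _ _ _ [/(_ x)[] + _ _].
have H6 k x : D x <= 0 -> H k x <= 0.
  by case: (HP k) => _ _ _ _ [/(_ x)[] _ +].
have H7 k x : 2 * (delta * 2 ^+ k) <= D x <= 4 * (delta * 2 ^+ k) ->
     (delta * 2 ^+ k) ^+ 2 / 16 <= H k x.
  by case: (HP k) => _ _ _ _ [_ /(_ x)[]].
have H8 k x : 2 * (delta * 2 ^+ k) <= - D x <= 4 * (delta * 2 ^+ k) ->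
     (delta * 2 ^+ k) ^+ 2 / 16 <= - H k x.
  by case: (HP k) => _ _ _ _ [_ /(_ x)[]].
move: (H) (dH) HdH H1 H2 H3 H4 H5 H6 H7 H8 => {HH HP H dH}.
move=> H dH HdH H1 H2 H3 H4 H5 H6 H7 H8.
exists (fun x => \sum_(k < M.+1) H k x), (fun x => \sum_(k < M.+1) dH k x); split.
- exact: is_derive_bigsum.
- move=> x.
  have cond k (f : R) : `|f| <= f -> (delta * 2 ^+ k <= 2 * `|D x|) \/ `|D x| <= delta * 2 ^+ k / 2.
    by move=> _; have [|] := lerP (delta * 2 ^+ k) (2 * `|D x|); [left|right; lra].
  (* Scales [r] above [2 * |D x|] do not contribute at [x]. Below, [4 * r ^ 2 <= 8 * |D x| * r], and
     these [r] add up to at most [4 * |D x|]: both bounds get the constant 32. *)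
  have S := @sum_dyadic_le delta (2 * `|D x|) M.+1 d0 (mulr_ge0 (ler0n _ _) (normr_ge0 _)).
  split.
  + apply: (le_trans (ler_norm_sum _ _ _)).
    apply: (@le_trans _ _ (\sum_(k < M.+1 | delta * 2 ^+ k <= 2 * `|D x|)
        (8 * `|D x|) * (delta * 2 ^+ k))); last first.
      rewrite -mulr_sumr; apply: (le_trans (ler_wpM2l _ S)).
        by rewrite mulr_ge0.
      by rewrite expr2; lra.
    rewrite [leRHS]big_mkcond ler_sum// => k _; case: ifPn => kD.
      move: kD (H1 k x) (r0 k); move: (delta * _) => r kD H1k rr.
      by have := ler_wpM2l (ltW rr) kD; rewrite expr2 in H1k; lra.
    have [|-> _] := H4 k x; last by rewrite normr0.
    by left; move: kD; rewrite -ltNge; lra.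
  + apply: (le_trans (ler_norm_sum _ _ _)).
    apply: (@le_trans _ _ (\sum_(k < M.+1 | delta * 2 ^+ k <= 2 * `|D x|)
        8 * (delta * 2 ^+ k))); last first.
      by rewrite -mulr_sumr; apply: (le_trans (ler_wpM2l _ S)) => //; lra.
    rewrite [leRHS]big_mkcond ler_sum// => k _; case: ifPn => kD.
      exact: H2.
    have [|_ ->] := H4 k x; last by rewrite normr0.
    by left; move: kD; rewrite -ltNge; lra.
- move=> x y.
  (* A scale [r] active at [z] lies between [a] and [17 * a] for [a = 2 * |D z| / 17], so it counts
     for at most [17 * a / r], and these sum to at most 34. Only scales active at [x] or at [y]
     contribute: [80 * (34 + 34) = 5440]. *)
  pose act z k := (delta * 2 ^+ k < 2 * `|D z|) &&
      (`|D z| < 17 / 2 * (delta * 2 ^+ k)).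
  have cnt z : \sum_(k < M.+1) (act z k)%:R <= 34 :> R.
    have [Dz|Dz] := eqVneq (D z) 0.
      rewrite big1// => k _; rewrite /act Dz normr0 mulr0.
      by rewrite ltNge (ltW (r0 k)).
    have D0 : 0 < `|D z| by rewrite normr_gt0.
    pose a := 2 * `|D z| / 17.
    have a0 : 0 < a by rewrite divr_gt0 ?mulr_gt0.
    apply: (@le_trans _ _ (\sum_(k < M.+1 | a <= delta * 2 ^+ k)
       17 * (a / (delta * 2 ^+ k)))).
      rewrite [leRHS]big_mkcond ler_sum// => k _; rewrite /act.
      have [/andP[h1 h2]|_] := boolP (_ && _); last first.
        by case: ifP => // _; rewrite mulr_ge0// divr_ge0// ltW.
      rewrite ifT; last by rewrite /a; lra.
      by rewrite mulrA ler_pdivlMr// mul1r /a; lra.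
    rewrite -mulr_sumr.
    by have := @sum_dyadic_inv_le delta a M.+1 d0 a0; lra.
  rewrite -sumrB; apply: (le_trans (ler_norm_sum _ _ _)).
  apply: (@le_trans _ _ (80 * `|y - x| *
     \sum_(k < M.+1) ((act x k)%:R + (act y k)%:R))); last first.
    rewrite big_split /=.
    have := cnt x; have := cnt y; have := normr_ge0 (y - x) => z0 c1 c2.
    by have := ler_wpM2l z0 (lerD c2 c1); lra.
  rewrite mulr_sumr ler_sum// => k _.
  have z0 := normr_ge0 (y - x).
  have zero z : ~~ act z k -> dH k z = 0.
    rewrite negb_and -!leNgt => /orP zz; have [//|//] := H4 k z.
    by case: zz => zz; [left; lra|right].
  have [xk|xk] := boolP (act x k); have [yk|yk] := boolP (act y k);
    rewrite /=; try (by apply: (le_trans (H3 _ _ _)); lra).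
  by rewrite (zero _ xk) (zero _ yk) subrr normr0 addr0 mulr0.
- exists (\sum_(k < M.+1) (4 * (delta * 2 ^+ k) ^+ 2 + 8 * (delta * 2 ^+ k))) => x.
  split; apply: (le_trans (ler_norm_sum _ _ _)); apply: ler_sum => k _.
    by apply: (le_trans (H1 _ _)); rewrite lerDl mulr_ge0// ltW.
  by apply: (le_trans (H2 _ _)); rewrite lerDr mulr_ge0// sqr_ge0.
- have pick x k : 2 * (delta * 2 ^+ k) <= x <= 4 * (delta * 2 ^+ k) ->
      x ^+ 2 / 256 <= (delta * 2 ^+ k) ^+ 2 / 16.
    have := r0 k; move: (delta * _) => r rr0 /andP[x1 x2].
    have : x ^+ 2 <= (4 * r) ^+ 2 by rewrite lerXn2r ?nnegrE//; lra.
    by rewrite exprMn; lra.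
  split => x; split => Dx.
  + by apply: sumr_ge0 => k _; exact: H5.
  + by apply: sumr_le0 => k _; exact: H6.
  + have [k kM kD] := dyadic_between d0 Dx.
    rewrite (bigD1 (Ordinal kM))//= (le_trans (pick _ _ kD))//.
    rewrite (le_trans (H7 _ _ kD))// lerDl sumr_ge0// => j _; apply: H5.
    by have := r0 k; lra.
  + have [k kM kD] := dyadic_between d0 Dx.
    rewrite (bigD1 (Ordinal kM))//= -(sqrrN (D x)) (le_trans (pick _ _ kD))//.
    rewrite (le_trans (H8 _ _ kD))// opprD lerDl oppr_ge0 sumr_le0// => j _; apply: H6.
    by have := r0 k; lra.
Qed.

(** On the middle quarter of [[v, u]], with [d = u - v], [D] stays between [3 / 4 * d] and
    [5 / 4 * d]; this is in the range of the lower bound on [G], so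
    [G >= 9 / 16 * d ^ 2 / 256 >= d ^ 2 / 512]. Over a length [d / 4] the gain is [d ^ 3 / 2048]; on
    the rest of [[v, u]], [g] does not decrease. *)
Lemma gain_pos D g G delta M u v : 0 < delta ->
  (forall x y, `|D y - D x| <= 2 * `|y - x|) ->
  (forall x, is_derive x 1 g (G x)) ->
  (forall x, 0 <= D x -> 0 <= G x) ->
  (forall x, 2 * delta <= D x <= delta * 2 ^+ M.+2 -> D x ^+ 2 / 256 <= G x) ->
  D ((u + v) / 2) = u - v -> v < u ->
  0 <= g u - g v /\
  (4 * delta <= u - v <= delta * 2 ^+ M.+1 -> (u - v) ^+ 3 / 2048 <= g u - g v).
Proof.
move=> d0 DL gG G0 GD Dw vu.
pose d := u - v; pose w := (u + v) / 2.
have low x : v <= x <= u -> d - 2 * `|x - w| <= D x.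
  move=> _; have := DL w x; rewrite ler_norml Dw -/d; lra.
have nondec a b : v <= a -> a <= b -> b <= u -> 0 <= g b - g a.
  move=> va ab bu; have [z [z1 z2 ->]] := mean_value a b gG.
  move: z1 z2; rewrite min_l// max_r// => z1 z2.
  rewrite mulr_ge0 ?subr_ge0// G0//; apply: le_trans (low z _); last by lra.
  have : `|z - w| <= d / 2 by rewrite ler_norml /d /w; lra.
  by lra.
split; first by apply: nondec => //; exact: ltW.
move=> dd.
have dp : 0 < d by rewrite subr_gt0.
have n1 : 0 <= g (w - d / 8) - g v by apply: nondec; rewrite /w /d; lra.
have n2 : 0 <= g u - g (w + d / 8) by apply: nondec; rewrite /w /d; lra.
suff : d ^+ 3 / 2048 <= g (w + d / 8) - g (w - d / 8) by rewrite -/d; lra.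
have [z [z1 z2 ->]] := mean_value (w - d / 8) (w + d / 8) gG.
have wd : w - d / 8 <= w + d / 8 by lra.
move: z1 z2; rewrite min_l// max_r// => z1 z2.
have Dz : 3 / 4 * d <= D z <= 5 / 4 * d.
  have := DL w z; rewrite Dw -/d.
  have : `|z - w| <= d / 8 by rewrite ler_norml; lra.
  by move=> h1; rewrite ler_norml; lra.
have : D z ^+ 2 / 256 <= G z.
  by apply: GD; move: dd; rewrite -/d [2 ^+ M.+2]exprS; lra.
have : (3 / 4 * d) ^+ 2 <= D z ^+ 2 by rewrite lerXn2r ?nnegrE//; lra.
rewrite (_ : (3 / 4 * d) ^+ 2 = 9 / 16 * d ^+ 2); last by field.
rewrite (_ : w + d / 8 - (w - d / 8) = d / 4); last by field.
move=> h1 h2.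
have h3 : d ^+ 2 / 512 <= G z by have := sqr_ge0 d; lra.
rewrite exprSr (_ : d ^+ 2 * d / 2048 = d ^+ 2 / 512 * (d / 4)); last by field.
by rewrite ler_wpM2r//; lra.
Qed.

Lemma test_function D delta M : 0 < delta ->
  (forall x y, `|D y - D x| <= 2 * `|y - x|) ->
  exists g G G1 : R -> R,
    [/\ (forall x, is_derive x 1 g (G x)) /\ (forall x, is_derive x 1 G (G1 x)),
        (forall x, `|G x| <= 32 * `|D x| ^+ 2 /\ `|G1 x| <= 32 * `|D x|),
        (forall x y, `|G1 y - G1 x| <= 5440 * `|y - x|),
        (exists B, forall x, `|G x| <= B /\ `|G1 x| <= B) &
        (forall u v, D ((u + v) / 2) = u - v -> 0 <= g u - g v /\
           (4 * delta <= `|u - v| <= delta * 2 ^+ M.+1 ->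
            `|u - v| ^+ 3 / 2048 <= g u - g v))].
Proof.
move=> d0 DL; have [G [G1 [GG1 Gb GL GB [Gs Gd]]]] := multiscale_bump M d0 DL.
have [g gG] := continuous_antiderivative (is_derive_continuous GG1).
exists g, G, G1; split => // u v Duv.
have [uv|uv|uv] := ltgtP u v; last first.
- split; first by rewrite uv addrN.
  by move=> /andP[h _]; move: h; rewrite uv addrN normr0 leNgt mulr_gt0.
- rewrite gtr0_norm ?subr_gt0//; apply: (gain_pos d0 DL gG) => // x.
  + by have [] := Gs x.
  + by have [] := Gd x.
- rewrite ltr0_norm ?subr_lt0// opprB.
  (* Reflecting [D], [g] and [G] exchanges the roles of [u] and [v]. *)
  have := @gain_pos (- D) (- g) (- G) delta M v u d0.
  rewrite /= -[(- g) v - (- g) u]/(- g v - - g u) (_ : - g v - - g u = g u - g v); last by ring.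
  apply => //.
  + move=> x y; rewrite -[(- D) y - (- D) x]/(- D y - - D x).
    by rewrite -opprB normrN opprK addrC.
  + move=> x Dx; rewrite -[(- G) x]/(- G x) oppr_ge0; apply: (proj2 (Gs x)).
    by rewrite -oppr_ge0.
  + move=> x Dx; have [_ +] := Gd x; rewrite -[(- D) x]/(- D x) sqrrN; exact.
  + by rewrite -[(- D) _]/(- D _) addrC Duv opprB.
Qed.

End TestFunction.

(** * Gaussian integrals *)

Section Density.
Context d (T : measurableType d) (R : realType).
Variables (mu nu : {measure set T -> \bar R}) (p : T -> R).
Hypothesis mp : measurable_fun setT p.
Hypothesis p0 : forall x, 0 <= p x.
Hypothesis nuE : forall A, measurable A -> nu A = (\int[mu]_(x in A) (p x)%:E)%E.
Import HBNNSimple.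
Local Open Scope ereal_scope.

Let mep : measurable_fun setT (EFin \o p).
Proof. exact/measurable_EFinP. Qed.

Let integral_density_nnsfun (h : {nnsfun T >-> R}) :
  \int[nu]_x (h x)%:E = \int[mu]_x ((h x)%:E * (p x)%:E).
Proof.
under [LHS]eq_integral do rewrite fimfunE -fsumEFin//.
rewrite [LHS]ge0_integral_fsum//; last 2 first.
  - by move=> r; exact/measurable_EFinP/measurableT_comp.
  - by move=> n x _; rewrite EFinM nnfun_muleindic_ge0.
under [RHS]eq_integral.
  move=> x xD; rewrite fimfunE -fsumEFin// muleC ge0_mule_fsumr; last first.
    by move=> r; rewrite EFinM nnfun_muleindic_ge0.
  over.
rewrite [RHS]ge0_integral_fsum//; last 2 first.
  - move=> r; apply: emeasurable_funM => //.
    by apply/measurable_EFinP; do 2 apply/measurableT_comp => //.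
  - move=> n x _; rewrite mule_ge0 ?lee_fin//.
    by rewrite -lee_fin EFinM nnfun_muleindic_ge0.
apply: eq_fsbigr => r _.
rewrite integralZl_indic_nnsfun//= integral_indic// setIT nuE//.
have [r0|r0] := ltP r 0%R.
  rewrite preimage_nnfun0// integral_set0 mule0.
  rewrite integral0_eq// => x _.
  by rewrite indic0 mulr0 mule0.
rewrite integral_mkcond -ge0_integralZl//; last 2 first.
  - apply/(measurable_restrictT _ _).1 => //; exact: measurable_funTS.
  - by move=> x _; apply: erestrict_ge0 => y _; rewrite lee_fin.
apply: eq_integral => x _; rewrite patchE indicE; case: ifPn => _.
  by rewrite mulr1 muleC.
by rewrite mulr0 !mule0.
Qed.

Lemma ge0_integral_density (f : T -> \bar R) : measurable_fun setT f ->
  (forall x, 0 <= f x) -> \int[nu]_x f x = \int[mu]_x (f x * (p x)%:E).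
Proof.
move=> mf f0; pose f_ := nnsfun_approx measurableT mf.
transitivity (lim (\int[nu]_x (f_ n x)%:E @[n --> \oo])).
  rewrite -monotone_convergence//=.
  - apply: eq_integral => ? /[!inE] xD; apply/esym/cvg_lim => //=.
    exact: cvg_nnsfun_approx.
  - by move=> n; exact/measurable_EFinP/measurable_funTS.
  - by move=> n ? _; rewrite lee_fin.
  - by move=> ? _ ? ? mn; rewrite lee_fin; exact/lefP/nd_nnsfun_approx.
transitivity (lim (\int[mu]_x ((f_ n x)%:E * (p x)%:E) @[n --> \oo])); last first.
  rewrite -monotone_convergence//=.
  - apply: eq_integral => x /[!inE] xD; apply/cvg_lim => //=.
    apply: cvgeZr => //; exact: cvg_nnsfun_approx.
  - by move=> n; apply: emeasurable_funM => //; exact/measurable_EFinP/measurable_funTS.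
  - by move=> n ? _; rewrite mule_ge0// lee_fin.
  - move=> x _ m n mn; rewrite lee_wpmul2r ?lee_fin//.
    by exact/lefP/nd_nnsfun_approx.
by apply: congr_lim; apply/funext => n /=; exact: integral_density_nnsfun.
Qed.

End Density.

Section Gaussian.
Context {R : realType}.
Local Notation mu := (@lebesgue_measure R).
Local Notation SN := (@standard_normal R).
Local Notation phi := (@normal_pdf R 0 1).

Lemma ge0_integral_standard_normal (f : R -> \bar R) : measurable_fun setT f ->
  (forall x, 0 <= f x)%E ->
  (\int[SN]_x f x = \int[mu]_x (f x * (phi x)%:E))%E.
Proof.
move=> mf f0; rewrite /standard_normal ge0_integral_distribution//=.
rewrite (@ge0_integral_density _ _ _ mu (normal_prob 0 1) phi)//.
  exact: measurable_normal_pdf.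
exact: normal_pdf_ge0.
Qed.

Lemma normal_peakE (s : R) : 0 < s -> normal_peak s = s^-1 * normal_peak 1.
Proof.
move=> s0; rewrite /normal_peak expr1n mul1r -mulrnAr sqrtrM ?sqr_ge0//.
by rewrite sqrtr_sqr gtr0_norm// invfM.
Qed.

Lemma normal_pdf_scale (m s x : R) : 0 < s ->
  normal_pdf m s x = s^-1 * phi ((x - m) / s).
Proof.
move=> s0; rewrite !normal_pdfE ?gt_eqF// normal_peakE// /normal_fun -mulrA.
congr (_ * (_ * expR _)); rewrite subr0 expr1n; field.
by rewrite gt_eqF.
Qed.

(** The substitution [u = c + b * w] moves the affine map from [f] to the density; the semigroup
    property then becomes an identity between densities. *)
Lemma integral_standard_normal_affine (f : R -> R) (c b : R) : 0 < b ->
  continuous f -> (forall x, 0 <= f x) ->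
  (\int[SN]_w (f (c + b * w))%:E = \int[mu]_u (f u * normal_pdf c b u)%:E)%E.
Proof.
move=> b0 cf f0.
have cf' : continuous (fun w => f (c + b * w)).
  move=> w; apply: (@continuous_comp _ _ _ (fun w => c + b * w) f); last exact: cf.
  apply: cvgD; first exact: cvg_cst.
  by apply: cvgM; [exact: cvg_cst|exact: cvg_id].
rewrite (@ge0_integral_standard_normal (fun w => (f (c + b * w))%:E)); last 2 first.
- by apply/measurable_EFinP; exact: continuous_measurable_fun.
- by move=> x; rewrite lee_fin.
pose G w := f (c + b * w) * phi w.
pose F (u : R) := (u - c) / b.
have dF (u : R) : is_derive u 1 F b^-1.
  by apply: is_derive_eq; rewrite /GRing.scale /=; ring.
have F'E : (F^`())%classic = cst b^-1.
  by apply/funext => u; rewrite derive1E; exact: derive_val.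
under eq_integral do rewrite -EFinM.
rewrite (@increasing_ge0_integration_by_substitutionT _ F G).
- apply: eq_integral => u _; rewrite F'E /= normal_pdf_scale// /G /F; congr EFin.
  rewrite -[LHS]/(f (c + b * ((u - c) / b)) * phi ((u - c) / b) * b^-1).
  have -> : c + b * ((u - c) / b) = u by field; rewrite gt_eqF.
  by rewrite mulrA mulrAC.
- by move=> x y xy; rewrite /F ltr_pM2r ?invr_gt0// ltrD2r.
- by rewrite F'E => ?; exact: cvg_cst.
- by rewrite F'E; exact: is_cvg_cst.
- by rewrite F'E; exact: is_cvg_cst.
- by move=> x; have [] := dF x.
- apply/gt0_cvgMlNy; last exact: cvg_addrr_Ny.
  by rewrite invr_gt0.
- apply/gt0_cvgMly; last exact: cvg_addrr.
  by rewrite invr_gt0.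
- move=> x; apply: cvgM; first exact: cf'.
  by apply: continuous_normal_pdf; rewrite oner_eq0.
- by move=> x; rewrite /G mulr_ge0// normal_pdf_ge0.
Qed.

(** Two factorizations of the joint density of [Z] and [U = x + a * Z + b * W]: the law of [U] given
    [Z] times that of [Z], or the law of [U] times that of [Z] given [U], which is normal with mean
    [a * (u - x) / c ^ 2] and deviation [b / c]. *)
Lemma normal_pdf_prod (x a b c u z : R) : 0 < b -> 0 < c -> c ^+ 2 = a ^+ 2 + b ^+ 2 ->
  normal_pdf (x + a * z) b u * phi z =
  normal_pdf x c u * normal_pdf (a * (u - x) / c ^+ 2) (b / c) z.
Proof.
move=> b0 c0 cE.
rewrite !normal_pdfE ?gt_eqF ?divr_gt0//.
rewrite (normal_peakE b0) (normal_peakE c0) (normal_peakE (divr_gt0 b0 c0)).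
rewrite /normal_fun.
have cc e1 e2 e3 e4 : e1 + e2 = e3 + e4 ->
  b^-1 * normal_peak 1 * expR e1 * (normal_peak 1 * expR e2) =
  c^-1 * normal_peak 1 * expR e3 * ((b / c)^-1 * normal_peak 1 * expR e4) :> R.
  move=> e; have := congr1 (@expR R) e; rewrite !expRD => h.
  transitivity (b^-1 * normal_peak 1 ^+ 2 * (expR e1 * expR e2)); first by ring.
  rewrite h; field; by rewrite !gt_eqF.
apply: cc; rewrite expr_div_n cE; field.
have c2 : a ^+ 2 + b ^+ 2 != 0 by rewrite -cE expf_neq0 ?gt_eqF.
by rewrite c2 !gt_eqF.
Qed.

(** After Tonelli, [normal_pdf_prod] leaves in the inner integral over [z] a normal density, of
    total mass 1. *)
Lemma ge0_standard_normal_semigroup (f : R -> R) (x a b : R) : 0 < b ->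
  continuous f -> (forall x, 0 <= f x) ->
  (\int[SN]_z \int[SN]_w (f (x + a * z + b * w))%:E =
   \int[SN]_z (f (x + Num.sqrt (a ^+ 2 + b ^+ 2) * z))%:E)%E.
Proof.
move=> b0 cf f0; pose c := Num.sqrt (a ^+ 2 + b ^+ 2).
have c20 : 0 < a ^+ 2 + b ^+ 2 by rewrite ltr_wpDl ?sqr_ge0// exprn_gt0.
have c0 : 0 < c by rewrite sqrtr_gt0.
have cE : c ^+ 2 = a ^+ 2 + b ^+ 2 by rewrite sqr_sqrtr// ltW.
rewrite -/c integral_standard_normal_affine//.
under eq_integral do rewrite integral_standard_normal_affine//.
pose h (zu : R * R) := (f zu.2 * normal_pdf (x + a * zu.1) b zu.2)%:E.
have h0 zu : (0 <= h zu)%E by rewrite lee_fin mulr_ge0// normal_pdf_ge0.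
have mh : measurable_fun [set: measurableTypeR R * measurableTypeR R] h.
  apply/measurable_EFinP; apply: measurable_funM.
    by apply: measurableT_comp => //; exact: continuous_measurable_fun.
  rewrite (_ : (fun _ => _) = (normal_pdf 0 b) \o (fun zu => zu.2 - (x + a * zu.1))).
    apply: measurableT_comp; first exact: measurable_normal_pdf.
    apply: measurable_funB => //; apply: measurable_funD => //.
    by apply: measurable_funM.
  apply/funext => zu /=; rewrite normal_pdf_scale// [RHS]normal_pdf_scale//.
  by rewrite subr0.
rewrite (@ge0_integral_standard_normal (fun z => \int[mu]_u h (z, u))%E); last 2 first.
- exact: (@measurable_fun_fubini_tonelli_F _ _ _ _ _ mu h).
- by move=> z; apply: integral_ge0 => u _; exact: h0.
transitivity (\int[mu]_z \int[mu]_u (h (z, u) * (phi z)%:E))%E.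
  apply: eq_integral => z _; rewrite ge0_integralZr//.
  - exact/measurableT_comp.
  - by rewrite lee_fin normal_pdf_ge0.
rewrite (@fubini_tonelli _ _ _ _ _ mu mu (fun zu => h zu * (phi zu.1)%:E)%E); last 2 first.
- apply: emeasurable_funM => //; apply/measurable_EFinP.
  apply: measurableT_comp => //; exact: measurable_normal_pdf.
- move=> zu; apply: mule_ge0; first exact: h0.
  by rewrite lee_fin; exact: normal_pdf_ge0.
apply: eq_integral => u _; rewrite /h /=.
under eq_integral.
  move=> z _.
  rewrite -EFinM -mulrA (normal_pdf_prod _ _ _ b0 c0 cE) mulrA EFinM.
  over.
rewrite ge0_integralZl//.
- by rewrite integral_normal_pdf mule1.
- by apply/measurable_EFinP; exact: measurable_normal_pdf.
- by move=> z _; rewrite lee_fin normal_pdf_ge0.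
- by rewrite lee_fin mulr_ge0// normal_pdf_ge0.
Qed.

End Gaussian.

Section Sections.
Context d (T : measurableType d) d' (T' : measurableType d') (R : realType).
Variable m : {sigma_finite_measure set T' -> \bar R}.

(** Holds for every measurable [h], because [Rintegral] is [fine] of a difference of two Tonelli
    integrals, and each of these operations preserves measurability. *)
Lemma measurable_Rintegral_section (h : T * T' -> R) : measurable_fun setT h ->
  measurable_fun setT (fun w => \int[m]_z h (w, z)).
Proof.
move=> mh; have mh' : measurable_fun setT (EFin \o h) by exact/measurable_EFinP.
have mp := measurable_fun_fubini_tonelli_F (m2 := m) ((EFin \o h)^\+)%E
  (measurable_funepos mh') (fun x => funepos_ge0 _ x).
have mn := measurable_fun_fubini_tonelli_F (m2 := m) ((EFin \o h)^\-)%E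
  (measurable_funeneg mh') (fun x => funeneg_ge0 _ x).
rewrite (_ : (fun w => _) = @fine R \o
    (fubini_F m (EFin \o h)^\+ \- fubini_F m (EFin \o h)^\-)%E).
  by apply: measurableT_comp => //; exact: emeasurable_funB.
by apply/funext => w /=; rewrite /Rintegral integralE /fubini_F !unlock.
Qed.

End Sections.

Section GaussianMoments.
Context {R : realType}.
Local Notation mu := (@lebesgue_measure R).
Local Notation SN := (@standard_normal R).
Local Notation phi := (@normal_pdf R 0 1).

(** Exponential tilting shifts the density; its quadratic analogue below dilates it. Integrated, the
    two identities yield the first two moments and all integrability, with no integration by
    parts. *)
Lemma standard_normal_tilt (t z : R) :
  expR (t * z - t ^+ 2 / 2) * phi z = normal_pdf t 1 z.
Proof.
rewrite !normal_pdfE ?oner_eq0// mulrCA; congr (_ * _).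
by rewrite /normal_fun -expRD; congr expR; field.
Qed.

Lemma standard_normal_dilate (s z : R) : 0 < s ->
  expR (- (s ^- 2 - 1) * z ^+ 2 / 2) * phi z = s * normal_pdf 0 s z.
Proof.
move=> s0; rewrite !normal_pdfE ?oner_eq0 ?gt_eqF// (normal_peakE s0).
have <- : expR (- (s ^- 2 - 1) * z ^+ 2 / 2) * normal_fun 0 1 z = normal_fun 0 s z.
  by rewrite /normal_fun -expRD; congr expR; field; rewrite gt_eqF.
by field; rewrite gt_eqF.
Qed.

Lemma integral_standard_normal_tilt (t : R) :
  (\int[SN]_z (expR (t * z - t ^+ 2 / 2))%:E = 1)%E.
Proof.
rewrite ge0_integral_standard_normal; last 2 first.
- apply/measurable_EFinP; apply: measurableT_comp => //.
  by apply: measurable_funB => //; exact: measurable_funM.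
- by move=> z; rewrite lee_fin expR_ge0.
under eq_integral do rewrite -EFinM standard_normal_tilt.
exact: integral_normal_pdf.
Qed.

Lemma integral_standard_normal_dilate (s : R) : 0 < s ->
  (\int[SN]_z (expR (- (s ^- 2 - 1) * z ^+ 2 / 2))%:E = s%:E)%E.
Proof.
move=> s0; rewrite ge0_integral_standard_normal; last 2 first.
- apply/measurable_EFinP; apply: measurableT_comp => //.
  by apply: measurable_funM => //; apply: measurable_funM => //; exact: measurable_funX.
- by move=> z; rewrite lee_fin expR_ge0.
under eq_integral do rewrite -EFinM standard_normal_dilate// EFinM.
rewrite ge0_integralZl ?lee_fin ?(ltW s0)//.
- by rewrite integral_normal_pdf mule1.
- by apply/measurable_EFinP; exact: measurable_normal_pdf.
- by move=> z _; rewrite lee_fin normal_pdf_ge0.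
Qed.

(** [z ^ 2 / 4] is the exponent of [integral_standard_normal_dilate] at [s ^ 2 = 2]. The bound comes
    from squaring [1 + u <= exp u] at [u = z ^ 2 / 8]. *)
Lemma cube_le_expR (z : R) : 1 + `|z| ^+ 3 <= 40 * expR (z ^+ 2 / 4).
Proof.
have -> : z ^+ 2 / 4 = z ^+ 2 / 8 + z ^+ 2 / 8 by field.
have h := expR_ge1Dx (z ^+ 2 / 8); rewrite expRD.
rewrite -(real_normK (num_real z)) in h *.
move: (`|z|) (normr_ge0 z) h => y y0 h.
have h2 : (1 + y ^+ 2 / 8) * (1 + y ^+ 2 / 8) <= expR (y ^+ 2 / 8) * expR (y ^+ 2 / 8).
  by apply: ler_pM => //; have := sqr_ge0 y; lra.
suff : 1 + y ^+ 3 <= 40 * ((1 + y ^+ 2 / 8) * (1 + y ^+ 2 / 8)) by lra.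
have : 0 <= (y ^+ 2 - y) ^+ 2 by exact: sqr_ge0.
have : 0 <= (y - 1) ^+ 2 by exact: sqr_ge0.
have := sqr_ge0 y; have := sqr_ge0 (y ^+ 2).
rewrite -!exprM (_ : (y ^+ 2 - y) ^+ 2 = y ^+ 4 - 2 * y ^+ 3 + y ^+ 2); last by ring.
rewrite (_ : (y - 1) ^+ 2 = y ^+ 2 - 2 * y + 1); last by ring.
rewrite (_ : (1 + y ^+ 2 / 8) * (1 + y ^+ 2 / 8) = 1 + y ^+ 2 / 4 + y ^+ 4 / 64); last by field.
nra.
Qed.

Lemma standard_normal_integrable (f : R -> R) (A : R) : measurable_fun setT f ->
  (forall z, `|f z| <= A * (1 + `|z| ^+ 3)) ->
  SN.-integrable setT (EFin \o f).
Proof.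
move=> mf fA; pose s : R := Num.sqrt 2.
have s0 : 0 < s by rewrite sqrtr_gt0.
have sE : - (s ^- 2 - 1) = 2^-1 by rewrite sqr_sqrtr//; field.
have A0 : 0 <= A by have := fA 0; rewrite normr0 expr0n addr0 mulr1; exact: le_trans.
pose g z : R := 40 * A * expR (z ^+ 2 / 4).
have mg : measurable_fun setT g.
  apply: measurable_funM => //; apply: measurableT_comp => //.
  by apply: measurable_funM => //; exact: measurable_funX.
apply: (@le_integrable _ _ _ _ _ measurableT _ (EFin \o g)).
- exact/measurable_EFinP.
- move=> z _ /=; rewrite lee_fin (le_trans (fA z))//.
  rewrite [leRHS]ger0_norm; last by rewrite /g !mulr_ge0 ?expR_ge0.
  by rewrite /g -mulrA mulrCA ler_wpM2l// cube_le_expR.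
- apply/integrableP; split; first exact/measurable_EFinP.
  under eq_integral.
    move=> z _; rewrite /= ger0_norm; last by rewrite /g !mulr_ge0 ?expR_ge0.
    rewrite /g (_ : z ^+ 2 / 4 = - (s ^- 2 - 1) * z ^+ 2 / 2); last by rewrite sE; field.
    rewrite EFinM; over.
  rewrite ge0_integralZl//.
  + by rewrite integral_standard_normal_dilate// -EFinM ltry.
  + apply/measurable_EFinP; apply: measurableT_comp => //.
    by apply: measurable_funM => //; apply: measurable_funM => //; exact: measurable_funX.
  + by rewrite lee_fin mulr_ge0.
Qed.

Lemma pow_le_cube (z : R) : [/\ 1 <= 1 + `|z| ^+ 3, `|z| <= 1 + `|z| ^+ 3,
  z ^+ 2 <= 1 + `|z| ^+ 3 & `|z| ^+ 3 <= 1 + `|z| ^+ 3].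
Proof.
rewrite -(real_normK (num_real z)); move: (`|z|) (normr_ge0 z) => y y0.
have y3 : 0 <= y ^+ 3 by rewrite exprn_ge0.
split; rewrite ?lerDl ?lerDr//.
  have [y1|y1] := lerP y 1; first by lra.
  have : y <= y ^+ 3 by rewrite -[leLHS]expr1 ler_eXn2l//; lra.
  lra.
have [y1|y1] := lerP y 1.
  have : y ^+ 2 <= 1 by rewrite exprn_ile1.
  lra.
have : y ^+ 2 <= y ^+ 3 by rewrite ler_eXn2l.
lra.
Qed.

Lemma standard_normal_integrable_cst (c : R) : SN.-integrable setT (EFin \o cst c).
Proof.
apply: (@standard_normal_integrable _ `|c|) => // z.
by have [h _ _ _] := pow_le_cube z; rewrite ler_peMr.
Qed.

Lemma standard_normal_integrable_id : SN.-integrable setT (EFin \o (fun z : R => z)).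
Proof.
apply: (@standard_normal_integrable _ 1) => // z.
by have [_ h _ _] := pow_le_cube z; rewrite mul1r.
Qed.

Lemma standard_normal_integrable_sqr : SN.-integrable setT (EFin \o (fun z : R => z ^+ 2)).
Proof.
apply: (@standard_normal_integrable _ 1) => // z.
by have [_ _ h _] := pow_le_cube z; rewrite mul1r ger0_norm ?sqr_ge0.
Qed.

Lemma standard_normal_integrable_cube : SN.-integrable setT (EFin \o (fun z : R => `|z| ^+ 3)).
Proof.
apply: (@standard_normal_integrable _ 1) => [|z].
  by apply: measurable_funX; exact: normr_measurable.
by have [_ _ _ h] := pow_le_cube z; rewrite mul1r ger0_norm ?exprn_ge0.
Qed.

Lemma Rintegral_standard_normal_cst (c : R) : \int[SN]_z c = c.
Proof.
rewrite Rintegral_cst//.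
have -> : fine (SN setT) = 1 :> R by rewrite (@probability_setT _ _ _ SN).
by rewrite mulr1.
Qed.

(** Integrating [1 + x <= exp x] along the tilt gives [t * m <= t ^ 2 / 2] for the mean [m] and
    every [t]; [t = m] forces [m = 0]. *)
Lemma Rintegral_standard_normal_mean : \int[SN]_z z = 0.
Proof.
have key t : 1 + t * (\int[SN]_z z) - t ^+ 2 / 2 <= 1.
  have e1 : \int[SN]_z expR (t * z - t ^+ 2 / 2) = 1.
    by rewrite /Rintegral integral_standard_normal_tilt.
  have i1 : SN.-integrable setT (EFin \o (fun z : R => t * z)).
    exact: integrable_realZ standard_normal_integrable_id.
  have i2 : SN.-integrable setT (EFin \o (fun z : R => 1 - t ^+ 2 / 2)).
    exact: standard_normal_integrable_cst.
  rewrite -[leRHS]e1 -RintegralZl//; last exact: standard_normal_integrable_id.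
  rewrite addrAC -[X in X + _](Rintegral_standard_normal_cst).
  rewrite -RintegralD//; apply: le_Rintegral => //.
  - exact: integrable_realD.
  - apply/integrableP; split.
      apply/measurable_EFinP; apply: measurableT_comp => //.
      by apply: measurable_funB => //; exact: measurable_funM.
    under eq_integral do rewrite /= ger0_norm ?expR_ge0//.
    by rewrite integral_standard_normal_tilt ltry.
  - move=> z _; have := expR_ge1Dx (t * z - t ^+ 2 / 2); lra.
move: (\int[SN]_z z) key => m key.
have := key m; have := sqr_ge0 m; rewrite -expr2 => ? ?.
by apply/eqP; rewrite -sqrf_eq0; apply/eqP; lra.
Qed.

(** The same convexity bound along the dilation gives [(s - 1) * (s + 1) * m <= (s - 1) * 2 * s ^ 2]
    for all [s > 0]. Near 1, [s > 1] excludes [m > 1] and [s < 1] excludes [m < 1]; explicit values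
    of [s] replace a limit. *)
Lemma Rintegral_standard_normal_var : \int[SN]_z (z ^+ 2) = 1.
Proof.
have key s : 0 < s -> 1 - (s ^- 2 - 1) / 2 * (\int[SN]_z (z ^+ 2)) <= s.
  move=> s0.
  have e1 : \int[SN]_z expR (- (s ^- 2 - 1) * z ^+ 2 / 2) = s.
    by rewrite /Rintegral integral_standard_normal_dilate.
  rewrite -[leRHS]e1 -RintegralZl//; last exact: standard_normal_integrable_sqr.
  rewrite -[X in X - _](Rintegral_standard_normal_cst).
  have i1 : SN.-integrable setT (EFin \o (fun z : R => (s ^- 2 - 1) / 2 * z ^+ 2)).
    exact: integrable_realZ standard_normal_integrable_sqr.
  have i2 := standard_normal_integrable_cst 1.
  rewrite -RintegralB//; apply: le_Rintegral => //.
  - exact: integrable_realB.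
  - apply/integrableP; split.
      apply/measurable_EFinP; apply: measurableT_comp => //.
      by apply: measurable_funM => //; apply: measurable_funM => //; exact: measurable_funX.
    under eq_integral do rewrite /= ger0_norm ?expR_ge0//.
    by rewrite integral_standard_normal_dilate// ltry.
  - move=> z _; have := expR_ge1Dx (- (s ^- 2 - 1) * z ^+ 2 / 2); lra.
have m0 : 0 <= \int[SN]_z (z ^+ 2) by apply: Rintegral_ge0 => z _; exact: sqr_ge0.
move: (\int[SN]_z (z ^+ 2)) m0 key => m m0 key.
have key2 s : 0 < s -> (s - 1) * ((s + 1) * m) <= (s - 1) * (2 * s ^+ 2).
  move=> s0; have := key s s0.
  have s2 : 0 < s ^+ 2 by rewrite exprn_gt0.
  rewrite -(ler_pM2r s2).
  have -> : (1 - (s ^- 2 - 1) / 2 * m) * s ^+ 2 = s ^+ 2 - (1 - s ^+ 2) / 2 * m.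
    by field; rewrite gt_eqF.
  by lra.
apply/eqP; rewrite eq_le; apply/andP; split; rewrite leNgt; apply/negP => m1.
- pose e := (m - 1) / (4 + m).
  have e0 : 0 < e by rewrite divr_gt0; lra.
  have e1 : e <= 1 by rewrite ler_pdivrMr; lra.
  have := key2 (1 + e); rewrite addrAC subrr add0r ler_pM2l// => /(_ _).
  have em : e * (4 + m) = m - 1 by rewrite divfK// gt_eqF; lra.
  nra.
- pose e := (1 - m) / 5.
  have e0 : 0 < e by rewrite divr_gt0; lra.
  have := key2 (1 - e); rewrite addrAC subrr add0r !mulNr lerN2 ler_pM2l// => /(_ _).
  have em : e * 5 = 1 - m by rewrite divfK.
  nra.
Qed.

Definition lipschitz_with (K : R) (f : R -> R) :=
  forall x y, `|f y - f x| <= K * `|y - x|.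

Lemma lipschitz_with_ge0 K f : lipschitz_with K f -> 0 <= K.
Proof. by move=> /(_ 0 1); rewrite subr0 normr1 mulr1; exact: le_trans. Qed.

Lemma lipschitz_with_measurable K f : lipschitz_with K f -> measurable_fun setT f.
Proof. by move=> fK; apply: continuous_measurable_fun; apply: lipschitz_continuous fK. Qed.

Lemma lipschitz_integrable_affine K f (x a : R) : lipschitz_with K f ->
  SN.-integrable setT (EFin \o (fun z => f (x + a * z))).
Proof.
move=> fK; have K0 := lipschitz_with_ge0 fK.
apply: (@standard_normal_integrable _ (`|f x| + K * `|a|)).
  apply: measurableT_comp; first exact: lipschitz_with_measurable fK.
  by apply: measurable_funD => //; exact: measurable_funM.
move=> z; have [h1 h2 _ _] := pow_le_cube z.
rewrite -[f _](subrK (f x)) addrC (le_trans (ler_normD _ _))// mulrDl lerD//.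
  by rewrite ler_peMr.
apply: (le_trans (fK _ _)); rewrite addrAC subrr add0r normrM mulrA.
by rewrite ler_wpM2l// mulr_ge0.
Qed.

(** The density argument takes [0 < b]; the case [b = 0] is added because a skipped step carries no
    variance. Finiteness of the right-hand integral provides integrability of the inner one. *)
Lemma ge0_lipschitz_semigroup K f (x a b : R) : 0 <= a -> 0 <= b ->
  lipschitz_with K f -> (forall x, 0 <= f x) ->
  SN.-integrable setT (EFin \o (fun z => \int[SN]_w f (x + a * z + b * w))) /\
  \int[SN]_z (\int[SN]_w f (x + a * z + b * w)) =
  \int[SN]_z f (x + Num.sqrt (a ^+ 2 + b ^+ 2) * z).
Proof.
move=> a0; rewrite le_eqVlt => /predU1P[<-|b0] fK f0.
  rewrite expr0n addr0 sqrtr_sqr ger0_norm//.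
  have -> : (fun z => \int[SN]_w f (x + a * z + 0 * w)) = (fun z => f (x + a * z)).
    by apply/funext => z; under eq_Rintegral do rewrite mul0r addr0;
      rewrite Rintegral_standard_normal_cst.
  by split=> //; exact: lipschitz_integrable_affine fK.
have cf := lipschitz_continuous fK.
have E := ge0_standard_normal_semigroup x a b0 cf f0.
have inE z : (\int[SN]_w f (x + a * z + b * w))%:E =
    (\int[SN]_w (f (x + a * z + b * w))%:E)%E.
  rewrite /Rintegral fineK//; apply: integrable_fin_num => //.
  exact: lipschitz_integrable_affine fK.
have fin := integrable_fin_num measurableT
  (lipschitz_integrable_affine x (Num.sqrt (a ^+ 2 + b ^+ 2)) fK).
split; last by rewrite /Rintegral; under eq_integral do rewrite inE; rewrite E.
apply/integrableP; split.
  apply/measurable_EFinP.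
  apply: (@measurable_Rintegral_section _ _ _ _ _ SN
    (fun zw : R * R => f (x + a * zw.1 + b * zw.2))).
  apply: measurableT_comp; first exact: lipschitz_with_measurable fK.
  by apply: measurable_funD; [apply: measurable_funD => //|]; exact: measurable_funM.
under eq_integral.
  move=> z _; rewrite /= ger0_norm; last by apply: Rintegral_ge0.
  rewrite inE; over.
by rewrite E ltey_eq fin.
Qed.

Lemma lipschitz_semigroup K f (x a b : R) : 0 <= a -> 0 <= b ->
  lipschitz_with K f ->
  SN.-integrable setT (EFin \o (fun z => \int[SN]_w f (x + a * z + b * w))) /\
  \int[SN]_z (\int[SN]_w f (x + a * z + b * w)) =
  \int[SN]_z f (x + Num.sqrt (a ^+ 2 + b ^+ 2) * z).
Proof.
move=> a0 b0 fK.
pose fp y := Num.max (f y) 0; pose fn y := Num.max (- f y) 0.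
have fE y : f y = fp y - fn y.
  rewrite /fp /fn; have [h|h] := lerP (f y) 0.
    by rewrite (@max_l _ _ (- f y)); lra.
  by rewrite (@max_r _ _ (- f y)); lra.
have fpK : lipschitz_with K fp.
  move=> y z; apply: le_trans (fK y z); rewrite /fp.
  rewrite ler_norml; have := ler_norm (f z - f y); have := ler_norm (f y - f z).
  rewrite (distrC (f y)).
  by have [h|h] := lerP (f y) 0; have [h'|h'] := lerP (f z) 0; lra.
have fnK : lipschitz_with K fn.
  move=> y z; apply: le_trans (fK y z); rewrite /fn.
  rewrite ler_norml; have := ler_norm (f z - f y); have := ler_norm (f y - f z).
  rewrite (distrC (f y)).
  by have [h|h] := lerP (- f y) 0; have [h'|h'] := lerP (- f z) 0; lra.
have [i1 e1] := ge0_lipschitz_semigroup x a0 b0 fpK (fun y => ltac:(by rewrite le_max lexx orbT)).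
have [i2 e2] := ge0_lipschitz_semigroup x a0 b0 fnK (fun y => ltac:(by rewrite le_max lexx orbT)).
have -> : (fun z => \int[SN]_w f (x + a * z + b * w)) =
    (fun z => \int[SN]_w fp (x + a * z + b * w) - \int[SN]_w fn (x + a * z + b * w)).
  apply/funext => z; rewrite -RintegralB//.
  - by apply: eq_Rintegral => w _; rewrite fE.
  - exact: lipschitz_integrable_affine fpK.
  - exact: lipschitz_integrable_affine fnK.
split; first exact: integrable_realB.
rewrite RintegralB// e1 e2 -RintegralB//.
- by apply: eq_Rintegral => w _; rewrite fE.
- exact: lipschitz_integrable_affine fpK.
- exact: lipschitz_integrable_affine fnK.
Qed.

End GaussianMoments.

(** * The quantile coupling *)

Section RandomVariables.
Context d (T : measurableType d) (R : realType) (P : probability T R).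

Definition RV_of (f : T -> R) (mf : measurable_fun setT f) : {RV P >-> R} :=
  HB.pack f (isMeasurableFun.Build _ _ _ _ f mf).

End RandomVariables.

Section Quantile.
Context {R : realType}.
Implicit Types (mu nu : probability R R) (x y t : R).

Lemma probability_eq_ray mu nu :
  (forall x, mu `]x, +oo[%classic = nu `]x, +oo[%classic) ->
  forall A, measurable A -> mu A = nu A.
Proof.
move=> munu; apply: (@measure_unique _ _ _ (@RGenOInfty.G R)
    (fun k => `](- k%:R), +oo[%classic)).
- exact: RGenOInfty.measurableE.
- move=> _ _ [x ->] [y ->]; exists (Num.max x y).
  apply/seteqP; split => z /=; rewrite !in_itv /= !andbT gt_max.
    by move=> [-> ->].
  by move=> /andP[].
- by move=> k; exists (- k%:R).
- rewrite -subTset => z _; exists (Num.truncn `|z|).+1 => //=.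
  rewrite in_itv /= andbT ltrNl (le_lt_trans _ (truncnS_gt `|z|))//.
  by rewrite -normrN ler_norm.
- by move=> _ [x ->]; exact: munu.
- by move=> k; rewrite (le_lt_trans (probability_le1 _ _))// ltry.
Qed.

Definition pcdf mu x : R := fine (mu `]-oo, x]%classic).

Lemma pcdfE mu x : mu `]-oo, x]%classic = (pcdf mu x)%:E.
Proof. by rewrite fineK// fin_num_measure. Qed.

Lemma pcdf_bounded mu x : 0 <= pcdf mu x <= 1.
Proof. by rewrite -!lee_fin -pcdfE measure_ge0 probability_le1. Qed.

Lemma pcdf_nondecreasing mu x y : x <= y -> pcdf mu x <= pcdf mu y.
Proof.
move=> xy; rewrite -lee_fin -!pcdfE le_measure ?inE//.
by move=> z /=; rewrite !in_itv /= => /le_trans; apply.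
Qed.

Lemma pcdf_ccdf mu x : mu `]x, +oo[%classic = (1 - pcdf mu x)%:E.
Proof.
have -> : `]x, +oo[%classic = ~` `]-oo, x]%classic :> set R.
  by rewrite setCitvl.
by rewrite probability_setC// pcdfE.
Qed.

Lemma pcdf_right mu x t : (forall y, x < y -> t <= pcdf mu y) -> t <= pcdf mu x.
Proof.
move=> ty.
have cv : mu (`]-oo, (x + n.+1%:R^-1)]%classic) @[n --> \oo] -->
    mu (\bigcap_n `]-oo, (x + n.+1%:R^-1)]%classic).
  apply: nonincreasing_cvg_mu => //.
  - by rewrite (le_lt_trans (probability_le1 _ _))// ltry.
  - by apply: bigcap_measurable.
  - move=> n m nm; apply/subsetPset => z /=; rewrite !in_itv /= => /le_trans; apply.
    by rewrite lerD2l lef_pV2 ?posrE// ler_nat.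
rewrite -itvNycEbigcap in cv.
rewrite -lee_fin -pcdfE -(cvg_lim _ cv)//; apply: lime_ge.
  by apply/cvg_ex; eexists; exact: cv.
by near=> n; rewrite pcdfE lee_fin ty// ltrDl.
Unshelve. all: by end_near. Qed.

Lemma pcdf_cvgy mu t : t < 1 -> exists x, t <= pcdf mu x.
Proof.
move=> t1; apply: contrapT => /forallNP tx.
have cv : mu (`]-oo, n%:R]%classic) @[n --> \oo] --> mu (\bigcup_n `]-oo, n%:R]%classic).
  apply: nondecreasing_cvg_mu => //.
  - by apply: bigcup_measurable.
  - move=> n m nm; apply/subsetPset => z /=; rewrite !in_itv /= => /le_trans; apply.
    by rewrite ler_nat.
have uT : \bigcup_n `]-oo, n%:R]%classic = [set: R].
  rewrite -subTset => z _; exists (Num.truncn z).+1 => //=.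
  by rewrite in_itv /= ltW// truncnS_gt.
rewrite uT probability_setT in cv.
have : (1 <= t%:E)%E.
  rewrite -(cvg_lim _ cv)//; apply: lime_le.
    by apply/cvg_ex; eexists; exact: cv.
  by near=> n; rewrite pcdfE lee_fin ltW// ltNge; apply/negP; exact: tx.
by rewrite lee_fin leNgt t1.
Unshelve. all: by end_near. Qed.

Lemma pcdf_cvgNy mu t : 0 < t -> exists x, pcdf mu x < t.
Proof.
move=> t0; apply: contrapT => /forallNP tx.
have cv : mu (`]-oo, (- n%:R)]%classic) @[n --> \oo] -->
    mu (\bigcap_n `]-oo, (- n%:R)]%classic).
  apply: nonincreasing_cvg_mu => //.
  - by rewrite (le_lt_trans (probability_le1 _ _))// ltry.
  - by apply: bigcap_measurable.
  - move=> n m nm; apply/subsetPset => z /=; rewrite !in_itv /= => /le_trans; apply.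
    by rewrite lerN2 ler_nat.
have u0 : \bigcap_n `]-oo, (- n%:R)]%classic = set0 :> set R.
  rewrite -subset0 => z /(_ (Num.truncn (- z)).+1 I) /=.
  by rewrite in_itv /= lerNr leNgt truncnS_gt.
rewrite u0 measure0 in cv.
have : (t%:E <= 0)%E.
  rewrite -(cvg_lim _ cv)//; apply: lime_ge.
    by apply/cvg_ex; eexists; exact: cv.
  by near=> n; rewrite pcdfE lee_fin leNgt; apply/negP; exact: tx.
by rewrite lee_fin leNgt t0.
Unshelve. all: by end_near. Qed.

Definition quantile mu t : R := inf [set x | t <= pcdf mu x].

(** A Galois connection, due to right continuity of the distribution function: the infimum is
    attained. Monotonicity, measurability and the law of the quantile all follow from it. *)
Lemma quantile_le mu t x : 0 < t < 1 -> (quantile mu t <= x) = (t <= pcdf mu x).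
Proof.
move=> /andP[t0 t1].
have ne : [set x | t <= pcdf mu x] !=set0 by exact: pcdf_cvgy.
have lb : has_lbound [set x | t <= pcdf mu x].
  have [y yt] := pcdf_cvgNy mu t0; exists y => z /= tz.
  rewrite leNgt; apply/negP => /ltW/(pcdf_nondecreasing mu) zy.
  by move: (lt_le_trans yt tz); rewrite ltNge zy.
apply/idP/idP => [qx|tx]; last exact: ge_inf.
apply: pcdf_right => y xy.
have [z tz zy] := inf_lt ne (le_lt_trans qx xy).
exact: le_trans tz (pcdf_nondecreasing mu (ltW zy)).
Qed.

Lemma quantile_nondecreasing mu t t' : 0 < t < 1 -> 0 < t' < 1 -> t <= t' ->
  quantile mu t <= quantile mu t'.
Proof.
by move=> h h' tt'; rewrite quantile_le// (le_trans tt')// -quantile_le.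
Qed.

(** Sends the complement of []0, 1[], null for the uniform law, to an interior point, so that the
    relation between [D], [U] and [V] holds for every [t]. *)
Definition clip01 t : R := if (0 < t) && (t < 1) then t else 2^-1.

Lemma clip01_in t : 0 < clip01 t < 1.
Proof. by rewrite /clip01; case: ifP => //; lra. Qed.

Lemma measurable_clip01 : measurable_fun [set: measurableTypeR R] clip01.
Proof.
apply: measurable_fun_ifT => //.
by apply: measurable_and; apply: measurable_fun_ltr.
Qed.

Lemma measurable_quantile mu :
  measurable_fun [set: measurableTypeR R] (fun t => quantile mu (clip01 t)).
Proof.
apply: (measurability _ (RGenOInfty.measurableE R)) => //.
move=> _ [_ [x ->] <-]; rewrite setTI.
rewrite (_ : _ @^-1` _ = clip01 @^-1` `]pcdf mu x, +oo[%classic).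
  rewrite -[X in measurable X]setTI; apply: measurable_clip01 => //.
by apply/seteqP; split => t /=; rewrite !in_itv /= !andbT !ltNge quantile_le ?clip01_in.
Qed.

Let lt01 : (0 : R) < 1 := ltr01.
Local Notation U01 := (uniform_prob lt01).

Lemma uniform_prob_in : U01 `]0, 1[%classic = 1%E.
Proof.
rewrite /uniform_prob (eq_integral (fun=> 1%E)); last first.
  move=> t; rewrite inE /= in_itv /= => /andP[t0 t1].
  by rewrite /uniform_pdf !ltW// subr0 invr1.
by rewrite integral_cst//= lebesgue_measure_itv /= lte_fin ltr01 oppr0 adde0 mule1.
Qed.

Lemma uniform_prob_eq (A B : set (measurableTypeR R)) : measurable A -> measurable B ->
  (forall t, 0 < t < 1 -> A t <-> B t) -> U01 A = U01 B.
Proof.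
move=> mA mB AB.
have out : U01 (~` `]0, 1[%classic) = 0%E.
  by rewrite probability_setC// [X in (1 - X)%E]uniform_prob_in subee.
have E C : measurable C -> U01 C = U01 (C `&` `]0, 1[%classic).
  move=> mC; rewrite -[in LHS](setUIDK C `]0, 1[%classic) measureU//.
  - rewrite [X in (_ + X)%E](_ : _ = 0%E) ?adde0//.
    apply/eqP; rewrite eq_le measure_ge0 andbT -out le_measure ?inE//.
    + exact: measurableD.
    + exact: measurableC.
  - exact: measurableI.
  - exact: measurableD.
  - by rewrite setDE setIACA setICr setI0.
rewrite E// (E B)//; congr (U01 _); apply/seteqP; split => t [h1 h2]; split => //;
  move: h2; rewrite /= in_itv /= => h2; exact/(AB _ h2).
Qed.

Lemma uniform_prob_ray x : 0 <= x <= 1 -> U01 `]x, +oo[%classic = (1 - x)%:E.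
Proof.
move=> /andP[x0 x1]; rewrite (@uniform_prob_eq _ `]x, 1[%classic)//; last first.
  by move=> t /andP[t0 t1]; rewrite /= !in_itv /= t1 andbT.
rewrite /uniform_prob (eq_integral (fun=> 1%E)); last first.
  move=> t; rewrite inE /= in_itv /= => /andP[t0 t1].
  by rewrite /uniform_pdf (le_trans x0) ?ltW// subr0 invr1.
rewrite integral_cst//= lebesgue_measure_itv /= lte_fin mul1e.
by case: ltP => // h; rewrite (_ : x = 1) ?subrr//; lra.
Qed.

Definition quantile_RV mu : {RV U01 >-> R} := RV_of U01 (measurable_quantile mu).

Lemma quantile_has_law mu : has_law (quantile_RV mu) mu.
Proof.
apply: (@probability_eq_ray (distribution _ (quantile_RV mu)) mu) => x.
pose A := (fun t => quantile mu (clip01 t)) @^-1` `]x, +oo[%classic.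
have mA : measurable A.
  by rewrite -[A]setTI; apply: (measurable_quantile mu).
rewrite [RHS]pcdf_ccdf -(uniform_prob_ray (pcdf_bounded mu x)).
have := @uniform_prob_eq A `]pcdf mu x, +oo[%classic mA (measurable_itv _); apply.
move=> t t01; rewrite /A /= !in_itv /= !andbT !ltNge quantile_le ?clip01_in//.
by rewrite /clip01 t01.
Qed.

Lemma quantile_coupling mu nu :
  exists (U V : {RV U01 >-> R}) (D : R -> R), [/\ has_law U mu, has_law V nu,
    (forall x y, `|D y - D x| <= 2 * `|y - x|) &
    (forall t, D ((U t + V t) / 2) = U t - V t)].
Proof.
exists (quantile_RV mu), (quantile_RV nu).
pose u t := quantile mu (clip01 t); pose v t := quantile nu (clip01 t).
pose w t := (u t + v t) / 2; pose e t := u t - v t.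
(* The increments of [u] and [v] have the same sign, so the absolute value of their difference is at
   most that of their sum, which is twice the increment of [w]. *)
have lip s t : e t - e s <= 2 * `|w t - w s|.
  suff H : forall s t, clip01 s <= clip01 t ->
      e t - e s <= 2 * `|w t - w s| /\ e s - e t <= 2 * `|w t - w s|.
    have /orP[h|h] := le_total (clip01 s) (clip01 t).
      by have [] := H _ _ h.
    by have [_] := H _ _ h; rewrite distrC.
  move=> {}s {}t st.
  have h1 : u s <= u t by apply: quantile_nondecreasing; rewrite ?clip01_in.
  have h2 : v s <= v t by apply: quantile_nondecreasing; rewrite ?clip01_in.
  by rewrite ger0_norm /w /e; lra.
(* McShane extension: the infimum of the cones of slope 2 standing on the graph of [e] over [w]
   extends this Lipschitz function from the values of [w] to the line. *)
pose S x := [set e t + 2 * `|x - w t| | t in [set: R]].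
have Slb x t : lbound (S x) (e t - 2 * `|x - w t|).
  move=> _ [s _ <-]; have := lip s t.
  have := ler_distD x (w t) (w s); rewrite (distrC (w t) x); lra.
have Sne x : S x !=set0 by exists (e 0 + 2 * `|x - w 0|); exists 0.
have Shl x : has_lbound (S x) by exists (e 0 - 2 * `|x - w 0|); exact: Slb.
exists (fun x => inf (S x)); split.
- exact: quantile_has_law.
- exact: quantile_has_law.
- have half x y : inf (S y) <= inf (S x) + 2 * `|y - x|.
    rewrite -lerBlDr; apply: lb_le_inf => // _ [t _ <-].
    rewrite lerBlDr; apply: (@le_trans _ _ (e t + 2 * `|y - w t|)).
      by apply: ge_inf => //; exists t.
    have := ler_distD x y (w t); lra.
  move=> x y; rewrite ler_norml; have := half x y; have := half y x.
  rewrite (distrC x y); lra.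
- move=> t; rewrite -[RHS]/(e t) -[(_ + _) / 2]/(w t).
  apply/eqP; rewrite eq_le; apply/andP; split.
    apply: (@le_trans _ _ (e t + 2 * `|w t - w t|)).
      by apply: ge_inf => //; exists t.
    by rewrite subrr normr0 mulr0 addr0.
  apply: lb_le_inf => //; have := Slb (w t) t.
  by rewrite subrr normr0 mulr0 subr0.
Qed.

End Quantile.

(** * Conditional expectations *)

Section Adapted.
Context {R : realType} d (T : measurableType d) (P : probability T R).
Implicit Types (G : set (set T)) (f xi X Z W : T -> R).
Import HBNNSimple.

(* Measurability of a real function for a sub-sigma-field is measurability on
   [T] equipped with the generated sigma-algebra: the closure properties of
   measurable functions are then available. *)
Definition adapted G f : Prop :=
  measurable_fun [set: g_sigma_algebraType G] (f : g_sigma_algebraType G -> R).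

Lemma adaptedE G f : sub_sigma_field G ->
  adapted G f <-> (forall B, measurable B -> G (f @^-1` B)).
Proof.
move=> [sG _]; split=> [mf B mB|mf _ B mB].
  have := mf measurableT B mB; rewrite setTI.
  by rewrite -[X in X _ -> _]/(G.-sigma.-measurable) (measurable_g_measurableTypeE sG).
rewrite setTI -[X in X _]/(G.-sigma.-measurable) (measurable_g_measurableTypeE sG).
exact: mf.
Qed.

Lemma adapted_preimage G f : sub_sigma_field G ->
  g_sigma_algebra_preimage f `<=` G -> adapted G f.
Proof.
move=> sG fG; apply/(adaptedE _ sG) => B mB; apply: fG.
by exists B => //; rewrite setTI.
Qed.

Lemma adapted_sub G G' f : sub_sigma_field G -> sub_sigma_field G' ->
  G `<=` G' -> adapted G f -> adapted G' f.
Proof.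
move=> sG sG' GG' /(adaptedE _ sG) mf; apply/(adaptedE _ sG') => B mB.
exact/GG'/mf.
Qed.

Lemma adapted_measurable G f : sub_sigma_field G -> adapted G f ->
  measurable_fun setT f.
Proof.
move=> sG /(adaptedE _ sG) mf _ B mB; rewrite setTI.
by have [_] := sG; apply; exact: mf.
Qed.

Lemma Rintegral_real_sum (I : Type) (s : seq I) (h : I -> T -> R) :
  (forall i, P.-integrable setT (EFin \o h i)) ->
  \int[P]_x (\sum_(i <- s) h i x) = \sum_(i <- s) \int[P]_x h i x.
Proof.
move=> hi; elim: s => [|i s IH].
  rewrite big_nil; under eq_Rintegral do rewrite big_nil.
  by rewrite Rintegral_cst// mul0r.
rewrite big_cons -IH -RintegralD//.
  by apply: eq_Rintegral => x _; rewrite big_cons.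
exact: integrable_real_sum.
Qed.

Lemma orthogonal_simple G W (h : {nnsfun (g_sigma_algebraType G) >-> R}) :
  sub_sigma_field G -> P.-integrable setT (EFin \o W) ->
  (forall A, G A -> (\int[P]_(w in A) (W w)%:E = 0)%E) ->
  \int[P]_w (h w * W w) = 0.
Proof.
move=> sG iW W0; have [_ GM] := sG.
pose A i := (h : T -> R) @^-1` [set i].
have GA i : G (A i).
  have ah : adapted G h by rewrite /adapted; exact: measurable_funPT.
  exact: (adaptedE _ sG).1 ah _ (measurable_set1 _).
have mA i : measurable (A i) by exact/GM/GA.
have iB i : P.-integrable setT (EFin \o (fun w => \1_(A i) w * W w)).
  apply: (@integrable_real_le _ _ _ _ _ (fun w => `|W w|)).
  - apply: measurable_funM; last exact: integrable_real_measurable iW.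
    exact: measurable_indic.
  - exact: integrable_norm iW.
  - by move=> w; rewrite normrM ler_piMl// indicE; case: (_ \in _); rewrite ?normr0 ?normr1.
have iA i : P.-integrable setT (EFin \o (fun w => i * (\1_(A i) w * W w))).
  exact: integrable_realZ (iB i).
transitivity (\int[P]_w (\sum_(i <- finmap.enum_fset (fset_set (range h)))
    i * (\1_(A i) w * W w))).
  apply: eq_Rintegral => w _; rewrite fimfunE fsbig_finite//= mulr_suml.
  by apply: eq_bigr => i _; rewrite mulrA.
rewrite Rintegral_real_sum; last by move=> i; exact: iA.
rewrite big1// => i _.
rewrite RintegralZl//.
rewrite (_ : \int[P]_w _ = 0) ?mulr0// /Rintegral.
rewrite -[RHS]/(fine 0%E) -(W0 _ (GA i)) [in RHS]integral_mkcond.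
congr fine; apply: eq_integral => w _; rewrite patchE indicE.
by case: ifPn => _; rewrite ?mul1r ?mul0r.
Qed.

(** The simple approximations satisfy [|h n * W| <= |xi * W|], so integrability of the product alone
    justifies dominated convergence. The multiplier may be unbounded, as it is in
    [potential_step]. *)
Lemma orthogonal_nonneg G W xi : sub_sigma_field G ->
  P.-integrable setT (EFin \o W) ->
  (forall A, G A -> (\int[P]_(w in A) (W w)%:E = 0)%E) ->
  adapted G xi -> (forall w, 0 <= xi w) ->
  P.-integrable setT (EFin \o (fun w => xi w * W w)) ->
  \int[P]_w (xi w * W w) = 0.
Proof.
move=> sG iW W0 mxi xi0 ixiW.
have mexi : measurable_fun [set: g_sigma_algebraType G]
    (EFin \o (xi : g_sigma_algebraType G -> R)) by exact/measurable_EFinP.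
pose h := nnsfun_approx measurableT mexi.
have hcvg w : (h n w)%:E @[n --> \oo] --> (xi w)%:E.
  by apply: (cvg_nnsfun_approx measurableT mexi) => // x _; rewrite lee_fin.
have hle n w : h n w <= xi w.
  rewrite -lee_fin -(cvg_lim _ (hcvg w))//; apply: lime_ge.
    by apply/cvg_ex; eexists; exact: hcvg.
  near=> m; rewrite lee_fin.
  have /(nd_nnsfun_approx measurableT mexi)/lefP : (n <= m)%N by near: m; exact: nbhs_infty_ge.
  exact.
have mW := integrable_real_measurable iW.
have mh n : measurable_fun setT (h n : T -> R).
  by apply: (adapted_measurable sG); rewrite /adapted; exact: measurable_funPT.
have hn0 n : (\int[P]_w (h n w * W w)%:E = 0)%E.
  rewrite -EFin_Rintegral; first by rewrite orthogonal_simple.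
  apply: (@integrable_real_le _ _ _ _ _ (fun w => `|xi w * W w|)).
  - exact: measurable_funM.
  - exact: integrable_norm ixiW.
  - by move=> w; rewrite !normrM ler_wpM2r// !ger0_norm.
have := @dominated_cvg _ _ _ P setT measurableT (fun n w => (h n w * W w)%:E)
  (fun w => (xi w * W w)%:E) (fun w => `|xi w * W w|%:E).
move=> /(_ _ _ _ _ _)/wrap[].
- by move=> n; apply/measurable_EFinP; exact: measurable_funM.
- by move=> w _; under eq_fun do rewrite EFinM; rewrite EFinM; apply: cvgeZr.
- by [].
- exact: integrable_norm ixiW.
- by move=> n w _ /=; rewrite lee_fin !normrM ler_wpM2r// !ger0_norm.
under eq_cvg do rewrite hn0.
move=> cv; rewrite /Rintegral.
by rewrite (_ : \int[P]_x (xi x * W x)%:E = 0)%E//; apply: cvg_unique cv (cvg_cst _).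
Unshelve. all: by end_near. Qed.

Lemma orthogonal_adapted G W xi : sub_sigma_field G ->
  P.-integrable setT (EFin \o W) ->
  (forall A, G A -> (\int[P]_(w in A) (W w)%:E = 0)%E) ->
  adapted G xi ->
  P.-integrable setT (EFin \o (fun w => xi w * W w)) ->
  \int[P]_w (xi w * W w) = 0.
Proof.
move=> sG iW W0 mxi ixiW.
have mW := integrable_real_measurable iW.
pose xp w := Num.max (xi w) 0; pose xn w := Num.max (- xi w) 0.
have mxp : adapted G xp by apply: measurable_maxr.
have mxn : adapted G xn by apply: measurable_maxr => //; exact: measurable_funN.
have xp0 w : 0 <= xp w by rewrite le_max lexx orbT.
have xn0 w : 0 <= xn w by rewrite le_max lexx orbT.
have xE w : xi w = xp w - xn w.
  rewrite /xp /xn; have [h|h] := lerP (xi w) 0.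
    by rewrite (@max_l _ _ (- xi w)); lra.
  by rewrite (@max_r _ _ (- xi w)); lra.
have xpn w : `|xi w| = xp w + xn w.
  rewrite /xp /xn; have [h|h] := lerP (xi w) 0.
    by rewrite (@max_l _ _ (- xi w)) ?ler0_norm; lra.
  by rewrite (@max_r _ _ (- xi w)) ?gtr0_norm; lra.
have ip : P.-integrable setT (EFin \o (fun w => xp w * W w)).
  apply: (@integrable_real_le _ _ _ _ _ (fun w => `|xi w * W w|)).
  - by apply: measurable_funM => //; exact: adapted_measurable mxp.
  - exact: integrable_norm ixiW.
  - by move=> w; rewrite !normrM ler_wpM2r// xpn ger0_norm// lerDl.
have i_n : P.-integrable setT (EFin \o (fun w => xn w * W w)).
  apply: (@integrable_real_le _ _ _ _ _ (fun w => `|xi w * W w|)).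
  - by apply: measurable_funM => //; exact: adapted_measurable mxn.
  - exact: integrable_norm ixiW.
  - by move=> w; rewrite !normrM ler_wpM2r// xpn ger0_norm// lerDr.
transitivity (\int[P]_w (xp w * W w - xn w * W w)).
  by apply: eq_Rintegral => w _; rewrite xE mulrBl.
by rewrite RintegralB// !(@orthogonal_nonneg G)// subrr.
Qed.

Lemma cond_exp_orthogonal G X Z xi : sub_sigma_field G ->
  P.-integrable setT (EFin \o X) -> is_cond_exp P G X Z -> adapted G xi ->
  P.-integrable setT (EFin \o (fun w => xi w * (X w - Z w))) ->
  \int[P]_w (xi w * (X w - Z w)) = 0.
Proof.
move=> sG iX [mZ LZ XZ] mxi ixi.
have iZ : P.-integrable setT (EFin \o Z) by exact/Lfun1_integrable.
apply: (orthogonal_adapted sG (integrable_realB iX iZ)) => // A GA.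
have mA : measurable A by have [_] := sG; exact.
rewrite integralB_EFin//; last 2 first.
- exact: integrableS iX.
- exact: integrableS iZ.
rewrite XZ// subee// integrable_fin_num//.
exact: integrableS iX.
Qed.

(** The set where [Z < 0] belongs to [G], and on it the integral of [|Z|] is minus that of [X],
    hence 0. *)
Lemma cond_exp_ae_ge0 G X Z : sub_sigma_field G ->
  is_cond_exp P G X Z -> (forall w, 0 <= X w) ->
  {ae P, forall w, Z w = Num.max (Z w) 0}.
Proof.
move=> sG [mZ LZ XZ] X0.
have iZ : P.-integrable setT (EFin \o Z) by exact/Lfun1_integrable.
have aZ : adapted G Z by exact: adapted_preimage.
pose A := Z @^-1` `]-oo, 0[%classic.
have GA : G A by exact: (adaptedE _ sG).1 aZ _ (measurable_itv _).
have mA : measurable A by have [_] := sG; exact.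
have mZA : measurable_fun A (EFin \o Z).
  by apply: measurable_funTS; exact/measurable_EFinP/(integrable_real_measurable iZ).
have : (\int[P]_(w in A) `|(EFin \o Z) w| = 0)%E.
  apply/eqP; rewrite eq_le integral_ge0 ?andbT; last by move=> w _; exact: abse_ge0.
  rewrite (eq_integral (fun w => - (Z w)%:E)%E); last first.
    by move=> w; rewrite inE /A /= in_itv /= => w0; rewrite ltr0_norm.
  rewrite integralN; last exact: integrable_add_def (integrableS measurableT mA (@subsetT _ _) iZ).
  by rewrite XZ// oppe_le0 integral_ge0// => w _; rewrite lee_fin.
move=> /(ae_eq_integral_abs P mA mZA) [N [mN N0 NA]].
exists N; split => // w /= ZN; apply: NA => /= H; apply: ZN.
have [h|h] := leP (Z w) 0 => //.
have [h0|h0] := eqVneq (Z w) 0 => //.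
have Zn : Z w < 0 by rewrite lt_neqAle h0.
by have := H; rewrite /A /= in_itv /= => /(_ Zn) [].
Qed.

(** A version of a conditional variance can be negative on a null set, whereas stopping is analysed
    along every trajectory, with nonnegative variances. *)
Lemma cond_exp_max G X Z : sub_sigma_field G ->
  is_cond_exp P G X Z -> (forall w, 0 <= X w) ->
  is_cond_exp P G X (fun w => Num.max (Z w) 0).
Proof.
move=> sG cXZ X0; have ae := cond_exp_ae_ge0 sG cXZ X0.
have [mZ LZ XZ] := cXZ.
have iZ : P.-integrable setT (EFin \o Z) by exact/Lfun1_integrable.
have aZ : adapted G Z by exact: adapted_preimage.
have mm : adapted G (fun w => Num.max (Z w) 0) by apply: measurable_maxr.
have iM : P.-integrable setT (EFin \o (fun w => Num.max (Z w) 0)).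
  apply: (@integrable_real_le _ _ _ _ _ (fun w => `|Z w|)).
  - exact: adapted_measurable mm.
  - exact: integrable_norm iZ.
  - move=> w; rewrite ger0_norm ?le_max ?lexx ?orbT// ge_max normr_ge0 andbT.
    exact: ler_norm.
split.
- move=> _ [B mB <-]; rewrite setTI; exact: (adaptedE _ sG).1 mm _ mB.
- exact/Lfun1_integrable.
- move=> A GA; rewrite -XZ//.
  have mA : measurable A by have [_] := sG; exact.
  apply: ae_eq_integral => //.
  + exact/measurable_funTS/measurable_EFinP/(integrable_real_measurable iM).
  + exact/measurable_funTS/measurable_EFinP/(integrable_real_measurable iZ).
  + by apply: filterS ae => w <-.
Qed.

(* Conditional Jensen for [x |-> x ^ (3/2)], obtained by integrating the tangent
   inequality [|y|^3 >= s^3 + 3/2 s (y^2 - s^2)] at [s^2 = q], truncated so that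
   everything is integrable. *)
Lemma cond_jensen_three_halves G (y q : T -> R) : sub_sigma_field G ->
  measurable_fun setT y -> P.-integrable setT (EFin \o (fun w => `|y w| ^+ 3)) ->
  P.-integrable setT (EFin \o (fun w => y w ^+ 2)) ->
  is_cond_exp P G (fun w => y w ^+ 2) q -> (forall w, 0 <= q w) ->
  P.-integrable setT (EFin \o (fun w => q w * Num.sqrt (q w))) /\
  \int[P]_w (q w * Num.sqrt (q w)) <= \int[P]_w (`|y w| ^+ 3).
Proof.
move=> sG my iy3 iy2 cq q0.
have [mq Lq _] := cq.
have aq : adapted G q by exact: adapted_preimage.
have iq : P.-integrable setT (EFin \o q) by exact/Lfun1_integrable.
(* Cutting to 0, not to a constant, keeps [s ^ 3 = s * q] exact, so that the linear term of the
   tangent inequality is the centred [s * (y ^ 2 - q)]. *)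
pose s n w : R := if q w <= n%:R then Num.sqrt (q w) else 0.
have asq : adapted G (fun w => Num.sqrt (q w)).
  apply: measurableT_comp aq => //; apply: continuous_measurable_fun.
  exact: sqrt_continuous.
have as_ n : adapted G (s n).
  by apply: measurable_fun_ifT => //; exact: measurable_fun_ler.
have s0 n w : 0 <= s n w by rewrite /s; case: ifP => // _; exact: sqrtr_ge0.
have sb n w : s n w <= Num.sqrt n%:R.
  by rewrite /s; case: ifP => [h|_]; rewrite ?sqrtr_ge0// ler_sqrt.
have sq n w : s n w * s n w ^+ 2 = s n w * q w.
  by rewrite /s; case: ifP => _; rewrite ?mul0r// sqr_sqrtr.
have ms n : measurable_fun setT (s n) by exact: adapted_measurable (as_ n).
have is3 n : P.-integrable setT (EFin \o (fun w => s n w ^+ 3)).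
  apply: (@integrable_real_le _ _ _ _ _ (cst (Num.sqrt n%:R ^+ 3))).
  - exact: measurable_funX.
  - exact: finite_measure_integrable_cst.
  - by move=> w; rewrite ger0_norm ?exprn_ge0// lerXn2r ?nnegrE ?sqrtr_ge0.
have isy n : P.-integrable setT (EFin \o (fun w => s n w * (y w ^+ 2 - q w))).
  apply: (@integrable_real_le _ _ _ _ _ (fun w => Num.sqrt n%:R * `|y w ^+ 2 - q w|)).
  - apply: measurable_funM => //; apply: measurable_funB.
      exact: measurable_funX.
    exact: integrable_real_measurable iq.
  - by apply: integrable_realZ; apply: integrable_norm; exact: integrable_realB.
  - by move=> w; rewrite normrM ler_wpM2r// ger0_norm.
have orth n : \int[P]_w (s n w * (y w ^+ 2 - q w)) = 0.
  exact: (cond_exp_orthogonal sG iy2 cq (as_ n) (isy n)).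
have le n : (\int[P]_w (s n w ^+ 3)%:E <= (\int[P]_w (`|y w| ^+ 3))%:E)%E.
  rewrite -EFin_Rintegral// lee_fin.
  have -> : \int[P]_w (s n w ^+ 3) =
      \int[P]_w (s n w ^+ 3 + 3 / 2 * (s n w * (y w ^+ 2 - q w))).
    rewrite RintegralD//; last exact: integrable_realZ.
    by rewrite RintegralZl// orth mulr0 addr0.
  apply: le_RintegralT => //.
    by apply: integrable_realD => //; exact: integrable_realZ.
  move=> w; rewrite mulrBr -sq -(real_normK (num_real (y w))).
  move: (s n w) (`|y w|) (s0 n w) (normr_ge0 (y w)) => a b a0 b0.
  rewrite -subr_ge0.
  rewrite (_ : _ - _ = (b - a) ^+ 2 * (b + a / 2)); last by field.
  by rewrite mulr_ge0 ?sqr_ge0// addr_ge0// divr_ge0.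
have cvs w : (s n w ^+ 3)%:E @[n --> \oo] --> (q w * Num.sqrt (q w))%:E.
  apply: cvg_near_cst; near=> n; rewrite /s ifT.
    by rewrite exprSr sqr_sqrtr.
  near: n; exact: nbhs_infty_ger.
have E : (\int[P]_w (q w * Num.sqrt (q w))%:E <= (\int[P]_w (`|y w| ^+ 3))%:E)%E.
  rewrite (_ : \int[P]_w _ = limn (fun n => \int[P]_w (s n w ^+ 3)%:E))%E.
    apply: lime_le; last by apply: nearW => n; exact: le.
    apply: ereal_nondecreasing_is_cvgn => n m nm; apply: ge0_le_integral => //.
    - by move=> w _; rewrite lee_fin exprn_ge0.
    - by apply/measurable_EFinP; exact: measurable_funX.
    - by apply/measurable_EFinP; exact: measurable_funX.
    - move=> w _; rewrite lee_fin lerXn2r ?nnegrE// /s.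
      case: ifP => h; last by case: ifP; rewrite ?sqrtr_ge0.
      by rewrite ifT// (le_trans h)// ler_nat.
  rewrite -monotone_convergence//.
  - by apply: eq_integral => w _; apply/esym/cvg_lim => //; exact: cvs.
  - by move=> n; apply/measurable_EFinP; exact: measurable_funX.
  - by move=> n w _; rewrite lee_fin exprn_ge0.
  - move=> w _ n m nm; rewrite lee_fin lerXn2r ?nnegrE// /s.
    case: ifP => h; last by case: ifP; rewrite ?sqrtr_ge0.
    by rewrite ifT// (le_trans h)// ler_nat.
have iqs : P.-integrable setT (EFin \o (fun w => q w * Num.sqrt (q w))).
  apply: ge0_integrable_real.
  - apply: measurable_funM; first exact: adapted_measurable aq.
    exact: adapted_measurable asq.
  - by move=> w; rewrite mulr_ge0 ?sqrtr_ge0.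
  - by apply: le_lt_trans E _; rewrite ltry.
by split => //; rewrite -lee_fin EFin_Rintegral.
Unshelve. all: by end_near. Qed.

End Adapted.

(** * Variance stopping and a Rosenthal inequality *)

Section RealInequalities.
Context {R : realType}.
Implicit Types (a b x y r s t m e : R).

Definition p32 x : R := x * Num.sqrt x.

Lemma p32_ge0 x : 0 <= x -> 0 <= p32 x.
Proof. by move=> x0; rewrite mulr_ge0 ?sqrtr_ge0. Qed.

Lemma le_p32 x y : 0 <= x -> x <= y -> p32 x <= p32 y.
Proof.
move=> x0 xy; rewrite ler_pM ?sqrtr_ge0// ler_sqrt//; exact: le_trans xy.
Qed.

Lemma p32_sqrt x : 0 <= x -> Num.sqrt x ^+ 3 = p32 x.
Proof. by move=> x0; rewrite exprSr sqr_sqrtr. Qed.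

(** The sum is at most twice the larger term, and [2 ^ (3 / 2) <= 3]. *)
Lemma p32D a b : 0 <= a -> 0 <= b -> p32 (a + b) <= 3 * (p32 a + p32 b).
Proof.
have dbl x : 0 <= x -> p32 (2 * x) <= 3 * p32 x.
  move=> x0; rewrite /p32 sqrtrM//.
  have h : Num.sqrt 2 <= 3 / 2 :> R.
    rewrite -[leRHS]ger0_norm ?divr_ge0// -sqrtr_sqr ler_sqrt ?sqr_ge0//.
    by rewrite (_ : (3 / 2) ^+ 2 = 9 / 4 :> R); [lra|field].
  have := ler_wpM2r (mulr_ge0 x0 (sqrtr_ge0 x)) h; lra.
move=> a0 b0; have [ab|ba] := lerP a b.
  have := le_p32 (addr_ge0 a0 b0) (_ : a + b <= 2 * b); have := dbl b b0.
  by have := p32_ge0 a0; move=> h1 h2 /(_ ltac:(lra)); lra.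
have := le_p32 (addr_ge0 a0 b0) (_ : a + b <= 2 * a); have := dbl a a0.
by have := p32_ge0 b0; move=> h1 h2 /(_ ltac:(lra)); lra.
Qed.

Lemma mul_le_p32 a r : 0 <= a -> 0 <= r -> a * r <= a ^+ 3 + p32 r.
Proof.
move=> a0 r0; have a3 : 0 <= a ^+ 3 by rewrite exprn_ge0.
have [h|h] := lerP r (a ^+ 2).
  rewrite (le_trans _ (_ : a ^+ 3 <= _)) ?lerDl ?p32_ge0//.
  by rewrite exprS ler_wpM2l.
have : a <= Num.sqrt r by rewrite -[a]ger0_norm// -sqrtr_sqr ler_sqrt// ltW.
by move=> /(ler_wpM2r r0); rewrite /p32 (mulrC r); lra.
Qed.

(** Either [6 * r <= a ^ 2] or [a <= 3 * sqrt r]. The weight [1 / 2] is what [skipped_sum_cube]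
    absorbs. *)
Lemma young_p32 a r : 0 <= a -> 0 <= r -> 3 * (a * r) <= a ^+ 3 / 2 + 27 * p32 r.
Proof.
move=> a0 r0; have a3 : 0 <= a ^+ 3 by rewrite exprn_ge0.
have [h|h] := lerP (6 * r) (a ^+ 2).
  have := ler_wpM2l a0 h; rewrite -exprS; have := p32_ge0 r0; lra.
have : a <= Num.sqrt (9 * r).
  by rewrite -[a]ger0_norm// -sqrtr_sqr ler_sqrt ?mulr_ge0//; lra.
rewrite sqrtrM// (_ : 9 = 3 ^+ 2) ?sqrtr_sqr ?ger0_norm//; last by ring.
by move=> /(ler_wpM2r r0); rewrite /p32 (mulrC r); have := mulr_ge0 (sqrtr_ge0 r) r0; lra.
Qed.

Lemma sqr_mul_le_cube a b : 0 <= a -> 0 <= b -> a ^+ 2 * b <= a ^+ 3 + b ^+ 3.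
Proof.
move=> a0 b0; have [h|h] := lerP b a.
  have : a ^+ 2 * b <= a ^+ 2 * a by rewrite ler_wpM2l ?sqr_ge0.
  by rewrite -exprSr; have := exprn_ge0 3 b0; lra.
have : a ^+ 2 * b <= b ^+ 2 * b by rewrite ler_wpM2r// lerXn2r ?nnegrE// ltW.
by rewrite -exprSr; have := exprn_ge0 3 a0; lra.
Qed.

Lemma cube_normD a b : `|a + b| ^+ 3 <= 4 * (`|a| ^+ 3 + `|b| ^+ 3).
Proof.
have : `|a + b| ^+ 3 <= (`|a| + `|b|) ^+ 3 by rewrite lerXn2r ?nnegrE ?addr_ge0// ler_normD.
move/le_trans; apply; move: (`|a|) (`|b|) (normr_ge0 a) (normr_ge0 b) => x y x0 y0.
rewrite -subr_ge0 (_ : _ - _ = 3 * ((x + y) * (x - y) ^+ 2)); last by ring.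
by apply: mulr_ge0 => //; apply: mulr_ge0; [exact: addr_ge0|exact: sqr_ge0].
Qed.

(** The second-order expansion of [|x| ^ 3] at [a]. Once [a >= 0], the case beyond the binomial
    formula is [a + b < 0], where the two sides differ by [2 * a] times a nonnegative quadratic
    form. *)
Lemma cube_norm_expand a b :
  `|a + b| ^+ 3 <= `|a| ^+ 3 + 3 * (a * `|a|) * b + 3 * `|a| * b ^+ 2 + `|b| ^+ 3.
Proof.
have pos x y : 0 <= x -> `|x + y| ^+ 3 <= x ^+ 3 + 3 * (x * x) * y + 3 * x * y ^+ 2 + `|y| ^+ 3.
  move=> x0; have [xy|xy] := lerP 0 (x + y).
    have : y ^+ 3 <= `|y| ^+ 3 by rewrite -normrX ler_norm.
    rewrite (ger0_norm xy).
    rewrite (_ : (x + y) ^+ 3 = x ^+ 3 + 3 * (x * x) * y + 3 * x * y ^+ 2 + y ^+ 3); last by ring.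
    by lra.
  rewrite (ltr0_norm xy) (ler0_norm (_ : y <= 0)); last by lra.
  rewrite -subr_ge0 (_ : _ - _ = 2 * x * ((x + 3 / 2 * y) ^+ 2 + 3 / 4 * y ^+ 2)); last by field.
  apply: mulr_ge0; first exact: mulr_ge0.
  by have := sqr_ge0 (x + 3 / 2 * y); have := sqr_ge0 y; lra.
have [a0|a0] := lerP 0 a; first by rewrite (ger0_norm a0); exact: pos.
rewrite (ltr0_norm a0); have := pos (- a) (- b); rewrite -opprD !normrN sqrrN.
rewrite (_ : 3 * (- a * - a) * - b = 3 * (a * - a) * b); last by ring.
by apply; lra.
Qed.

(** Either [t <= e * a] or [a < t / e]. The factor [e ^ -2] is the one for [a ^ 2 * t]; since
    [e <= 1] it also serves [a * t ^ 2]. *)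
Lemma young_sqr_mul e a t : 0 < e <= 1 -> 0 <= a -> 0 <= t ->
  a ^+ 2 * t <= e * a ^+ 3 + t ^+ 3 / e ^+ 2 /\
  a * t ^+ 2 <= e * a ^+ 3 + t ^+ 3 / e ^+ 2.
Proof.
move=> /andP[e0 e1] a0 t0.
have a3 : 0 <= a ^+ 3 by rewrite exprn_ge0.
have t3 : 0 <= t ^+ 3 / e ^+ 2 by rewrite divr_ge0 ?exprn_ge0// ltW.
have [h|h] := lerP t (e * a).
  have h1 : a ^+ 2 * t <= e * a ^+ 3.
    apply: (le_trans (ler_wpM2l (sqr_ge0 a) h)); rewrite exprSr; lra.
  have h2 : t ^+ 2 <= e * a ^+ 2.
    apply: (@le_trans _ _ ((e * a) ^+ 2)).
      by rewrite lerXn2r ?nnegrE// mulr_ge0// ltW.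
    rewrite exprMn ler_wpM2r ?sqr_ge0// expr2 ler_piMl// ltW//.
  split; first by lra.
  have := ler_wpM2l a0 h2; rewrite (_ : a * (e * a ^+ 2) = e * a ^+ 3); last by ring.
  by lra.
have ae : a <= t / e by rewrite ler_pdivlMr// mulrC ltW.
have te0 : 0 <= t / e by rewrite divr_ge0// ltW.
split.
  have : a ^+ 2 * t <= (t / e) ^+ 2 * t by rewrite ler_wpM2r// lerXn2r ?nnegrE.
  rewrite exprMn exprVn (_ : t ^+ 2 * e ^- 2 * t = t ^+ 3 / e ^+ 2); last by ring.
  by have := mulr_ge0 (ltW e0) a3; lra.
have : a * t ^+ 2 <= t / e * t ^+ 2 by rewrite ler_wpM2r ?sqr_ge0.
rewrite (_ : t / e * t ^+ 2 = t ^+ 3 / e); last by ring.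
have : t ^+ 3 / e <= t ^+ 3 / e ^+ 2.
  by rewrite ler_wpM2l ?exprn_ge0// lef_pV2 ?posrE ?exprn_gt0// expr2 ler_piMl// ltW.
by have := mulr_ge0 (ltW e0) a3; lra.
Qed.

End RealInequalities.

(* [q] are the successive conditional variances along one trajectory.  A step
   is kept as long as the accumulated variance, including it, is at most 1. *)
Section Stopping.
Context {R : realType}.
Variable q : nat -> R.
Hypothesis q0 : forall i, 0 <= q i.

Definition accum k : R := \sum_(i < k) q i.
(** Involves [q] up to index [k], all known before step [k] is taken: the rule is predictable, and
    multiplying by it preserves centring. *)
Definition keep k : bool := accum k.+1 <= 1.
Definition kept_var k : R := \sum_(i < k) (if keep i then q i else 0).
Definition skipped_var k : R := \sum_(i < k) (if keep i then 0 else q i).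

Lemma accumS k : accum k.+1 = accum k + q k.
Proof. by rewrite /accum big_ord_recr. Qed.

Lemma kept_varS k : kept_var k.+1 = kept_var k + (if keep k then q k else 0).
Proof. by rewrite /kept_var big_ord_recr. Qed.

Lemma skipped_varS k :
  skipped_var k.+1 = skipped_var k + (if keep k then 0 else q k).
Proof. by rewrite /skipped_var big_ord_recr. Qed.

Lemma kept_skipped k : accum k = kept_var k + skipped_var k.
Proof.
rewrite /accum /kept_var /skipped_var -big_split; apply: eq_bigr => i _ /=.
by case: ifP; rewrite ?addr0 ?add0r.
Qed.

Lemma kept_var_ge0 k : 0 <= kept_var k.
Proof. by apply: sumr_ge0 => i _; case: ifP. Qed.

Lemma skipped_var_ge0 k : 0 <= skipped_var k.
Proof. by apply: sumr_ge0 => i _; case: ifP. Qed.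

Lemma kept_var_le1 k : kept_var k <= 1.
Proof.
suff : kept_var k <= accum k /\ kept_var k <= 1 by case.
elim: k => [|k [IH1 IH2]]; first by rewrite /kept_var /accum !big_ord0.
rewrite kept_varS accumS; case: ifPn => [h|_].
  by move: h; rewrite /keep accumS; lra.
by have := q0 k; lra.
Qed.

(** Skipped variance is the excess over 1 plus the part of the crossing step that lies below 1, at
    most [m]. *)
Lemma skipped_var_le k m : (forall i, (i < k)%N -> q i <= m) -> 0 <= m ->
  skipped_var k <= `|accum k - 1| + m.
Proof.
move=> qm m0.
suff : (accum k <= 1 -> skipped_var k = 0) /\
    (1 < accum k -> skipped_var k <= accum k - 1 + m).
  move=> [h1 h2]; have [h|h] := leP (accum k) 1.
    by rewrite h1// addr_ge0.
  by apply: (le_trans (h2 h)); rewrite lerD2r ler_norm.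
elim: k qm => [|k IH] qm.
  by rewrite /skipped_var /accum !big_ord0; split => //; lra.
have [|h1 h2] := IH; first by move=> i ik; apply: qm; exact: ltnW.
have qk := qm k (ltnSn k); have qk0 := q0 k.
rewrite skipped_varS; split => h.
  rewrite /keep h addr0 h1//; move: h; rewrite accumS; lra.
have kf : (accum k.+1 <= 1) = false by rewrite leNgt h.
rewrite /keep kf; move: h; rewrite accumS => h.
have [h3|h3] := lerP (accum k) 1; first by rewrite h1//; lra.
by have := h2 h3; lra.
Qed.

(** [m] is the largest [q i], and its power is one of the summands. *)
Lemma exists_max_p32 k : exists m, [/\ forall i, (i < k)%N -> q i <= m, 0 <= m &
  p32 m <= \sum_(i < k) p32 (q i)].
Proof.
elim: k => [|k [m [h1 h2 h3]]].
  by exists 0; split => //; rewrite big_ord0 /p32 mul0r.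
exists (Num.max m (q k)); split.
- move=> i; rewrite ltnS leq_eqVlt => /predU1P[->|ik].
    by rewrite le_max lexx orbT.
  by rewrite le_max h1.
- by rewrite le_max h2.
- rewrite big_ord_recr /=; have [h|h] := leP m (q k).
    by rewrite lerDr sumr_ge0// => i _; exact: p32_ge0.
  by rewrite (le_trans h3)// lerDl p32_ge0.
Qed.

Lemma p32_skipped_var_le k :
  p32 (skipped_var k) <= 3 * (p32 `|accum k - 1| + \sum_(i < k) p32 (q i)).
Proof.
have [m [h1 h2 h3]] := exists_max_p32 k.
have h := skipped_var_le h1 h2.
have := le_p32 (skipped_var_ge0 k) h; have := p32D (normr_ge0 (accum k - 1)) h2.
by lra.
Qed.

Lemma p32_remaining_var_le k :
  p32 (1 - kept_var k) <= 12 * (p32 `|accum k - 1| + \sum_(i < k) p32 (q i)).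
Proof.
have [m [h1 h2 h3]] := exists_max_p32 k.
have h := skipped_var_le h1 h2.
(* The missing variance is [1 - accum k] plus the skipped variance. Two uses of [p32D] on
   [b + (b + m)] give [3 + 3 * 3 = 12]. *)
have h4 : 1 - kept_var k <= `|accum k - 1| + (`|accum k - 1| + m).
  by have := kept_skipped k; have := ler_norm (- (accum k - 1)); rewrite normrN; lra.
have h5 : 0 <= 1 - kept_var k by have := kept_var_le1 k; lra.
have n0 := normr_ge0 (accum k - 1).
have := le_p32 h5 h4; have := p32D n0 (addr_ge0 n0 h2); have := p32D n0 h2.
have := p32_ge0 n0; have := p32_ge0 h2.
by lra.
Qed.

End Stopping.

(** * Functions in L^3 and L^(3/2) *)

Section CubeIntegrable.
Context {R : realType} d (T : measurableType d) (P : probability T R).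
Implicit Types (f g r : T -> R).

Definition cube_integrable f : Prop :=
  measurable_fun setT f /\ P.-integrable setT (EFin \o (fun w => `|f w| ^+ 3)).

Lemma measurable_norm_cube f : measurable_fun setT f ->
  measurable_fun setT (fun w => `|f w| ^+ 3).
Proof. by move=> mf; apply: measurable_funX; exact: measurableT_comp. Qed.

Lemma cube_integrableD f g : cube_integrable f -> cube_integrable g ->
  cube_integrable (fun w => f w + g w).
Proof.
move=> [mf hf] [mg hg]; have mfg := measurable_funD mf mg; split => //.
apply: (@integrable_real_le _ _ _ _ _ (fun w => 4 * (`|f w| ^+ 3 + `|g w| ^+ 3))).
- exact: measurable_norm_cube.
- by apply: integrable_realZ; exact: integrable_realD.
- by move=> w; rewrite ger0_norm ?exprn_ge0// cube_normD.
Qed.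

Lemma cube_integrable0 : cube_integrable (cst 0).
Proof.
split => //; rewrite (_ : EFin \o _ = cst 0%E); first exact: integrable0.
by apply/funext => w /=; rewrite normr0 expr0n.
Qed.

Lemma cube_integrable_le f g : measurable_fun setT f -> cube_integrable g ->
  (forall w, `|f w| <= `|g w|) -> cube_integrable f.
Proof.
move=> mf [mg ig] fg; split => //; apply: integrable_real_le ig _.
  exact: measurable_norm_cube.
by move=> w; rewrite ger0_norm ?exprn_ge0// lerXn2r ?nnegrE.
Qed.

Lemma cube_integrable_sum (h : nat -> T -> R) n : (forall i, cube_integrable (h i)) ->
  cube_integrable (fun w => \sum_(i < n) h i w).
Proof.
move=> hh; elim: n => [|n IH].
  rewrite (_ : (fun _ => _) = cst 0); first exact: cube_integrable0.
  by apply/funext => w; rewrite big_ord0.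
rewrite (_ : (fun _ => _) = (fun w => \sum_(i < n) h i w + h n w)).
  exact: cube_integrableD.
by apply/funext => w; rewrite big_ord_recr.
Qed.

Lemma measurable_p32 r : measurable_fun setT r -> measurable_fun setT (fun w => p32 (r w)).
Proof.
move=> mr; apply: measurable_funM => //; apply: measurableT_comp mr.
by apply: continuous_measurable_fun; exact: sqrt_continuous.
Qed.

(** The nonnegative part of [L^(3/2)], the space conjugate to [L^3]: steps belong to the latter,
    their variances to the former, and products of the two are integrable. *)
Definition p32_integrable r : Prop := [/\ measurable_fun setT r, forall w, 0 <= r w &
  P.-integrable setT (EFin \o (fun w => p32 (r w)))].

Lemma p32_integrableD r1 r2 : p32_integrable r1 -> p32_integrable r2 ->
  p32_integrable (fun w => r1 w + r2 w).
Proof.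
move=> [mf f0 hf] [mg g0 hg]; have mfg := measurable_funD mf mg.
split => //; first by move=> w; rewrite addr_ge0.
apply: (@integrable_real_le _ _ _ _ _ (fun w => 3 * (p32 (r1 w) + p32 (r2 w)))).
- exact: measurable_p32.
- by apply: integrable_realZ; exact: integrable_realD.
- by move=> w; rewrite ger0_norm ?p32_ge0 ?addr_ge0// p32D.
Qed.

Lemma p32_integrable_le r1 r2 : measurable_fun setT r1 -> p32_integrable r2 ->
  (forall w, 0 <= r1 w <= r2 w) -> p32_integrable r1.
Proof.
move=> mf [mg g0 ig] fg; split => //; first by move=> w; have /andP[] := fg w.
apply: integrable_real_le ig _; first exact: measurable_p32.
by move=> w; have /andP[h1 h2] := fg w; rewrite ger0_norm ?p32_ge0// le_p32.
Qed.

Lemma p32_integrable_sum (h : nat -> T -> R) n : (forall i, p32_integrable (h i)) ->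
  p32_integrable (fun w => \sum_(i < n) h i w).
Proof.
move=> hh; elim: n => [|n IH].
  rewrite (_ : (fun _ => _) = cst 0).
    split => //; rewrite (_ : EFin \o _ = cst 0%E); first exact: integrable0.
    by apply/funext => w /=; rewrite /p32 mul0r.
  by apply/funext => w; rewrite big_ord0.
rewrite (_ : (fun _ => _) = (fun w => \sum_(i < n) h i w + h n w)).
  exact: p32_integrableD.
by apply/funext => w; rewrite big_ord_recr.
Qed.

Lemma p32_integrable_norm_sub1 f : p32_integrable f -> p32_integrable (fun w => `|f w - 1|).
Proof.
move=> Lf; have [mf f0 _] := Lf.
apply: (p32_integrable_le _ (r2 := fun w => f w + 1)).
- by apply: measurableT_comp => //; exact: measurable_funB.
- by apply: p32_integrableD => //; split => //; exact: finite_measure_integrable_cst.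
- by move=> w; rewrite normr_ge0 (le_trans (ler_normB _ _))// normr1 lerD2r ger0_norm.
Qed.

Lemma integrable_sqr_mul f g : cube_integrable f -> cube_integrable g ->
  P.-integrable setT (EFin \o (fun w => f w ^+ 2 * g w)).
Proof.
move=> [mf hf] [mg hg].
apply: (@integrable_real_le _ _ _ _ _ (fun w => `|f w| ^+ 3 + `|g w| ^+ 3)).
- by apply: measurable_funM => //; exact: measurable_funX.
- exact: integrable_realD.
- by move=> w; rewrite normrM normrX sqr_mul_le_cube.
Qed.

Lemma integrable_mul_p32 f r : cube_integrable f -> p32_integrable r ->
  P.-integrable setT (EFin \o (fun w => f w * r w)).
Proof.
move=> [mf hf] [mr r0 hr].
apply: (@integrable_real_le _ _ _ _ _ (fun w => `|f w| ^+ 3 + p32 (r w))).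
- exact: measurable_funM.
- exact: integrable_realD.
- by move=> w; rewrite normrM (ger0_norm (r0 w)) mul_le_p32.
Qed.

Lemma cube_integrable_L1 f : cube_integrable f -> P.-integrable setT (EFin \o f).
Proof.
move=> [mf hf].
apply: (@integrable_real_le _ _ _ _ _ (fun w => 1 + `|f w| ^+ 3)) => //.
- apply: integrable_realD => //; exact: finite_measure_integrable_cst.
- by move=> w; have [_ h _ _] := pow_le_cube (f w).
Qed.

Lemma cube_integrable_norm f : cube_integrable f -> cube_integrable (fun w => `|f w|).
Proof.
move=> hf; apply: (cube_integrable_le _ hf); first by case: hf => mf _; exact: measurableT_comp.
by move=> w; rewrite normr_id.
Qed.

End CubeIntegrable.

Section MartingaleSteps.
Context {R : realType} d (T : measurableType d) (P : probability T R).

(* [y k] is the increment from time [k] to time [k + 1], and [q k] a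
   nonnegative version of its conditional variance. *)
Record martingale_steps (F : nat -> set (set T)) (y q : nat -> T -> R) : Prop := {
  ms_sub : forall k, sub_sigma_field (F k);
  ms_incr : forall k, F k `<=` F k.+1;
  ms_y : forall k, adapted (F k.+1) (y k);
  ms_q : forall k, adapted (F k) (q k);
  ms_q0 : forall k w, 0 <= q k w;
  ms_iy : forall k, P.-integrable setT (EFin \o (fun w => `|y k w| ^+ 3));
  ms_iq : forall k, P.-integrable setT (EFin \o (fun w => p32 (q k w)));
  ms_le : forall k, \int[P]_w p32 (q k w) <= \int[P]_w (`|y k w| ^+ 3);
  ms_mean : forall k xi, adapted (F k) xi ->
    P.-integrable setT (EFin \o (fun w => xi w * y k w)) ->
    \int[P]_w (xi w * y k w) = 0;
  ms_var : forall k xi, adapted (F k) xi ->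
    P.-integrable setT (EFin \o (fun w => xi w * (y k w ^+ 2 - q k w))) ->
    \int[P]_w (xi w * (y k w ^+ 2 - q k w)) = 0 }.

Arguments ms_y [F y q] _ k.
Arguments ms_q [F y q] _ k.

Variables (F : nat -> set (set T)) (y q : nat -> T -> R).
Hypothesis ms : martingale_steps F y q.
Implicit Types (f g : T -> R) (G : set (set T)).

Let sF := ms_sub ms.
Let q0 w i : 0 <= q i w := ms_q0 ms i w.

Definition kept_sum k w : R := \sum_(i < k) (if keep (q^~ w) i then y i w else 0).
Definition skipped_sum k w : R := \sum_(i < k) (if keep (q^~ w) i then 0 else y i w).
Definition remaining_sd k w : R := Num.sqrt (1 - kept_var (q^~ w) k).

Lemma filtration_le i k : (i <= k)%N -> F i `<=` F k.
Proof.
elim: k => [|k IH]; first by rewrite leqn0 => /eqP ->.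
by rewrite leq_eqVlt => /predU1P[->//|/IH ik] A /ik; exact: (ms_incr ms).
Qed.

Lemma adapted_ge i k f : (i <= k)%N -> adapted (F i) f -> adapted (F k) f.
Proof. by move=> ik; apply: adapted_sub => //; exact: filtration_le. Qed.

Lemma adapted_q i k : (i <= k)%N -> adapted (F k) (q i).
Proof. by move=> ik; exact: (adapted_ge ik (ms_q ms i)). Qed.

Lemma adapted_y i k : (i < k)%N -> adapted (F k) (y i).
Proof. by move=> ik; exact: (adapted_ge ik (ms_y ms i)). Qed.

Lemma adapted_sum G (h : nat -> T -> R) k : (forall i, (i < k)%N -> adapted G (h i)) ->
  adapted G (fun w => \sum_(i < k) h i w).
Proof.
elim: k => [|k IH] hh.
  rewrite (_ : (fun _ => _) = cst 0); first exact: measurable_cst.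
  by apply/funext => w; rewrite big_ord0.
rewrite (_ : (fun _ => _) = (fun w => \sum_(i < k) h i w + h k w)).
  apply: measurable_funD; last exact: hh.
  by apply: IH => i ik; apply: hh; exact: ltnW.
by apply/funext => w; rewrite big_ord_recr.
Qed.

Lemma adapted_if_keep k j f g : (k <= j)%N -> adapted (F j) f -> adapted (F j) g ->
  adapted (F j) (fun w => if keep (q^~ w) k then f w else g w).
Proof.
move=> kj mf mg; apply: measurable_fun_ifT => //.
apply: measurable_fun_ler => //.
apply: (@adapted_sum (F j) q) => i ik.
by apply: adapted_q; rewrite (leq_trans _ kj).
Qed.

Lemma adapted_cst G (c : R) : adapted G (cst c).
Proof. exact: measurable_cst. Qed.

Lemma adapted_kept_sum k : adapted (F k) (kept_sum k).
Proof.
apply: (@adapted_sum (F k) (fun i w => if keep (q^~ w) i then y i w else 0)) => i ik;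
  apply: adapted_if_keep; first exact: ltnW.
  exact: adapted_y.
exact: adapted_cst.
Qed.

Lemma adapted_skipped_sum k : adapted (F k) (skipped_sum k).
Proof.
apply: (@adapted_sum (F k) (fun i w => if keep (q^~ w) i then 0 else y i w)) => i ik;
  apply: adapted_if_keep; first exact: ltnW.
  exact: adapted_cst.
exact: adapted_y.
Qed.

(** The shifted index expresses predictability: the normal variance still to be filled after step
    [k] is known before that step. *)
Lemma adapted_kept_var k : adapted (F k) (fun w => kept_var (q^~ w) k.+1).
Proof.
apply: (@adapted_sum (F k) (fun i w => if keep (q^~ w) i then q i w else 0)) => i ik;
  apply: adapted_if_keep => //.
  exact: adapted_q.
exact: adapted_cst.
Qed.

Lemma adapted_skipped_var k : adapted (F k) (fun w => skipped_var (q^~ w) k.+1).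
Proof.
apply: (@adapted_sum (F k) (fun i w => if keep (q^~ w) i then 0 else q i w)) => i ik;
  apply: adapted_if_keep => //.
  exact: adapted_cst.
exact: adapted_q.
Qed.

Lemma adapted_remaining_sd k : adapted (F k) (remaining_sd k.+1).
Proof.
apply: (measurableT_comp (_ : measurable_fun setT (@Num.sqrt R))).
  by apply: continuous_measurable_fun; exact: sqrt_continuous.
by apply: measurable_funB; [exact: adapted_cst|exact: adapted_kept_var].
Qed.

Lemma cube_integrable_y k : cube_integrable P (y k).
Proof. by split; [exact: (adapted_measurable (sF k.+1) (ms_y ms k))|exact: (ms_iy ms)]. Qed.

Lemma p32_integrable_q k : p32_integrable P (q k).
Proof.
split; first exact: (adapted_measurable (sF k) (ms_q ms k)).
  by move=> w; exact: q0.
exact: (ms_iq ms).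
Qed.

Lemma cube_integrable_kept_sum k : cube_integrable P (kept_sum k).
Proof.
apply: (cube_integrable_sum _ (h := fun i w => if keep (q^~ w) i then y i w else 0)) => i;
  apply: (cube_integrable_le _ (cube_integrable_y i)) => [|w].
  apply: (adapted_measurable (sF i.+1)); apply: adapted_if_keep => //.
    exact: (ms_y ms).
  exact: adapted_cst.
by case: ifP => // _; rewrite normr0.
Qed.

Lemma cube_integrable_skipped_sum k : cube_integrable P (skipped_sum k).
Proof.
apply: (cube_integrable_sum _ (h := fun i w => if keep (q^~ w) i then 0 else y i w)) => i;
  apply: (cube_integrable_le _ (cube_integrable_y i)) => [|w].
  apply: (adapted_measurable (sF i.+1)); apply: adapted_if_keep => //.
    exact: adapted_cst.
  exact: (ms_y ms).
by case: ifP => // _; rewrite normr0.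
Qed.

Lemma p32_integrable_skipped_var k : p32_integrable P (fun w => skipped_var (q^~ w) k).
Proof.
apply: (p32_integrable_sum _ (h := fun i w => if keep (q^~ w) i then 0 else q i w)) => i.
apply: (p32_integrable_le _ (p32_integrable_q i)) => [|w].
  apply: (adapted_measurable (sF i)); apply: adapted_if_keep => //.
    exact: adapted_cst.
  exact: (ms_q ms).
by case: ifP => _; rewrite ?lexx ?q0.
Qed.

(* Up to [|y k| ^ 3] per step a supermartingale: in the expansion of [|M + y| ^ 3] the
   term linear in [y] is centred and [3 |M| y ^ 2] is compensated by the second term. *)
Definition potential k w : R :=
  `|skipped_sum k w| ^+ 3 - 3 * (`|skipped_sum k w| * skipped_var (q^~ w) k).

Lemma integrable_potential k : P.-integrable setT (EFin \o potential k).
Proof.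
apply: integrable_realB; first by case: (cube_integrable_skipped_sum k).
apply: integrable_realZ; apply: integrable_mul_p32 (p32_integrable_skipped_var k).
exact: cube_integrable_norm (cube_integrable_skipped_sum k).
Qed.

Lemma potential_step k :
  \int[P]_w potential k.+1 w <= \int[P]_w potential k w + \int[P]_w (`|y k w| ^+ 3).
Proof.
pose M := skipped_sum k; pose V w := skipped_var (q^~ w) k.+1.
(* [|M + y| >= |M| + sg * y] bounds the compensating term of the potential linearly in [y]. Together
   with [cube_norm_expand], [xi1] collects the coefficients of [y] and [xi2] those of
   [y ^ 2 - q]. *)
pose sg w : R := if 0 <= M w then 1 else -1.
pose xi1 w : R := if keep (q^~ w) k then 0
  else 3 * (M w * `|M w|) - 3 * (V w * sg w).
pose xi2 w : R := if keep (q^~ w) k then 0 else 3 * `|M w|.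
have aM : adapted (F k) M by exact: adapted_skipped_sum.
have aV : adapted (F k) V by exact: adapted_skipped_var.
have asg : adapted (F k) sg.
  by apply: measurable_fun_ifT => //; apply: measurable_fun_ler.
have anM : adapted (F k) (fun w => `|M w|) by apply: measurableT_comp aM.
have a1 : adapted (F k) xi1.
  apply: adapted_if_keep => //; first exact: adapted_cst.
  apply: measurable_funB; apply: measurable_funM => //; exact: measurable_funM.
have a2 : adapted (F k) xi2.
  apply: adapted_if_keep => //; first exact: adapted_cst.
  exact: measurable_funM.
have LM : cube_integrable P M := cube_integrable_skipped_sum k.
have LV : p32_integrable P V := p32_integrable_skipped_var k.+1.
have Ly := cube_integrable_y k; have Lq := p32_integrable_q k.
have my := Ly.1; have mq : measurable_fun setT (q k) by case: Lq.
have i1 : P.-integrable setT (EFin \o (fun w => xi1 w * y k w)).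
  apply: (@integrable_real_le _ _ _ _ _
      (fun w => 3 * `|M w ^+ 2 * y k w| + 3 * `|y k w * V w|)).
  - by apply: measurable_funM => //; exact: adapted_measurable a1.
  - apply: integrable_realD; apply: integrable_realZ; apply: integrable_norm.
      exact: integrable_sqr_mul.
    exact: integrable_mul_p32.
  - move=> w; rewrite /xi1; case: ifP => _.
      by rewrite mul0r normr0 addr_ge0// mulr_ge0.
    have -> : `|M w ^+ 2 * y k w| = `|M w| * `|M w| * `|y k w|.
      by rewrite normrM normrX expr2.
    rewrite mulrBl (le_trans (ler_normB _ _))// !normrM normr_id.
    rewrite (@ger0_norm _ 3)//.
    have -> : `|sg w| = 1 by rewrite /sg; case: ifP; rewrite ?normrN normr1.
    lra.
have i2 : P.-integrable setT (EFin \o (fun w => xi2 w * (y k w ^+ 2 - q k w))).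
  apply: (@integrable_real_le _ _ _ _ _
      (fun w => 3 * `|y k w ^+ 2 * M w| + 3 * `|M w * q k w|)).
  - apply: measurable_funM; first exact: adapted_measurable a2.
    by apply: measurable_funB => //; exact: measurable_funX.
  - apply: integrable_realD; apply: integrable_realZ; apply: integrable_norm.
      exact: integrable_sqr_mul.
    exact: integrable_mul_p32.
  - move=> w; rewrite /xi2; case: ifP => _.
      by rewrite mul0r normr0 addr_ge0// mulr_ge0.
    have -> : `|y k w ^+ 2 * M w| = `|M w| * `|y k w ^+ 2|.
      by rewrite normrM mulrC.
    rewrite mulrBr (le_trans (ler_normB _ _))//.
    rewrite (normrM _ (y k w ^+ 2)) [X in _ + X]normrM [`|3 * _|]normrM normr_id.
    by rewrite (@ger0_norm _ 3)// (normrM (M w)) !mulrA.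
have ipot := integrable_potential k; have iy3 := Ly.2.
have ia := integrable_realD ipot iy3.
have ib := integrable_realD ia i1.
have ic := integrable_realD ib i2.
have -> : \int[P]_w potential k w + \int[P]_w (`|y k w| ^+ 3) =
  \int[P]_w (potential k w + `|y k w| ^+ 3 + xi1 w * y k w +
    xi2 w * (y k w ^+ 2 - q k w)).
  rewrite (RintegralD measurableT ib i2) (RintegralD measurableT ia i1).
  by rewrite (RintegralD measurableT ipot iy3) (ms_mean ms a1 i1) (ms_var ms a2 i2) !addr0.
apply: le_RintegralT => //; first exact: integrable_potential.
move=> w; rewrite /potential /xi1 /xi2.
have ME : skipped_sum k.+1 w = M w + (if keep (q^~ w) k then 0 else y k w).
  by rewrite /skipped_sum big_ord_recr.
rewrite ME /V skipped_varS -/(M w).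
case: ifP => _; first by rewrite !addr0 !mul0r !addr0 lerDl exprn_ge0.
have h1 := cube_norm_expand (M w) (y k w).
have h2 : `|M w| + sg w * y k w <= `|M w + y k w|.
  rewrite /sg; have [m0|m0] := leP 0 (M w).
    by rewrite ger0_norm// mul1r ler_norm.
  by rewrite ltr0_norm// mulN1r -opprD -normrN ler_norm.
have r0 := skipped_var_ge0 (q0 w) k.
have h3 := ler_wpM2r (addr_ge0 r0 (q0 w k)) h2.
lra.
Qed.

(** A Rosenthal inequality with exponent 3. After summing [potential_step], [young_p32] turns the
    compensator into half of the left-hand side, which is finite and absorbed; this doubles the
    constants 1 and 27. *)
Lemma skipped_sum_cube n :
  \int[P]_w (`|skipped_sum n w| ^+ 3) <=
  2 * \sum_(i < n) \int[P]_w (`|y i w| ^+ 3) + 54 * \int[P]_w p32 (skipped_var (q^~ w) n).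
Proof.
have pot : \int[P]_w potential n w <= \sum_(i < n) \int[P]_w (`|y i w| ^+ 3).
  elim: n => [|n IH].
    rewrite big_ord0 (_ : potential 0 = cst 0) ?Rintegral_cst ?mul0r//.
    apply/funext => w; rewrite /potential /skipped_sum /skipped_var !big_ord0.
    by rewrite normr0 mul0r mulr0 subr0 expr0n.
  by rewrite big_ord_recr /= (le_trans (potential_step n))// lerD2r.
have [mM iM3] := cube_integrable_skipped_sum n.
have [mV V0 iV] := p32_integrable_skipped_var n.
have ip := integrable_potential n.
have i1 := integrable_realZ (2^-1) iM3; have i2 := integrable_realZ 27 iV.
have i3 := integrable_realD ip i1.
have : \int[P]_w (`|skipped_sum n w| ^+ 3) <=
   \int[P]_w (potential n w + 2^-1 * `|skipped_sum n w| ^+ 3 +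
      27 * p32 (skipped_var (q^~ w) n)).
  apply: le_RintegralT => //; first exact: integrable_realD.
  move=> w; rewrite /potential.
  have := young_p32 (normr_ge0 (skipped_sum n w)) (V0 w); lra.
rewrite (RintegralD measurableT i3 i2) (RintegralD measurableT ip i1).
rewrite (RintegralZl _ measurableT iM3) (RintegralZl _ measurableT iV).
lra.
Qed.

End MartingaleSteps.

(** * Lindeberg comparison *)

Section Lindeberg.
Context {R : realType}.
Local Notation SN := (@standard_normal R).

Definition normal_abs3 : R := \int[SN]_z (`|z| ^+ 3).

Lemma normal_abs3_ge0 : 0 <= normal_abs3.
Proof. by apply: Rintegral_ge0 => z _; rewrite exprn_ge0. Qed.

(** [B] secures integrability and enters no estimate; the quantitative constant is [K], common to
    all the test functions. *)
Definition smooth_test (B K : R) (g G G1 : R -> R) : Prop :=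
  [/\ forall x : R, is_derive x 1 g (G x), forall x : R, is_derive x 1 G (G1 x),
      forall x, `|G x| <= B /\ `|G1 x| <= B & lipschitz_with K G1].

(** A step [a] is traded for an independent normal one of variance [s ^ 2]. The semigroup property
    splits the larger normal variable as [L * z + s * w], and both sides are expanded to second
    order at [x + L * z]; what differs is a multiple of [a], a multiple of [a ^ 2 - s ^ 2], and
    cubes. *)
Lemma lindeberg_pointwise B K g G G1 (x L a s : R) : smooth_test B K g G G1 ->
  0 <= L -> 0 <= s ->
  \int[SN]_z g (x + a + L * z) <=
  \int[SN]_z g (x + Num.sqrt (L ^+ 2 + s ^+ 2) * z) +
  (\int[SN]_z G (x + L * z)) * a +
  2^-1 * (\int[SN]_z G1 (x + L * z)) * (a ^+ 2 - s ^+ 2) +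
  K * `|a| ^+ 3 + K * normal_abs3 * s ^+ 3.
Proof.
move=> [gG GG1 bG KG1] L0 s0; have K0 := lipschitz_with_ge0 KG1.
have lg : lipschitz_with B g.
  by apply: (derive_bounded_lipschitz gG) => z; have [] := bG z.
have lG : lipschitz_with B G.
  by apply: (derive_bounded_lipschitz GG1) => z; have [] := bG z.
have ig c := lipschitz_integrable_affine c L lg.
have iG := lipschitz_integrable_affine x L lG.
have iG1 := lipschitz_integrable_affine x L KG1.
have [isg <-] := lipschitz_semigroup x L0 s0 lg.
have icst (c : R) : SN.-integrable setT (EFin \o (fun _ : R => c)) :=
  standard_normal_integrable_cst c.
have up : \int[SN]_z g (x + a + L * z) <=
    \int[SN]_z g (x + L * z) + a * (\int[SN]_z G (x + L * z)) +
    2^-1 * a ^+ 2 * (\int[SN]_z G1 (x + L * z)) + K * `|a| ^+ 3.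
  have i1 := integrable_realZ a iG.
  have i2 := integrable_realZ (2^-1 * a ^+ 2) iG1.
  have i3 := integrable_realD (ig x) i1.
  have i4 := integrable_realD i3 i2.
  rewrite -(RintegralZl _ measurableT iG) -(RintegralZl _ measurableT iG1).
  rewrite -[K * `|a| ^+ 3](Rintegral_standard_normal_cst).
  rewrite -(RintegralD measurableT (ig x) i1) -(RintegralD measurableT i3 i2).
  rewrite -(RintegralD measurableT i4 (icst _)).
  apply: le_RintegralT => //; first exact: integrable_realD.
  move=> z; have := taylor2 (x + L * z) a K0 gG GG1 KG1.
  by rewrite (addrAC x a) ler_norml => /andP[_]; lra.
have low : \int[SN]_z g (x + L * z) + 2^-1 * s ^+ 2 * (\int[SN]_z G1 (x + L * z)) -
    K * normal_abs3 * s ^+ 3 <=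
    \int[SN]_z (\int[SN]_w g (x + L * z + s * w)).
  have i2 := integrable_realZ (2^-1 * s ^+ 2) iG1.
  have i3 := integrable_realD (ig x) i2.
  rewrite -(RintegralZl _ measurableT iG1).
  rewrite -[K * normal_abs3 * s ^+ 3](Rintegral_standard_normal_cst).
  rewrite -(RintegralD measurableT (ig x) i2) -(RintegralB measurableT i3 (icst _)).
  apply: le_RintegralT => //; first exact: integrable_realB.
  move=> z; set p := x + L * z.
  have j1 := integrable_realZ (s * G p) (@standard_normal_integrable_id R).
  have j2 := integrable_realZ (2^-1 * s ^+ 2 * G1 p) (@standard_normal_integrable_sqr R).
  have j3 := integrable_realZ (K * s ^+ 3) (@standard_normal_integrable_cube R).
  have j4 := integrable_realD (icst (g p)) j1.
  have j5 := integrable_realD j4 j2.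
  have -> : g p + 2^-1 * s ^+ 2 * G1 p - K * normal_abs3 * s ^+ 3 =
    \int[SN]_w (g p + s * G p * w + 2^-1 * s ^+ 2 * G1 p * w ^+ 2 -
      K * s ^+ 3 * `|w| ^+ 3).
    rewrite (RintegralB measurableT j5 j3) (RintegralD measurableT j4 j2).
    rewrite (RintegralD measurableT (icst (g p)) j1) Rintegral_standard_normal_cst.
    rewrite (RintegralZl _ measurableT (@standard_normal_integrable_id R)).
    rewrite (RintegralZl _ measurableT (@standard_normal_integrable_sqr R)).
    rewrite (RintegralZl _ measurableT (@standard_normal_integrable_cube R)).
    rewrite Rintegral_standard_normal_mean Rintegral_standard_normal_var.
    by rewrite -/normal_abs3; ring.
  apply: le_RintegralT.
  - exact: integrable_realB.
  - exact: lipschitz_integrable_affine lg.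
  - move=> w; have := taylor2 p (s * w) K0 gG GG1 KG1.
    rewrite ler_norml normrM (ger0_norm s0) !exprMn => /andP[+ _]; lra.
lra.
Qed.

Section Mixture.
Context d (T : measurableType d).

Lemma measurable_normal_mixture K f (X L : T -> R) : lipschitz_with K f ->
  measurable_fun setT X -> measurable_fun setT L ->
  measurable_fun setT (fun w => \int[SN]_z f (X w + L w * z)).
Proof.
move=> fK mX mL.
apply: (@measurable_Rintegral_section _ _ _ _ _ SN (fun wz : T * R => f (X wz.1 + L wz.1 * wz.2))).
apply: measurableT_comp; first exact: lipschitz_with_measurable fK.
apply: measurable_funD; first exact: measurableT_comp.
by apply: measurable_funM => //; exact: measurableT_comp.
Qed.

End Mixture.

Context d (T : measurableType d) (P : probability T R).
Variables (F : nat -> set (set T)) (y q : nat -> T -> R).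
Hypothesis ms : martingale_steps P F y q.
Variables (B K : R) (g G G1 : R -> R).
Hypothesis sm : smooth_test B K g G G1.

Let lg : lipschitz_with B g.
Proof.
have [gG _ bG _] := sm.
by apply: (derive_bounded_lipschitz gG) => z; have [] := bG z.
Qed.

Let lG : lipschitz_with B G.
Proof.
have [_ GG1 bG _] := sm.
by apply: (derive_bounded_lipschitz GG1) => z; have [] := bG z.
Qed.

Let KG1 : lipschitz_with K G1.
Proof. by case: sm. Qed.

Let K0 : 0 <= K.
Proof. exact: lipschitz_with_ge0 KG1. Qed.

Let B0 : 0 <= B.
Proof. exact: lipschitz_with_ge0 lg. Qed.

Let sF := ms_sub ms.
Let q0 w i : 0 <= q i w := ms_q0 ms i w.
Let X k := kept_sum y q k.
Let lam k := remaining_sd q k.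

(* Lindeberg's interpolation: [k] martingale steps, then the variance missing up to 1
   is filled by an independent normal variable. *)
Definition smoothed k w : R := \int[SN]_z g (X k w + lam k w * z).

Let lam0 k w : 0 <= lam k w.
Proof. exact: sqrtr_ge0. Qed.

Let lam_sqr k w : lam k w ^+ 2 = 1 - kept_var (q^~ w) k.
Proof. by rewrite sqr_sqrtr// subr_ge0 kept_var_le1. Qed.

Let lam1 k w : lam k w <= 1.
Proof.
rewrite -[leRHS]sqrtr1 ler_sqrt// lerBlDr lerDl kept_var_ge0//.
Qed.

Let mX k : measurable_fun setT (X k).
Proof. by apply: (adapted_measurable (sF k)); exact: adapted_kept_sum ms _. Qed.

Let mlam k : measurable_fun setT (lam k).
Proof.
case: k => [|k]; last first.
  by apply: (adapted_measurable (sF k)); exact: (adapted_remaining_sd ms).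
rewrite (_ : lam 0 = cst 1)//; apply/funext => w.
by rewrite /lam /remaining_sd /kept_var big_ord0 subr0 sqrtr1.
Qed.

Lemma integrable_smoothed k : P.-integrable setT (EFin \o smoothed k).
Proof.
pose c : R := \int[SN]_z `|z|.
have inz : SN.-integrable setT (EFin \o (fun z : R => `|z|)).
  exact: integrable_norm (@standard_normal_integrable_id R).
apply: (@integrable_real_le _ _ _ _ _ (fun w => `|g 0| + B * c + B * `|X k w|)).
- exact: measurable_normal_mixture lg (mX k) (mlam k).
- apply: integrable_realD; first exact: finite_measure_integrable_cst.
  by apply: integrable_realZ; apply: integrable_norm; apply: cube_integrable_L1;
    exact: (cube_integrable_kept_sum ms).
- move=> w; rewrite /smoothed.
  have i1 := lipschitz_integrable_affine (X k w) (lam k w) lg.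
  apply: (le_trans (le_normr_Rintegral measurableT i1)).
  have i2 := @standard_normal_integrable_cst R (`|g 0| + B * `|X k w|).
  have i3 := integrable_realZ B inz.
  have -> : `|g 0| + B * c + B * `|X k w| =
      \int[SN]_z (`|g 0| + B * `|X k w| + B * `|z|).
    rewrite (RintegralD measurableT i2 i3) Rintegral_standard_normal_cst.
    by rewrite (RintegralZl _ measurableT inz) addrAC.
  apply: le_RintegralT; first exact: integrable_norm.
    exact: integrable_realD.
  move=> z; have := lg 0 (X k w + lam k w * z); rewrite subr0 => h.
  have h1 : `|X k w + lam k w * z| <= `|X k w| + `|z|.
    apply: (le_trans (ler_normD _ _)); rewrite lerD2l normrM (ger0_norm (lam0 _ _)).
    by rewrite ler_piMl.
  have h2 := ler_wpM2l B0 h1.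
  have := ler_normD (g (X k w + lam k w * z) - g 0) (g 0); rewrite subrK; lra.
Qed.

(** The multipliers [H G] and [H G1] use the deviation left after the step, which is already known
    at time [k]; this makes both second-order differences integrate to 0. A skipped step changes
    neither the sum nor the missing variance. *)
Lemma smoothed_step k :
  \int[P]_w smoothed k.+1 w <= \int[P]_w smoothed k w +
    K * (1 + normal_abs3) * \int[P]_w (`|y k w| ^+ 3).
Proof.
have aX : adapted (F k) (X k) by exact: (adapted_kept_sum ms).
have alam : adapted (F k) (lam k.+1) by exact: (adapted_remaining_sd ms).
pose H (f : R -> R) w : R := \int[SN]_z f (X k w + lam k.+1 w * z).
have aG : adapted (F k) (H G) by exact: (measurable_normal_mixture lG aX alam).
have aG1 : adapted (F k) (H G1) by exact: (measurable_normal_mixture KG1 aX alam).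
have bH (f : R -> R) : (forall x, `|f x| <= B) -> measurable_fun setT f ->
    forall w, `|H f w| <= B.
  move=> fB mf w; have i1 : SN.-integrable setT (EFin \o (fun z => f (X k w + lam k.+1 w * z))).
    apply: (@standard_normal_integrable _ _ B).
      by apply: (measurableT_comp mf); apply: measurable_funD => //; exact: measurable_funM.
    by move=> z; apply: (le_trans (fB _)); have [h _ _ _] := pow_le_cube z; rewrite ler_peMr.
  apply: (le_trans (le_normr_Rintegral measurableT i1)).
  rewrite -[leRHS](Rintegral_standard_normal_cst); apply: le_RintegralT => //.
    exact: integrable_norm.
  exact: standard_normal_integrable_cst.
have [_ _ bG _] := sm.
have bHG : forall w, `|H G w| <= B.
  by apply: bH; [move=> x; have [] := bG x|exact: lipschitz_with_measurable lG].
have bHG1 : forall w, `|H G1 w| <= B.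
  by apply: bH; [move=> x; have [] := bG x|exact: lipschitz_with_measurable KG1].
pose xi1 w : R := if keep (q^~ w) k then H G w else 0.
pose xi2 w : R := if keep (q^~ w) k then H G1 w else 0.
have a1 : adapted (F k) xi1.
  by apply: (adapted_if_keep ms) => //; exact: adapted_cst.
have a2 : adapted (F k) xi2.
  by apply: (adapted_if_keep ms) => //; exact: adapted_cst.
have b1 w : `|xi1 w| <= B by rewrite /xi1; case: ifP => // _; rewrite normr0.
have b2 w : `|xi2 w| <= B by rewrite /xi2; case: ifP => // _; rewrite normr0.
have Ly := cube_integrable_y ms k; have [mq _ iq] := p32_integrable_q ms k.
have my := Ly.1; have iy3 := Ly.2.
have i1 : P.-integrable setT (EFin \o (fun w => xi1 w * y k w)).
  apply: (@integrable_real_le _ _ _ _ _ (fun w => B * `|y k w|)).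
  - by apply: measurable_funM => //; exact: (adapted_measurable (sF k)).
  - by apply: integrable_realZ; apply: integrable_norm; exact: cube_integrable_L1.
  - by move=> w; rewrite normrM ler_wpM2r.
have i2 : P.-integrable setT (EFin \o (fun w => xi2 w * (y k w ^+ 2 - q k w))).
  apply: (@integrable_real_le _ _ _ _ _
    (fun w => B * ((1 + `|y k w| ^+ 3) + (1 + p32 (q k w))))).
  - apply: measurable_funM; first exact: (adapted_measurable (sF k)).
    by apply: measurable_funB => //; exact: measurable_funX.
  - apply: integrable_realZ; apply: integrable_realD; apply: integrable_realD => //;
      exact: finite_measure_integrable_cst.
  - move=> w; rewrite normrM ler_pM//; apply: (le_trans (ler_normB _ _)).
    have [_ _ h _] := pow_le_cube (y k w); apply: lerD.
      by rewrite ger0_norm ?sqr_ge0.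
    by have := mul_le_p32 (@ler01 R) (q0 w k); rewrite mul1r expr1n ger0_norm ?q0.
have is0 := integrable_smoothed k.
have i3 := integrable_realD is0 i1.
have i4 := integrable_realD i3 (integrable_realZ (2^-1) i2).
have i5 := integrable_realD i4 (integrable_realZ K iy3).
have i6 := integrable_realZ (K * normal_abs3) iq.
have Kn : 0 <= K * normal_abs3 by rewrite mulr_ge0// normal_abs3_ge0.
apply: (@le_trans _ _ (\int[P]_w (smoothed k w + xi1 w * y k w +
   2^-1 * (xi2 w * (y k w ^+ 2 - q k w)) + K * `|y k w| ^+ 3 +
   K * normal_abs3 * p32 (q k w)))).
  apply: le_RintegralT; [exact: integrable_smoothed|exact: integrable_realD|].
  move=> w; rewrite /smoothed /xi1 /xi2.
  have XE : X k.+1 w = X k w + (if keep (q^~ w) k then y k w else 0).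
    by rewrite /X /kept_sum big_ord_recr.
  have lE : lam k w = Num.sqrt (lam k.+1 w ^+ 2 +
      Num.sqrt (if keep (q^~ w) k then q k w else 0) ^+ 2).
    rewrite [RHS](_ : _ = Num.sqrt (1 - kept_var (q^~ w) k))//; congr Num.sqrt.
    rewrite lam_sqr sqr_sqrtr; last by case: ifP.
    by rewrite kept_varS; ring.
  have := lindeberg_pointwise (X k w) (if keep (q^~ w) k then y k w else 0) sm
    (lam0 k.+1 w) (sqrtr_ge0 (if keep (q^~ w) k then q k w else 0)).
  rewrite -lE -XE -/(H G w) -/(H G1 w).
  case: ifP => _.
    rewrite sqr_sqrtr// p32_sqrt//; lra.
  rewrite sqrtr0 normr0 !expr0n /= => h.
  have := mulr_ge0 Kn (p32_ge0 (q0 w k)).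
  have := mulr_ge0 K0 (exprn_ge0 3 (normr_ge0 (y k w))); lra.
rewrite (RintegralD measurableT i5 i6) (RintegralD measurableT i4 (integrable_realZ K iy3)).
rewrite (RintegralD measurableT i3 (integrable_realZ (2^-1) i2)).
rewrite (RintegralD measurableT is0 i1) (RintegralZl _ measurableT i2).
rewrite (RintegralZl _ measurableT iy3) (RintegralZl _ measurableT iq).
rewrite (ms_mean ms a1 i1) (ms_var ms a2 i2).
have := ler_wpM2l Kn (ms_le ms k); lra.
Qed.

Lemma smoothed_le n : \int[P]_w smoothed n w <= \int[SN]_z g z +
  K * (1 + normal_abs3) * \sum_(i < n) \int[P]_w (`|y i w| ^+ 3).
Proof.
elim: n => [|n IH].
  rewrite big_ord0 mulr0 addr0 (_ : smoothed 0 = cst (\int[SN]_z g z)).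
    rewrite Rintegral_cst//.
    have -> : fine (P setT) = 1 :> R by rewrite probability_setT.
    by rewrite mulr1.
  apply/funext => w; rewrite /smoothed /X /lam /kept_sum /remaining_sd /kept_var !big_ord0.
  by apply: eq_Rintegral => z _; rewrite subr0 sqrtr1 add0r mul1r.
rewrite big_ord_recr /= mulrDr addrA (le_trans (smoothed_step n))// lerD2r.
exact: IH.
Qed.

Variable D : R -> R.
Hypothesis DL : lipschitz_with 2 D.
Hypothesis GD : forall x, `|G x| <= 32 * `|D x| ^+ 2 /\ `|G1 x| <= 32 * `|D x|.

Let S n w : R := \sum_(i < n) y i w.

Lemma kept_skipped_sum n w : S n w = X n w + skipped_sum y q n w.
Proof.
rewrite /S /X /kept_sum /skipped_sum -big_split; apply: eq_bigr => i _ /=.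
by case: ifP; rewrite ?addr0 ?add0r.
Qed.

(** Here the growth bounds by powers of [|D x|] pay: the first two orders become cubes with a small
    weight on [|D x| ^ 3]. The constant is [48 = 32 + 32 / 2]. *)
Lemma taylor_young e x t : 0 < e <= 1 ->
  g x - g (x + t) <= 48 * e * `|D x| ^+ 3 + (48 / e ^+ 2 + K) * `|t| ^+ 3.
Proof.
move=> e01; have [gG GG1 _ _] := sm.
have := taylor2 x t K0 gG GG1 KG1; rewrite ler_norml => /andP[h _].
have [h1 h2] := young_sqr_mul e01 (normr_ge0 (D x)) (normr_ge0 t).
have [G_ G1_] := GD x.
have h3 : - (G x * t) <= 32 * (`|D x| ^+ 2 * `|t|).
  rewrite (le_trans (ler_norm _))// normrN normrM mulrA ler_wpM2r//.
have h4 : - (G1 x * t ^+ 2) <= 32 * (`|D x| * `|t| ^+ 2).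
  rewrite (le_trans (ler_norm _))// normrN normrM normrX mulrA ler_wpM2r ?exprn_ge0//.
lra.
Qed.

(** [48 / e ^ 2 + K] is from [taylor_young], 4 from [cube_normD]; [12 * normal_abs3] pays for the
    missing variance, [164 = 2 + 54 * 3] for the skipped steps, and the last summand for the
    interpolation. *)
Definition gap_constant e : R :=
  4 * (48 / e ^+ 2 + K) * (12 * normal_abs3 + 164) + K * (1 + normal_abs3).

Lemma cube_integrable_S n : cube_integrable P (S n).
Proof. by apply: (cube_integrable_sum _ (h := y)) => i; exact: (cube_integrable_y ms). Qed.

Lemma cube_integrable_D f : cube_integrable P f -> cube_integrable P (fun w => D (f w)).
Proof.
move=> Lf; have [mf _] := Lf.
apply: (cube_integrable_le _ (g := fun w => `|D 0| + 2 * `|f w|)).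
- by apply: measurableT_comp mf; exact: lipschitz_with_measurable DL.
- apply: cube_integrableD; last first.
    apply: (cube_integrable_le _ (g := fun w => f w + f w)); last first.
    + move=> w; rewrite (_ : f w + f w = 2 * f w); last by ring.
      by rewrite !normrM normr_id.
    + exact: cube_integrableD.
    + by apply: measurable_funM => //; exact: measurableT_comp.
  split => //; exact: finite_measure_integrable_cst.
- move=> w; rewrite [leRHS]ger0_norm ?addr_ge0 ?mulr_ge0//.
  have := ler_normD (D (f w) - D 0) (D 0); rewrite subrK.
  have := DL 0 (f w); rewrite subr0; lra.
Qed.

Lemma test_gap n e : 0 < e <= 1 ->
  \int[P]_w g (S n w) - \int[SN]_z g z <=
  48 * e * \int[P]_w (`|D (S n w)| ^+ 3) +
  gap_constant e * (\sum_(i < n) \int[P]_w (`|y i w| ^+ 3) +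
     \int[P]_w p32 `|\sum_(i < n) q i w - 1|).
Proof.
move=> e01; have /andP[e0 _] := e01.
set l := \sum_(i < n) _; set b := \int[P]_w p32 _.
have LS := cube_integrable_S n; have [mS _] := LS.
have [mDS iDS] := cube_integrable_D LS.
have [mM iM] := cube_integrable_skipped_sum ms n.
pose C1 := 48 / e ^+ 2 + K.
have C10 : 0 <= C1 by rewrite addr_ge0// divr_ge0// exprn_ge0// ltW.
have LA : p32_integrable P (fun w => \sum_(i < n) q i w).
  by apply: (p32_integrable_sum _ (h := q)) => i; exact: (p32_integrable_q ms).
have [mb _ ib] := p32_integrable_norm_sub1 LA.
have ipq : P.-integrable setT (EFin \o (fun w => \sum_(i < n) p32 (q i w))).
  by apply: integrable_real_sum => i; case: (p32_integrable_q ms i).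
have lq : \int[P]_w (\sum_(i < n) p32 (q i w)) <= l.
  rewrite Rintegral_real_sum => [|i]; last by case: (p32_integrable_q ms i).
  by apply: ler_sum => i _; exact: (ms_le ms).
have ibq := integrable_realD ib ipq.
have ebq : \int[P]_w (p32 `|\sum_(i < n) q i w - 1| + \sum_(i < n) p32 (q i w)) <= b + l.
  by rewrite (RintegralD measurableT ib ipq) lerD2l.
have ilam : P.-integrable setT (EFin \o (fun w => lam n w ^+ 3)).
  apply: (@integrable_real_le _ _ _ _ _ (cst 1)).
  - exact: measurable_funX.
  - exact: finite_measure_integrable_cst.
  - by move=> w; rewrite ger0_norm ?exprn_ge0// exprn_ile1.
have elam : \int[P]_w (lam n w ^+ 3) <= 12 * (b + l).
  apply: (@le_trans _ _ (\int[P]_w (12 * (p32 `|\sum_(i < n) q i w - 1| + \sum_(i < n) p32 (q i w))))).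
    apply: le_RintegralT => //; first exact: integrable_realZ.
    move=> w; rewrite p32_sqrt; last by rewrite subr_ge0 kept_var_le1.
    exact: (p32_remaining_var_le (q0 w)).
  by rewrite (RintegralZl _ measurableT ibq) ler_wpM2l.
have eM : \int[P]_w (`|skipped_sum y q n w| ^+ 3) <= 2 * l + 162 * (b + l).
  apply: (le_trans (skipped_sum_cube ms n)); rewrite lerD2l.
  rewrite (_ : 162 = 54 * 3) -?mulrA ?ler_wpM2l//; last by ring.
  have [_ _ iV] := p32_integrable_skipped_var ms n.
  apply: (@le_trans _ _ (\int[P]_w (3 * (p32 `|\sum_(i < n) q i w - 1| + \sum_(i < n) p32 (q i w))))).
    apply: le_RintegralT => //; first exact: integrable_realZ.
    by move=> w; exact: (p32_skipped_var_le (q0 w)).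
  by rewrite (RintegralZl _ measurableT ibq) ler_wpM2l.
have igS : P.-integrable setT (EFin \o (fun w => g (S n w))).
  apply: (@integrable_real_le _ _ _ _ _ (fun w => `|g 0| + B * `|S n w|)).
  - by apply: measurableT_comp mS; exact: lipschitz_with_measurable lg.
  - apply: integrable_realD; first exact: finite_measure_integrable_cst.
    by apply: integrable_realZ; apply: integrable_norm; exact: cube_integrable_L1.
  - move=> w; have := ler_normD (g (S n w) - g 0) (g 0); rewrite subrK.
    by have := lg 0 (S n w); rewrite subr0; lra.
have is0 := integrable_smoothed n.
have j1 := integrable_realZ (48 * e) iDS.
have j2 := integrable_realZ (4 * C1 * normal_abs3) ilam.
have j3 := integrable_realZ (4 * C1) iM.
have j4 := integrable_realD is0 j1; have j5 := integrable_realD j4 j2.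
have main : \int[P]_w g (S n w) <= \int[P]_w smoothed n w +
   48 * e * \int[P]_w (`|D (S n w)| ^+ 3) + 4 * C1 * normal_abs3 * \int[P]_w (lam n w ^+ 3) +
   4 * C1 * \int[P]_w (`|skipped_sum y q n w| ^+ 3).
  rewrite -(RintegralZl _ measurableT iDS) -(RintegralZl _ measurableT ilam).
  rewrite -(RintegralZl _ measurableT iM) -(RintegralD measurableT is0 j1).
  rewrite -(RintegralD measurableT j4 j2) -(RintegralD measurableT j5 j3).
  apply: le_RintegralT => //; first exact: integrable_realD.
  move=> w; set c := 48 * e * _; set M := skipped_sum y q n w.
  have k1 := lipschitz_integrable_affine (X n w) (lam n w) lg.
  have k2 := integrable_realZ (4 * C1 * lam n w ^+ 3) (@standard_normal_integrable_cube R).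
  have k3 := @standard_normal_integrable_cst R (c + 4 * C1 * `|M| ^+ 3).
  have k4 := integrable_realD k1 k3.
  have : \int[SN]_z g (S n w) <= \int[SN]_z (g (X n w + lam n w * z) +
     (c + 4 * C1 * `|M| ^+ 3) + 4 * C1 * lam n w ^+ 3 * `|z| ^+ 3).
    apply: le_RintegralT; first exact: standard_normal_integrable_cst.
      exact: integrable_realD.
    (* The left side is constant in [z]: the full sum is compared with each point [X + lam * z], and
       averaging over [z] produces [smoothed n]. *)
    move=> z; have := taylor_young (S n w) (- M + lam n w * z) e01.
    rewrite (_ : S n w + (- M + lam n w * z) = X n w + lam n w * z); last first.
      by rewrite kept_skipped_sum -/M; ring.
    rewrite -/C1.
    have := cube_normD (- M) (lam n w * z); rewrite normrN normrM (ger0_norm (lam0 _ _)) exprMn.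
    move=> /(ler_wpM2l C10); rewrite /c; lra.
  rewrite Rintegral_standard_normal_cst (RintegralD measurableT k4 k2).
  rewrite (RintegralD measurableT k1 k3) Rintegral_standard_normal_cst.
  rewrite (RintegralZl _ measurableT (@standard_normal_integrable_cube R)).
  by rewrite -/normal_abs3 -/(smoothed n w); lra.
have sle := smoothed_le n.
have n0 := normal_abs3_ge0.
have b0 : 0 <= b by apply: Rintegral_ge0 => w _; rewrite p32_ge0.
have l0 : 0 <= l by apply: sumr_ge0 => i _; apply: Rintegral_ge0 => w _; rewrite exprn_ge0.
have u1 := ler_wpM2l (mulr_ge0 (mulr_ge0 (ler0n R 4) C10) n0) elam.
have u2 := ler_wpM2l (mulr_ge0 (ler0n R 4) C10) eM.
have u3 := mulr_ge0 (mulr_ge0 C10 n0) b0.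
have u4 := mulr_ge0 C10 b0.
have u5 := mulr_ge0 (mulr_ge0 K0 (addr_ge0 ler01 n0)) b0.
rewrite /gap_constant -/C1; rewrite -/l in sle.
lra.
Qed.

End Lindeberg.

(** * Transfer to the coupling and absorption *)

Section Law.
Context {R : realType} d (T : measurableType d) (P : probability T R).

Lemma has_law_Rintegral (U : {RV P >-> R}) (mu : probability R R) (f : R -> R) :
  has_law U mu -> measurable_fun setT f -> mu.-integrable setT (EFin \o f) ->
  P.-integrable setT (EFin \o (fun w => f (U w))) /\
  \int[P]_w f (U w) = \int[mu]_x f x.
Proof.
move=> lU mf imf; have mef : measurable_fun setT (EFin \o f) by exact/measurable_EFinP.
have E (h : R -> \bar R) : (\int[mu]_x h x = \int[distribution P U]_x h x)%E.
  by apply: eq_measure_integral => A mA _; first [exact: (esym (lU A mA)) | exact: (lU A mA)].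
have i1 : P.-integrable setT (EFin \o (fun w => f (U w))).
  apply/integrableP; split.
    by apply/measurable_EFinP; exact: measurableT_comp.
  have /integrableP[_] := imf.
  by rewrite E ge0_integral_distribution//; exact: measurableT_comp.
split => //; rewrite /Rintegral E integral_distribution//.
Qed.

Lemma integrable_distribution_real (U : {RV P >-> R}) (f : R -> R) :
  measurable_fun setT f -> P.-integrable setT (EFin \o (fun w => f (U w))) ->
  (distribution P U : probability R R).-integrable setT (EFin \o f).
Proof.
move=> mf /integrableP[_ fy]; have mef : measurable_fun setT (EFin \o f) by exact/measurable_EFinP.
apply/integrableP; split => //.
by rewrite ge0_integral_distribution//; exact: measurableT_comp.
Qed.

End Law.

Section Coupling.
Context {R : realType}.
Local Notation SN := (@standard_normal R).

(* Makes [2048 * 48 * coupling_eps * 8] equal to 1/2, so that the cost of the coupling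
   on the right-hand side can be absorbed. *)
Definition coupling_eps : R := 384^-1 * 4096^-1.

Lemma coupling_epsE : 48 * coupling_eps * 8 = 4096^-1 :> R.
Proof. by rewrite /coupling_eps; move: (4096^-1 : R) => a; field. Qed.

Lemma coupling_eps_in : 0 < coupling_eps <= 1.
Proof.
have h1 : (0 : R) < 4096^-1 by lra.
have h2 : (4096^-1 : R) <= 1 by lra.
by move: h1 h2; rewrite -coupling_epsE => h1 h2; apply/andP; split; lra.
Qed.

Definition coupling_constant : R := 4096 * gap_constant 5440 coupling_eps.

Lemma coupling_constant_gt0 : 0 < coupling_constant.
Proof.
have h1 : (0 : R) < 4096 by lra.
have h2 : (0 : R) <= 5440 by lra.
rewrite /coupling_constant; move: h1 h2; move: (4096 : R) (5440 : R) => a K a0 K0.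
apply: mulr_gt0 => //; have n0 := @normal_abs3_ge0 R; have /andP[e0 _] := coupling_eps_in.
rewrite /gap_constant; have e2 : 0 < 48 / coupling_eps ^+ 2 by rewrite divr_gt0// exprn_gt0.
by apply: ltr_pwDl; [apply: mulr_gt0; lra | apply: mulr_ge0 => //; lra].
Qed.

Lemma normal_coupling d (T : measurableType d) (P : probability T R)
    (F : nat -> set (set T)) (y q : nat -> T -> R) n (X : {RV P >-> R}) :
  martingale_steps P F y q -> (forall w, X w = \sum_(i < n) y i w) ->
  exists (d' : measure_display) (T' : measurableType d') (P' : probability T' R)
    (U V : {RV P' >-> R}),
    [/\ has_law U (distribution P X), has_law V SN,
       P'.-integrable setT (EFin \o (fun t => `|U t - V t| ^+ 3)) &
       \int[P']_t (`|U t - V t| ^+ 3) <= coupling_constant *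
         (\sum_(i < n) \int[P]_w (`|y i w| ^+ 3) +
          \int[P]_w p32 `|\sum_(i < n) q i w - 1|)].
Proof.
move=> ms XE.
have [U [V [D [lU lV DL DE]]]] := quantile_coupling (distribution P X) SN.
eexists _, _, _, U, V.
set P' := uniform_prob _ in U V lU lV DE *.
set lb := _ + _.
have L3X : cube_integrable P X.
  have -> : (X : T -> R) = (fun w => \sum_(i < n) y i w) by exact/funext.
  by apply: (cube_integrable_sum _ (h := y)) => i; exact: (cube_integrable_y ms).
have mcube : measurable_fun setT (fun x : R => `|x| ^+ 3).
  exact: measurable_norm_cube.
have iU := integrable_distribution_real mcube L3X.2.
have L3U : cube_integrable P' U by split => //; have [] := has_law_Rintegral lU mcube iU.
have L3V : cube_integrable P' V.
  by split => //; have [] := has_law_Rintegral lV mcube standard_normal_integrable_cube.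
have L3d : cube_integrable P' (fun t => U t - V t).
  apply: cube_integrableD => //; apply: (cube_integrable_le _ L3V); first exact: measurableT_comp.
  by move=> t; rewrite normrN.
have [md id3] := L3d.
split => //.
set e := \int[P']_t _.
have lX : has_law X (distribution P X) by move=> A _.
have mD : measurable_fun setT D := lipschitz_with_measurable DL.
(* [U] is at distance [|U - V| / 2] from the midpoint, where [D] equals [U - V]. *)
have DU t : `|D (U t)| <= 2 * `|U t - V t|.
  have := DL ((U t + V t) / 2) (U t); rewrite DE.
  rewrite (_ : U t - (U t + V t) / 2 = (U t - V t) / 2); last by field.
  rewrite normrM (@ger0_norm _ 2^-1)//.
  have := ler_normD (D (U t) - (U t - V t)) (U t - V t); rewrite subrK; lra.
have eD : \int[P]_w (`|D (X w)| ^+ 3) <= 8 * e.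
  have mD3 : measurable_fun setT (fun x => `|D x| ^+ 3) by exact: measurable_norm_cube.
  have iDX : P.-integrable setT (EFin \o (fun w => `|D (X w)| ^+ 3)).
    by have [] := cube_integrable_D DL L3X.
  have iDd := integrable_distribution_real mD3 iDX.
  have [_ ->] := has_law_Rintegral lX mD3 iDd.
  have [iDU <-] := has_law_Rintegral lU mD3 iDd.
  rewrite /e -RintegralZl//; apply: le_RintegralT => //; first exact: integrable_realZ.
  move=> t; have : `|D (U t)| ^+ 3 <= (2 * `|U t - V t|) ^+ 3.
    by rewrite lerXn2r ?nnegrE ?mulr_ge0.
  by rewrite exprMn (_ : 2 ^+ 3 = 8 :> R)//; ring.
(* The scales of the [N]-th test function exhaust [0, oo[ as [N] grows. *)
pose h N t : R := if 4 * (2 ^+ N)^-1 <= `|U t - V t| <= (2 ^+ N)^-1 * 2 ^+ (N + N).+1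
  then `|U t - V t| ^+ 3 else 0.
have mh N : measurable_fun setT (h N).
  apply: measurable_fun_ifT => //; last exact: measurable_norm_cube.
  by apply: measurable_and; apply: measurable_fun_ler => //;
    exact: (measurableT_comp (@normr_measurable _ _) md).
have hle N t : `|h N t| <= `|U t - V t| ^+ 3.
  have h0 : 0 <= `|U t - V t| ^+ 3 by rewrite exprn_ge0.
  by rewrite /h; case: ifP => _; [rewrite ger0_norm | rewrite normr0].
have ih N : P'.-integrable setT (EFin \o h N).
  by apply: integrable_real_le id3 _.
have hN N : \int[P']_t h N t <= e / 2 + coupling_constant / 2 * lb.
  have d0 : 0 < (2 ^+ N)^-1 :> R by rewrite invr_gt0 exprn_gt0.
  (* With [delta = 2 ^ -N] and [M = 2 * N] the gain covers [|U - V|] from [4 * 2 ^ -N] to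
     [2 ^ (N + 1)], while the constants 32 and 5440 do not depend on [N]. *)
  have [g [G [G1 [[gG GG1] GD G1K [B GB] gain]]]] := test_function (N + N) d0 DL.
  have sm : smooth_test B 5440 g G G1 by split.
  have lg : lipschitz_with B g.
    by apply: (derive_bounded_lipschitz gG) => z; have [] := GB z.
  have mg := lipschitz_with_measurable lg.
  have igX : P.-integrable setT (EFin \o (fun w => g (X w))).
    have B0 := lipschitz_with_ge0 lg.
    apply: (@integrable_real_le _ _ _ _ _ (fun w => `|g 0| + B * `|X w|)).
    - exact: measurableT_comp.
    - apply: integrable_realD; first exact: finite_measure_integrable_cst.
      by apply: integrable_realZ; apply: integrable_norm; exact: cube_integrable_L1.
    - move=> w; have := ler_normD (g (X w) - g 0) (g 0); rewrite subrK.
      by have := lg 0 (X w); rewrite subr0; lra.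
  have igd := integrable_distribution_real mg igX.
  have [igU gU] := has_law_Rintegral lU mg igd.
  have [_ gX] := has_law_Rintegral lX mg igd.
  have igSN : SN.-integrable setT (EFin \o g).
    have := lipschitz_integrable_affine 0 1 lg.
    by under eq_fun do rewrite add0r mul1r.
  have [igV gV] := has_law_Rintegral lV mg igSN.
  have [c c0 cE] : exists2 c : R, 0 < c & c = 2048.
    by exists 2048; [lra | reflexivity].
  have : \int[P']_t (h N t) <= \int[P']_t (c * (g (U t) - g (V t))).
    apply: le_RintegralT => //; first by apply: integrable_realZ; exact: integrable_realB.
    move=> t; have [g0 g1] := gain _ _ (DE t); rewrite /h; rewrite -cE in g1.
    case: ifP => [/g1|_]; last by rewrite mulr_ge0// ltW.
    by rewrite ler_pdivrMr// mulrC.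
  rewrite RintegralZl//; last exact: integrable_realB.
  rewrite RintegralB// gU -gX gV.
  have -> : \int[P]_w g (X w) = \int[P]_w g (\sum_(i < n) y i w).
    by apply: eq_Rintegral => w _; rewrite XE.
  have eD' : \int[P]_w (`|D (\sum_(i < n) y i w)| ^+ 3) <= 8 * e.
    by apply: le_trans eD; rewrite le_eqVlt; apply/orP; left; apply/eqP;
      apply: eq_Rintegral => w _; rewrite XE.
  (* As [c = 2048], the term in [e] becomes exactly [e / 2]. *)
  move=> hg; apply: (le_trans hg); apply: le_trans (_ : c * (4096^-1 * e +
      gap_constant 5440 coupling_eps * lb) <= _).
    rewrite ler_pM2l//; apply: le_trans (test_gap ms sm DL GD n coupling_eps_in) _.
    rewrite -/lb lerD2r; have /andP[e0 _] := coupling_eps_in.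
    apply: le_trans (ler_wpM2l (mulr_ge0 (ler0n R 48) (ltW e0)) eD') _.
    by rewrite (mulrA _ 8) coupling_epsE.
  rewrite cE /coupling_constant; clear; move: (gap_constant _ _) lb e => gc l x; lra.
have hcv t : (h N t)%:E @[N --> \oo] --> (`|U t - V t| ^+ 3)%:E.
  apply: cvg_near_cst; near=> N; congr EFin; rewrite /h.
  have [->|d0] := eqVneq (U t - V t) 0; first by rewrite normr0 expr0n /=; case: ifP.
  have dp : 0 < `|U t - V t| by rewrite normr_gt0.
  have p0 : 0 < 2 ^+ N :> R by rewrite exprn_gt0.
  have N2 : N%:R <= 2 ^+ N :> R by rewrite -natrX ler_nat ltnW// ltn_expl.
  have N4 : 4 / `|U t - V t| <= N%:R by near: N; exact: nbhs_infty_ger.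
  have Nd : `|U t - V t| <= N%:R by near: N; exact: nbhs_infty_ger.
  rewrite ifT//; apply/andP; split.
    rewrite ler_pdivrMr// -ler_pdivrMl// mulrC; exact: le_trans N2.
  rewrite exprS exprD mulrA (mulrC _ 2) -!mulrA mulKf ?gt_eqF//; lra.
have : ((\int[P']_t (`|U t - V t| ^+ 3))%:E <= (e / 2 + coupling_constant / 2 * lb)%:E)%E.
  rewrite EFin_Rintegral//.
  have cv := @dominated_cvg _ _ _ P' setT measurableT (fun N t => (h N t)%:E)
    (fun t => (`|U t - V t| ^+ 3)%:E) (fun t => (`|U t - V t| ^+ 3)%:E).
  have {}cv := cv (fun N => (measurable_EFinP _ _).2 (mh N)) (fun t _ => hcv t)
    (fun t _ => isT) id3 (fun N t _ => hle N t).
  rewrite -(cvg_lim _ cv)//; apply: lime_le.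
    by apply/cvg_ex; eexists; exact: cv.
  apply: nearW => N; rewrite -EFin_Rintegral// lee_fin; exact: hN.
(* Absorbing [e / 2] doubles the constant. *)
rewrite lee_fin -/e; lra.
Unshelve. all: by end_near. Qed.

End Coupling.

(** * Normalization *)

Section Normalized.
Context {R : realType} d (T : measurableType d) (P : probability T R).
Implicit Types (F : nat -> set (set T)) (y q : nat -> T -> R).

Lemma martingale_steps_cond_exp F y q :
  (forall k, sub_sigma_field (F k)) -> (forall k, F k `<=` F k.+1) ->
  (forall k, adapted (F k.+1) (y k)) ->
  (forall k, P.-integrable setT (EFin \o (fun w => `|y k w| ^+ 3))) ->
  (forall k, is_cond_exp P (F k) (y k) (cst 0)) ->
  (forall k w, 0 <= q k w) ->
  (forall k, is_cond_exp P (F k) (fun w => y k w ^+ 2) (q k)) ->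
  martingale_steps P F y q.
Proof.
move=> sF FF ay iy3 cy q0 cq.
have my k : measurable_fun setT (y k) by exact: adapted_measurable (sF k.+1) (ay k).
have iy k : P.-integrable setT (EFin \o y k).
  exact: cube_integrable_L1 (conj (my k) (iy3 k)).
have iy2 k : P.-integrable setT (EFin \o (fun w => y k w ^+ 2)).
  have L1 : cube_integrable P (cst 1) by split => //;
    exact: (finite_measure_integrable_cst P (`|1| ^+ 3)).
  have := integrable_sqr_mul (conj (my k) (iy3 k)) L1.
  by under eq_fun do rewrite mulr1.
split => //.
- by move=> k; have [? _ _] := cq k; exact: adapted_preimage.
- by move=> k; have [] := cond_jensen_three_halves (sF k) (my k) (iy3 k) (iy2 k) (cq k) (q0 k).
- by move=> k; have [] := cond_jensen_three_halves (sF k) (my k) (iy3 k) (iy2 k) (cq k) (q0 k).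
- move=> k xi axi ixi; have := cond_exp_orthogonal (sF k) (iy k) (cy k) axi.
  have -> : (fun w => xi w * (y k w - cst 0 w)) = (fun w => xi w * y k w).
    by apply/funext => w; rewrite subr0.
  exact.
- by move=> k xi axi ixi; exact: cond_exp_orthogonal (sF k) (iy2 k) (cq k) axi ixi.
Qed.

Lemma is_cond_exp_scale G c (X Z : T -> R) : sub_sigma_field G ->
  P.-integrable setT (EFin \o X) -> is_cond_exp P G X Z ->
  is_cond_exp P G (fun w => c * X w) (fun w => c * Z w).
Proof.
move=> sG iX [mZ LZ XZ].
have iZ : P.-integrable setT (EFin \o Z) by exact/Lfun1_integrable.
have aZ : adapted G (fun w => c * Z w).
  by apply: measurable_funM => //; exact: adapted_preimage.
split.
- by move=> _ [B mB <-]; rewrite setTI; exact: (adaptedE _ sG).1 aZ _ mB.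
- by apply/Lfun1_integrable; exact: integrable_realZ.
- move=> A GA; have mA : measurable A by have [_] := sG; exact.
  under eq_integral do rewrite EFinM; under [RHS]eq_integral do rewrite EFinM.
  by rewrite !integralZl ?XZ//; [exact: integrableS iX | exact: integrableS iZ].
Qed.

Lemma is_cond_exp_cst0 G : sub_sigma_field G -> is_cond_exp P G (cst 0) (cst 0).
Proof.
move=> sG; split => //.
- by move=> _ [B mB <-]; rewrite setTI; apply: (adaptedE _ sG).1 => //; exact: measurable_cst.
- by apply/Lfun1_integrable; exact: finite_measure_integrable_cst.
Qed.

Section Steps.
Context (n : nat) (F : nat -> set (set T)) (Y : nat -> {RV P >-> R}) (sigma2 : nat -> T -> R).
Hypothesis fF : filtration n F.
Hypothesis mdY : martingale_difference n F Y.
Hypothesis sqY : square_integrable n Y.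
Hypothesis s_gt0 : 0 < sn n Y.
Hypothesis cvY : conditional_variances n F Y sigma2.
Hypothesis iY3 : forall m, (0 < m <= n)%N ->
  P.-integrable setT (EFin \o (fun w => `|Y m w| ^+ 3)).

(** Extended by 0 past [n], with the filtration frozen there, since [martingale_steps] speaks of all
    times. The shift is due to [Y] starting at index 1. *)
Definition normalized_step k w : R := if (k < n)%N then (sn n Y)^-1 * Y k.+1 w else 0.

Definition normalized_var k w : R :=
  if (k < n)%N then (sn n Y)^-1 ^+ 2 * Num.max (sigma2 k.+1 w) 0 else 0.

Lemma normalized_martingale_steps :
  martingale_steps P (fun k => F (minn k n)) normalized_step normalized_var.
Proof.
have [sF FF] := fF.
have sF' k : sub_sigma_field (F (minn k n)) by apply: sF; exact: geq_minr.
have iY2 k : (k < n)%N -> P.-integrable setT (EFin \o (fun w => Y k.+1 w ^+ 2)).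
  by move=> kn; apply: Lfun2_integrable_sqr; exact: sqY.
apply: martingale_steps_cond_exp => //.
- move=> k /=; have [kn|kn] := boolP (k < n)%N.
    by rewrite (minn_idPl (ltnW kn)) (minn_idPl kn); exact: FF.
  by rewrite -leqNgt in kn; rewrite (minn_idPr kn) (minn_idPr (leqW kn)).
- move=> k /=; rewrite /normalized_step; have [kn|kn] := boolP (k < n)%N;
  last exact: measurable_cst.
  rewrite (minn_idPl kn); apply: measurable_funM; first exact: measurable_cst.
  by have [mY _ _] := mdY (kn : 0 < k.+1 <= n)%N; apply: adapted_preimage => //; exact: sF.
- move=> k /=; rewrite /normalized_step; have [kn|kn] := boolP (k < n)%N; last first.
    by have [] := cube_integrable0 P.
  under eq_fun do rewrite normrM exprMn.
  by apply: integrable_realZ; exact: iY3.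
- move=> k /=; rewrite /normalized_step; have [kn|kn] := boolP (k < n)%N;
  last exact: is_cond_exp_cst0.
  have [_ LY cY] := mdY (kn : 0 < k.+1 <= n)%N.
  have := is_cond_exp_scale (sn n Y)^-1 (sF' k) ((Lfun1_integrable _ _).1 LY).
  by rewrite (minn_idPl (ltnW kn)) => /(_ _ cY);
    under [X in is_cond_exp _ _ _ X]eq_fun do rewrite mulr0.
- move=> k w; rewrite /normalized_var; case: ifP => // _.
  by rewrite mulr_ge0 ?sqr_ge0// le_max lexx orbT.
- move=> k /=; rewrite /normalized_step /normalized_var; have [kn|kn] := boolP (k < n)%N;
  last first.
    by under eq_fun do rewrite expr0n; exact: is_cond_exp_cst0.
  under eq_fun do rewrite exprMn.
  apply: is_cond_exp_scale => //; first exact: iY2.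
  rewrite (minn_idPl (ltnW kn)); apply: cond_exp_max; first exact/sF/ltnW.
    exact: (cvY (kn : 0 < k.+1 <= n)%N).
  by move=> w; rewrite sqr_ge0.
Qed.

Lemma normalized_sum w : Xn n Y w = \sum_(i < n) normalized_step i w.
Proof.
have h (r : seq nat) : (\sum_(i <- r) (Y i : {mfun T >-> R}) : {mfun T >-> R}) w =
    \sum_(i <- r) Y i w.
  by elim: r => [|a r IH]; rewrite ?big_nil// !big_cons -IH.
rewrite [LHS](_ : _ = (sn n Y)^-1 * \sum_(1 <= i < n.+1) Y i w); last by rewrite -h.
rewrite big_add1 /= big_mkord mulr_sumr; apply: eq_bigr => i _.
by rewrite /normalized_step ltn_ord.
Qed.

Lemma ae_normalized_var : {ae P, forall w, Vn2 n Y sigma2 w = \sum_(i < n) normalized_var i w}.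
Proof.
have [sF _] := fF.
have : {ae P, forall w (i : 'I_n), sigma2 i.+1 w = Num.max (sigma2 i.+1 w) 0}.
  apply: filter_forall => i.
  have hi : (0 < i.+1 <= n)%N by rewrite /= ltn_ord.
  apply: (cond_exp_ae_ge0 _ (cvY hi)) => [|w]; last by rewrite sqr_ge0.
  by apply: sF; rewrite ltnW.
apply: filterS => w hw; rewrite /Vn2 big_add1 /= big_mkord mulr_sumr.
apply: eq_bigr => i _; rewrite /normalized_var ltn_ord -hw exprVn sqr_sqrtr//.
by move: s_gt0; rewrite /sn sqrtr_gt0 => /ltW.
Qed.

End Steps.
End Normalized.

(** * Norms and the Lyapunov coefficient *)

Section Norms.
Context {R : realType}.

Lemma powR_three_halves (x : R) : 0 <= x -> x `^ (3 / 2) = p32 x.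
Proof.
move=> x0; have -> : 3 / 2 = 1 + 2^-1 :> R by lra.
rewrite powRD ?powRr1 ?powR12_sqrt//.
by apply/implyP => /eqP h; exfalso; lra.
Qed.

Lemma cube_powR (x : R) : 0 <= x -> (x ^+ 3) `^ 3^-1 = x.
Proof. by move=> x0; rewrite -powR_mulrn// -powRrM mulfV ?powRr1. Qed.

Lemma powR_cube (x : R) : 0 <= x -> (x `^ 3^-1) ^+ 3 = x.
Proof. by move=> x0; rewrite -powR_mulrn ?powR_ge0// -powRrM mulVf ?powRr1. Qed.

(** Subadditivity of the cube root, from [x ^ 3 + y ^ 3 <= (x + y) ^ 3]; [K + 1] stands for the cube
    root of [K], since [K <= (K + 1) ^ 3]. *)
Lemma powR_third_le (K e l b : R) : 0 < K -> 0 <= e -> 0 <= l -> 0 <= b ->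
  e <= K * (l + b) -> e `^ 3^-1 <= (K + 1) * (l `^ 3^-1 + b `^ 3^-1).
Proof.
move=> K0 e0 l0 b0 h; set x := l `^ _; set y := b `^ _.
have x0 : 0 <= x by exact: powR_ge0.
have y0 : 0 <= y by exact: powR_ge0.
have z0 : 0 <= (K + 1) * (x + y) by apply: mulr_ge0; lra.
rewrite -[leRHS]cube_powR//; apply: ge0_ler_powR; rewrite ?nnegrE ?invr_ge0 ?exprn_ge0//.
apply: (le_trans h); rewrite exprMn -(powR_cube l0) -(powR_cube b0) -/x -/y.
have h1 : x ^+ 3 + y ^+ 3 <= (x + y) ^+ 3.
  have := mulr_ge0 (mulr_ge0 x0 y0) (addr_ge0 x0 y0); nra.
have h2 : K <= (K + 1) ^+ 3 by have := mulr_gt0 K0 K0; nra.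
by apply: ler_pM => //; [lra | rewrite addr_ge0// exprn_ge0].
Qed.

Context d (T : measurableType d) (P : probability T R).

Lemma Lnorm_three (f : T -> R) :
  P.-integrable setT (EFin \o (fun w => `|f w| ^+ 3)) ->
  ('N[P]_(3%:E)[(fun w => (f w)%:E)] = ((\int[P]_w (`|f w| ^+ 3)) `^ 3^-1)%:E)%E.
Proof.
move=> fi; rewrite unlock /= -poweR_EFin EFin_Rintegral//; congr poweR.
by apply: eq_integral => w _ /=; rewrite powR_mulrn.
Qed.

(** The exponents [2 / 3] and [1 / 2] multiply to [1 / 3], so both terms of the bound are cube
    roots, as is the cost of the coupling. *)
Lemma Lnorm_three_halves (f : T -> R) :
  P.-integrable setT (EFin \o (fun w => p32 `|f w|)) ->
  (('N[P]_((3 / 2)%:E)[(fun w => (f w)%:E)]) `^ 2^-1 =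
   ((\int[P]_w p32 `|f w|) `^ 3^-1)%:E)%E.
Proof.
move=> fi; rewrite unlock /= -poweRrM -poweR_EFin EFin_Rintegral//; congr poweR.
  by apply: eq_integral => w _ /=; rewrite powR_three_halves.
by field.
Qed.

End Norms.

Section Lyapunov.
Context {R : realType} d (T : measurableType d) (P : probability T R).
Context (n : nat) (Y : nat -> {RV P >-> R}).
Hypothesis s_gt0 : 0 < sn n Y.

(** Disposes of an infinite third moment, where the bound is trivial; everywhere else third moments
    are finite. *)
Lemma L3_pinfty m : (0 < m <= n)%N ->
  ~ P.-integrable setT (EFin \o (fun w => `|Y m w| ^+ 3)) -> L3 n Y = +oo%E.
Proof.
move=> hm nY; rewrite /L3.
have E0 i : (0 <= 'E_P[(fun w => `|Y i w| ^+ 3)%R])%E.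
  by rewrite unlock; apply: integral_ge0 => w _; rewrite lee_fin exprn_ge0.
rewrite (_ : (\sum_(1 <= i < n.+1) _)%E = +oo%E).
  by rewrite poweRyr// gt0_muley// lte_fin invr_gt0.
apply/esum_eqyP => [i _|]; first by rewrite gt_eqF// (lt_le_trans _ (E0 i)).
exists m; split => //; first by rewrite mem_index_iota ltnS.
apply/eqP; rewrite eq_le leey /= leNgt; apply/negP => Ey; apply: nY.
apply: ge0_integrable_real => //.
- by apply: measurable_norm_cube.
- by move: Ey; rewrite unlock.
Qed.

Lemma L3E : (forall m, (0 < m <= n)%N ->
    P.-integrable setT (EFin \o (fun w => `|Y m w| ^+ 3))) ->
  L3 n Y = ((\sum_(i < n) \int[P]_w (`|normalized_step n Y i w| ^+ 3)) `^ 3^-1)%:E.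
Proof.
move=> iY; rewrite /L3 big_add1 /= big_mkord.
rewrite (_ : (\sum_(i < n) _)%E = (\sum_(i < n) \int[P]_w (`|Y i.+1 w| ^+ 3))%:E); last first.
  rewrite -sumEFin; apply: eq_bigr => i _.
  by rewrite unlock EFin_Rintegral//; apply: iY; rewrite ltn_ord.
rewrite poweR_EFin -EFinM; congr EFin.
rewrite -[X in X * _]cube_powR ?invr_ge0 ?(ltW s_gt0)// -powRM.
- congr powR; rewrite mulr_sumr; apply: eq_bigr => i _.
  rewrite -RintegralZl//; last by apply: iY; rewrite ltn_ord.
  apply: eq_Rintegral => w _; rewrite /normalized_step ltn_ord normrM exprMn.
  by rewrite ger0_norm ?invr_ge0 ?ltW.
- by rewrite exprn_ge0// invr_ge0 ltW.
- by apply: sumr_ge0 => i _; apply: Rintegral_ge0 => w _; rewrite exprn_ge0.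
Qed.

End Lyapunov.

Theorem theorem8 (R : realType) :
  exists C : R, 0 < C /\
  forall (d : measure_display) (T : measurableType d) (P : probability T R)
    (n : nat) (F : nat -> set (set T)) (Y : nat -> {RV P >-> R})
    (sigma2 : nat -> T -> R),
    (1 <= n)%N ->
    filtration n F ->
    trivial_sigma_field (F 0%N) ->
    martingale_difference n F Y ->
    square_integrable n Y ->
    0 < sn n Y ->
    conditional_variances n F Y sigma2 ->
    (wasserstein 3 (distribution P (Xn n Y)) standard_normal
     <= C%:E * (L3 n Y
          + ('N[P]_((3 / 2)%:E)[(fun w => (Vn2 n Y sigma2 w - 1)%:E)]) `^ 2^-1%R))%E.
Proof.
have K0 := @coupling_constant_gt0 R; exists (coupling_constant + 1).
split; first by rewrite addr_gt0.
move=> d T P n F Y sigma2 _ fF _ mdY sqY s_gt0 cvY.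
have C0 : 0 < coupling_constant + 1 :> R by rewrite addr_gt0.
case: (pselect (forall m, (0 < m <= n)%N ->
    P.-integrable setT (EFin \o (fun w => `|Y m w| ^+ 3)))) => [iY3|nY3]; last first.
  have [m hm nY] : exists2 m, (0 < m <= n)%N &
      ~ P.-integrable setT (EFin \o (fun w => `|Y m w| ^+ 3)).
    apply: contrapT => h; apply: nY3 => m hm; apply: contrapT => nY.
    by apply: h; exists m.
  rewrite (L3_pinfty s_gt0 hm nY) addye; last by rewrite gt_eqF// (lt_le_trans _ (poweR_ge0 _ _)).
  by rewrite gt0_muley ?leey// lte_fin.
have ms := normalized_martingale_steps fF mdY sqY cvY iY3.
have [d' [T' [P' [U [V [lU lV id3 le3]]]]]] := normal_coupling ms (normalized_sum n Y).
have [mSq Sq0 iSq] : p32_integrable P (fun w => \sum_(i < n) normalized_var n Y sigma2 i w).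
  by apply: (p32_integrable_sum _ (h := normalized_var n Y sigma2)) => i;
    exact: (p32_integrable_q ms).
have [mb _ ib] := p32_integrable_norm_sub1 (And3 mSq Sq0 iSq).
have ae := ae_normalized_var fF s_gt0 cvY.
have mV : measurable_fun setT (Vn2 n Y sigma2).
  apply: measurable_funM => //; under eq_fun do rewrite big_add1 /= big_mkord.
  apply: measurable_sum => i; have hi : (0 < i.+1 <= n)%N by rewrite /= ltn_ord.
  by have [_ Ls _] := cvY _ hi; exact: (integrable_real_measurable ((Lfun1_integrable _ _).1 Ls)).
have mVp : measurable_fun setT (fun w => p32 `|Vn2 n Y sigma2 w - 1|).
  by apply: measurable_p32; apply: measurableT_comp => //; apply: measurable_funB => //;
    exact: measurable_cst.
(* [Vn2] involves the given versions of the conditional variances, [normalized_var] their positive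
   parts; the two agree almost surely. *)
have eV : (\int[P]_w (p32 `|Vn2 n Y sigma2 w - 1|)%:E =
    \int[P]_w (p32 `|\sum_(i < n) normalized_var n Y sigma2 i w - 1|)%:E)%E.
  apply: ae_eq_integral => //; first exact/measurable_EFinP.
    exact/measurable_EFinP/measurable_p32.
  by apply: filterS ae => w -> _.
have iV : P.-integrable setT (EFin \o (fun w => p32 `|Vn2 n Y sigma2 w - 1|)).
  apply: ge0_integrable_real => //; first by move=> w; rewrite p32_ge0.
  by rewrite eV -EFin_Rintegral// ltry.
rewrite L3E// (Lnorm_three_halves iV) -EFinD -EFinM.
apply: le_trans (_ : (((\int[P']_t (`|U t - V t| ^+ 3)) `^ 3^-1)%:E <= _)%E).
  apply: ereal_inf_lbound; exists d', T', P', U, V; split => //.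
  by rewrite Lnorm_three.
rewrite lee_fin; apply: powR_third_le => //.
- by apply: Rintegral_ge0 => t _; rewrite exprn_ge0.
- by apply: sumr_ge0 => i _; apply: Rintegral_ge0 => w _; rewrite exprn_ge0.
- by apply: Rintegral_ge0 => w _; rewrite p32_ge0.
- by apply: (le_trans le3); rewrite ler_pM2l// lerD2l /Rintegral eV.
Qed.
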